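(* Let $f\colon\mathbb{R}^d\to\mathbb{R}$ be a bounded measurable function. Let $\mathcal{P}$ be a simple stationary point process on $\mathbb{R}^d$ and $\xi$ a translation invariant score function. Assume that $\mathcal{P}$ satisfies $\mathrm{EDC}(a,\hat a)$ and that $\xi$ satisfies $\mathrm{S}(b)$, $\mathrm{MG}(\beta)$ and $\mathrm{PG}(\gamma_1,\gamma_2)$ (with respect to $\mathcal{P}$). Moreover, assume that $\sigma^2(\xi)\int_{W_1} f(x)^2\,dx>0$. Then, for any $\varepsilon>0$, $$\frac{\mu_n^\xi(f)-\mathbb{E}[\mu_n^\xi(f)]}{\sqrt{n}^{\,1+\varepsilon}}\xrightarrow[n\to\infty]{}0\quad\text{almost surely.}$$
   Context: Notation. $\mathcal{N}$ is the set of locally finite simple point sets in $\mathbb{R}^d$; $\mathcal{X}(B)$ is the number of points of $\mathcal{X}$ in $B$; $B_r(x)=\{y\in\mathbb{R}^d:\|x-y\|\le r\}$. $W_n=[-\frac12 n^{1/d},\frac12 n^{1/d}]^d$, $\mathcal{P}_n=\mathcal{P}\cap W_n$ for $n\in\mathbb{N}$, and $\mathcal{P}_\infty=\mathcal{P}$, $W_\infty=\mathbb{R}^d$. For $\boldsymbol{x}=(x_1,\dots,x_p)\in(\mathbb{R}^d)^p$ and $I\subseteq\{1,\dots,p\}$ put $\boldsymbol{x}_I=(x_i)_{i\in I}$, $\mathrm{dist}(\boldsymbol{x},\boldsymbol{y})=\min_{i,j}\|x_i-y_j\|$; $\boldsymbol{x}$ is distinct if its components are pairwise distinct. Correlation functions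 and Palm measures. $\mathcal{P}$ is a simple stationary (law invariant under translations) point process on $\mathbb{R}^d$. Its $p$-point correlation function $\rho^{(p)}$ satisfies $\mathbb{E}[\prod_{i=1}^p\mathcal{P}(B_i)]=\int_{B_1\times\dots\times B_p}\rho^{(p)}(\boldsymbol{x})\,d\boldsymbol{x}$ for mutually disjoint bounded Borel sets $B_1,\dots,B_p$, and vanishes at non-distinct $\boldsymbol{x}$. The Palm measures $\mathbb{P}_{\boldsymbol{x}}$ on $\mathcal{N}$ (with expectation $\mathbb{E}_{\boldsymbol{x}}$) are the $\rho^{(p)}(\boldsymbol{x})d\boldsymbol{x}$-a.e. unique measures with $\mathbb{E}\big[\sum_{\boldsymbol{x}\in\mathcal{P}^p,\ \boldsymbol{x}\text{ distinct}}f(\boldsymbol{x};\mathcal{P})\big]=\int_{(\mathbb{R}^d)^p}\int_{\mathcal{N}}f(\boldsymbol{x};\mu)\,d\mathbb{P}_{\boldsymbol{x}}(\mu)\,\rho^{(p)}(\boldsymbol{x})\,d\boldsymbol{x}$. Score functions. A score function is a measurable $\xi\colon\mathbb{R}^d\times\mathcal{N}\to\mathbb{R}$ with $\xi(x,\mathcal{X})=0$ if $x\notin\mathcal{X}$. It is translation invariant if $\xi(x+z,\mathcal{X}+z)=\xi(x,\mathcal{X})$ for all $z\in\mathbb{R}^d$ and $x\in\mathcal{X}\in\mathcal{N}$. The radius of stabilization $R(x,\mathcal{X})=R^\xi(x,\mathcal{X})$ is the smallest $r\in\mathbb{R}_+$ with $\xi(x,\mathcal{X}\cap B_r(x))=\xi\big(x,(\mathcal{X}\cap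 B_r(x))\cup(\mathcal{Y}\cap B_r(x)^c)\big)$ for all $\mathcal{Y}\in\mathcal{N}$ ($\infty$ if there is none). Conditions. - A function $\Phi\colon\mathbb{R}_+\to\mathbb{R}_+$ is $\hat a$-exponentially fast decaying ($\hat a>0$) if $\limsup_{s\to\infty}\log\Phi(s)/s^{\hat a}<0$, or, put differently, if there are $c,C>0$ with $\Phi(s)\le Ce^{-cs^{\hat a}}$. - $\mathcal{P}$ satisfies $\mathrm{EDC}(a,\hat a)$, with $a\in[0,1)$, $\hat a>0$, if there exist $C\ge1$ and a continuous $\hat a$-exponentially fast decaying $\Phi$ such that for all $p\ge2$, $\boldsymbol{x}\in(\mathbb{R}^d)^p$ and $\emptyset\ne I\subsetneq\{1,\dots,p\}$: $|\rho^{(p)}(\boldsymbol{x})-\rho^{(|I|)}(\boldsymbol{x}_I)\rho^{(|I^c|)}(\boldsymbol{x}_{I^c})|\le C^pp!^a\Phi(\mathrm{dist}(\boldsymbol{x}_I,\boldsymbol{x}_{I^c}))$. - $\xi$ satisfies $\mathrm{S}(b)$, $b\in\mathbb{R}_+$, if there is $C>0$ with $\sup_{1\le n\le\infty}\sup_{1\le q\le p}\sup_{\boldsymbol{x}\in W_n^q}\mathbb{E}_{\boldsymbol{x}}[|R(x_1,\mathcal{P}_n)|^p]\le C^pp!^b$ for all $p\in\mathbb{N}$. - $\xi$ satisfies $\mathrm{MG}(\beta)$, $\beta\in\mathbb{R}_+$, if there is $C\ge1$ with $\sup_{1\le n\le\infty}\sup_{1\le q\le p}\sup_{\boldsymbol{x}\in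 W_n^q}\mathbb{E}_{\boldsymbol{x}}[|\xi(x_1,\mathcal{P}_n)|^p]\le C^pp!^\beta$ for all $p\in\mathbb{N}$. - $\xi$ satisfies $\mathrm{PG}(\gamma_1,\gamma_2)$, $\gamma_1,\gamma_2\in\mathbb{R}_+$, if there is $C\ge1$ with $|\xi(x,\mathcal{X}\cap B_r(x))|\,\mathbf{1}_{\{\mathcal{X}(B_r(x))=k\}}\le C\max\{1,r\}^{\gamma_1}k^{\gamma_2}$ for all $\mathcal{X}\in\mathcal{N}$, $r>0$, $x\in\mathbb{R}^d$, $k\in\mathbb{N}$. Statistics. $\mu_n^\xi(f)=\sum_{x\in\mathcal{P}_n}\xi(x,\mathcal{P}_n)f(xn^{-1/d})$, and $\sigma^2(\xi)=\mathbb{E}_0[\xi^2(0,\mathcal{P})]\rho^{(1)}(0)+\int_{\mathbb{R}^d}(m_{1,1}(0,x)-m_1(0)^2)\,dx$ with $m_1(x)=\mathbb{E}_x[\xi(x,\mathcal{P})]\rho^{(1)}(x)$ and $m_{1,1}(x,y)=\mathbb{E}_{(x,y)}[\xi(x,\mathcal{P})\xi(y,\mathcal{P})]\rho^{(2)}(x,y)$. *)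

(* Defs.v *)
From HB Require Import structures.
From mathcomp Require Import all_boot all_order all_algebra.
From mathcomp Require Import finmap.
From mathcomp Require Import all_classical all_reals all_analysis.
From mathcomp Require Import measurable_realfun.

Set Implicit Arguments.
Unset Strict Implicit.
Unset Printing Implicit Defensive.
Import Order.TTheory GRing.Theory Num.Theory.
Import numFieldNormedType.Exports.

Local Open Scope classical_set_scope.
Local Open Scope ring_scope.

Section iso_measure.
Context (d1 d2 : measure_display) (T1 : measurableType d1)
  (T2 : measurableType d2) (R : realType).
Variables (mu : {measure set T1 -> \bar R})
  (f : {mfun T1 >-> T2}) (g : {mfun T2 >-> T1}).

(* smu and fK only serve to make the image measure canonically sigma-finite. *)
Definition iso_measure (smu : sigma_finite setT mu) (fK : cancel f g) :
  set T2 -> \bar R := pushforward mu f.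

Hypotheses (smu : sigma_finite setT mu) (fK : cancel f g).

Let iso_measure0 : iso_measure smu fK set0 = 0%E.
Proof. exact: measure0. Qed.

Let iso_measure_ge0 A : (0 <= iso_measure smu fK A)%E.
Proof. exact: measure_ge0. Qed.

Let iso_measure_sigma_additive : semi_sigma_additive (iso_measure smu fK).
Proof. exact: measure_semi_sigma_additive. Qed.

HB.instance Definition _ := isMeasure.Build _ _ _ (iso_measure smu fK)
  iso_measure0 iso_measure_ge0 iso_measure_sigma_additive.

Let iso_measure_sigma_finite : sigma_finite setT (iso_measure smu fK).
Proof.
have [F TF Foo] := smu.
exists (fun k => g @^-1` F k).
  by rewrite -preimage_bigcup -TF preimage_setT.
move=> k; have [mF muF] := Foo k; split.
  by rewrite -[X in measurable X]setTI; exact: measurable_funPT.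
rewrite /iso_measure /pushforward -comp_preimage.
by rewrite (_ : g \o f = id) //; apply/funext => x /=; rewrite fK.
Qed.

HB.instance Definition _ := Measure_isSigmaFinite.Build _ _ _
  (iso_measure smu fK) iso_measure_sigma_finite.

End iso_measure.

Section tuple_cons.
Context (disp : measure_display) (T : measurableType disp) (n : nat).

Definition tuple_cons (u : T * n.-tuple T) : n.+1.-tuple T :=
  [tuple of u.1 :: u.2].

Definition tuple_uncons (t : n.+1.-tuple T) : T * n.-tuple T :=
  (thead t, [tuple of behead t]).

Let measurable_tuple_cons : measurable_fun setT tuple_cons.
Proof. exact: measurable_cons. Qed.

Let measurable_tuple_uncons : measurable_fun setT tuple_uncons.
Proof.
apply: measurable_fun_pair; first exact: measurable_tnth.
exact: measurable_behead.
Qed.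

HB.instance Definition _ := isMeasurableFun.Build _ _ _ _ tuple_cons
  measurable_tuple_cons.

HB.instance Definition _ := isMeasurableFun.Build _ _ _ _ tuple_uncons
  measurable_tuple_uncons.

Lemma tuple_consK : cancel tuple_cons tuple_uncons.
Proof.
by case=> x t; rewrite /tuple_uncons theadE; congr pair; apply: val_inj.
Qed.

End tuple_cons.

Section sigma_finite_prod.
Context (d1 d2 : measure_display) (T1 : measurableType d1)
  (T2 : measurableType d2) (R : realType).
Variables (m1 : {sigma_finite_measure set T1 -> \bar R})
  (m2 : {sigma_finite_measure set T2 -> \bar R}).

Lemma sigma_finite_prod : sigma_finite setT (m1 \x m2)%E.
Proof.
have /sigma_finiteP[F [TF ndF Foo]] := sigma_finiteT m1.
have /sigma_finiteP[G [TG ndG Goo]] := sigma_finiteT m2.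
exists (fun n => F n `*` G n).
  rewrite -setXTT TF TG predeqE => -[x y]; split.
    move=> [/= [n _ Fnx] [k _ Gky]]; exists (maxn n k) => //; split.
    - by move: x Fnx; exact/subsetPset/ndF/leq_maxl.
    - by move: y Gky; exact/subsetPset/ndG/leq_maxr.
  by move=> [n _ []/= ? ?]; split; exists n.
move=> k; have [? ?] := Foo k; have [? ?] := Goo k.
split; first exact: measurableX.
by rewrite product_measure1E// lte_mul_pinfty// ge0_fin_numE.
Qed.

End sigma_finite_prod.

(* The n-fold product of mu, on T^n. *)
Fixpoint power_measure (disp : measure_display) (T : measurableType disp)
    (R : realType) (mu : {sigma_finite_measure set T -> \bar R}) (n : nat) :
    {sigma_finite_measure set (n.-tuple T) -> \bar R} :=
  if n is n'.+1
  then iso_measure (sigma_finite_prod mu (power_measure mu n'))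
         (@tuple_consK _ T n')
  else \d_([tuple] : 0.-tuple T).

(* The Borel sigma-algebra of R^d, as the product of the Borel sigma-algebras
   of the coordinates. *)
Section vec_measurable.
Context (R : realType) (d : nat).

Let coor (i : 'I_d) (x : 'rV[R]_d) : R := x ord0 i.

Let vec_set0 : g_sigma_preimage coor set0.
Proof. exact: sigma_algebra0. Qed.

Let vec_setC A : g_sigma_preimage coor A -> g_sigma_preimage coor (~` A).
Proof. exact: sigma_algebraC. Qed.

Let vec_bigcup (F : (set 'rV[R]_d)^nat) :
  (forall i, g_sigma_preimage coor (F i)) ->
  g_sigma_preimage coor (\bigcup_i (F i)).
Proof. exact: sigma_algebra_bigcup. Qed.

HB.instance Definition _ := @isMeasurable.Build
  (measure_tuple_display default_measure_display) 'rV[R]_d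
  (g_sigma_preimage coor) vec_set0 vec_setC vec_bigcup.

End vec_measurable.

Definition vec_of_tuple (R : realType) (d : nat) (t : d.-tuple (measurableTypeR R)) :
    'rV[R]_d :=
  \row_i tnth t i.

Definition tuple_of_vec (R : realType) (d : nat) (x : 'rV[R]_d) :
    d.-tuple (measurableTypeR R) :=
  [tuple x ord0 i | i < d].

Lemma tuple_of_vecK (R : realType) (d : nat) :
  cancel (@vec_of_tuple R d) (@tuple_of_vec R d).
Proof.
by move=> t; apply: eq_from_tnth => i; rewrite tnth_mktuple mxE.
Qed.

Section lebesgue_vec.
Context (R : realType) (d : nat).

Let measurable_tuple_of_vec : measurable_fun setT (@tuple_of_vec R d).
Proof.
apply/measurable_fun_tnthP => i; rewrite (_ : _ \o _ = (fun x : 'rV[R]_d => x ord0 i)).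
  move=> _ A mA; rewrite setTI; apply: sub_sigma_algebra => /=.
  rewrite -bigcup_seq/=; exists i => /=; first by rewrite mem_index_enum.
  by exists A => //; rewrite setTI.
by apply/funext => x /=; rewrite tnth_mktuple.
Qed.

Let measurable_vec_of_tuple : measurable_fun setT (@vec_of_tuple R d).
Proof.
move=> _ A mA; rewrite setTI.
have : g_sigma_preimage (fun (i : 'I_d) (t : d.-tuple (measurableTypeR R)) =>
    vec_of_tuple t ord0 i) (@vec_of_tuple R d @^-1` A).
  rewrite (g_sigma_preimage_comp (fun (i : 'I_d) (x : 'rV[R]_d) => x ord0 i)).
  by exists A => //; rewrite setTI.
congr (g_sigma_preimage _ _).
by apply/funext => i; apply/funext => t; rewrite mxE.
Qed.

HB.instance Definition _ := isMeasurableFun.Build _ _ _ _ (@tuple_of_vec R d)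
  measurable_tuple_of_vec.

HB.instance Definition _ := isMeasurableFun.Build _ _ _ _ (@vec_of_tuple R d)
  measurable_vec_of_tuple.

Definition lebesgue_vec : {sigma_finite_measure set 'rV[R]_d -> \bar R} :=
  iso_measure
    (sigma_finiteT (power_measure (@lebesgue_measure R) d))
    (@tuple_of_vecK R d).

End lebesgue_vec.

Section euclidean.
Context (R : realType) (d : nat).
Local Notation E := 'rV[R]_d.

(* The norm `|x| of the library is the max norm. *)
Definition enorm (x : E) : R := Num.sqrt (\sum_(i < d) x ord0 i ^+ 2).

Definition cball (x : E) (r : R) : set E := [set y | enorm (x - y) <= r].

(* None stands for n = oo. *)
Definition window (n : option nat) : set E :=
  if n is Some m
  then [set x | forall i, `|x ord0 i| <= 2^-1 * (m%:R `^ d%:R^-1)]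
  else setT.

Definition locally_finite (A : set E) :=
  forall B, bounded_set B -> finite_set (A `&` B).

Record config := Config {
  points :> set E;
  points_locally_finite : locally_finite points }.

Lemma locally_finite0 : locally_finite set0.
Proof. by move=> B _; rewrite set0I. Qed.

Lemma locally_finiteI (X : config) (A : set E) : locally_finite (X `&` A).
Proof.
move=> B bB; apply: sub_finite_set (points_locally_finite X bB).
by move=> x [[Xx _] Bx].
Qed.

Lemma locally_finiteU (X Y : config) : locally_finite (X `|` Y).
Proof.
move=> B bB; rewrite setIUl finite_setU.
by split; exact: points_locally_finite.
Qed.

Lemma bounded_set_shift (B : set E) (z : E) :
  bounded_set B -> bounded_set [set x | B (x + z)].
Proof.
move=> [M [_ BM]]; exists (M + 1 + `|z|); split; first exact: num_real.
move=> N MN x /= Bxz.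
have M1 : M < M + 1 by rewrite ltrDl.
apply: (le_trans _ (ltW MN)); rewrite -[x in leLHS](addrK z).
by rewrite (le_trans (ler_normB _ _)) // lerD2r; exact: (BM _ M1).
Qed.

Lemma locally_finite_shift (X : config) (z : E) :
  locally_finite [set x + z | x in X].
Proof.
move=> B bB.
apply: (@sub_finite_set _ _ [set x + z | x in X `&` [set x | B (x + z)]]).
  by move=> _ [[x Xx <-] Bxz]; exists x.
exact/finite_image/points_locally_finite/bounded_set_shift.
Qed.

Definition config0 : config := Config locally_finite0.
Definition config_cap (X : config) (A : set E) : config :=
  Config (@locally_finiteI X A).
Definition config_cup (X Y : config) : config := Config (@locally_finiteU X Y).
Definition config_shift (X : config) (z : E) : config :=
  Config (@locally_finite_shift X z).

(* Meaningful for bounded B only. *)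
Definition npts (X : config) (B : set E) : nat := #|`fset_set (X `&` B)|%fset.

HB.instance Definition _ := gen_eqMixin config.
HB.instance Definition _ := gen_choiceMixin config.
HB.instance Definition _ := isPointed.Build config config0.

Definition count_events : set (set config) :=
  [set A | exists (B : set E) (k : nat),
    [/\ measurable B, bounded_set B & A = [set X | npts X B = k]]].

HB.instance Definition _ := Measurable.copy config
  (g_sigma_algebraType count_events).

End euclidean.

Section point_processes.
Context (R : realType) (d : nat).
Local Notation E := 'rV[R]_d.
Local Notation N := (config R d).

(* Simplicity is built into the state space: points carry no multiplicity. *)
Definition stationary (disp : measure_display) (Omega : measurableType disp)
    (P : probability Omega R) (pp : {RV P >-> N}) :=
  forall (z : E) (A : set N), measurable A ->
    P [set w | A (config_shift (pp w) z)] = P [set w | A (pp w)].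

(* Correlation functions and Palm measures are only determined almost
   everywhere: rho and palm are arbitrary versions, and the conditions below
   that are imposed at every x refer to these versions. *)
Definition is_correlation (disp : measure_display)
    (Omega : measurableType disp) (P : probability Omega R)
    (pp : {RV P >-> N}) (rho : forall p, p.-tuple E -> R) :=
  forall p, (0 < p)%N ->
    [/\ measurable_fun setT (rho p),
        forall x, 0 <= rho p x,
        forall x : p.-tuple E, ~~ uniq x -> rho p x = 0 &
        forall B : 'I_p -> set E,
          (forall i, measurable (B i)) -> (forall i, bounded_set (B i)) ->
          trivIset setT B ->
          ('E_P[fun w => (\prod_(i < p) npts (pp w) (B i))%:R] =
           \int[power_measure (lebesgue_vec R d) p]_(x in
             [set x : p.-tuple E | forall i, B i (tnth x i)])
             (rho p x)%:E)%E].

Definition is_palm (disp : measure_display)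
    (Omega : measurableType disp) (P : probability Omega R)
    (pp : {RV P >-> N}) (rho : forall p, p.-tuple E -> R)
    (palm : forall p, R.-pker p.-tuple E ~> N) :=
  forall p, (0 < p)%N ->
  forall f : p.-tuple E * N -> \bar R,
    measurable_fun setT f -> (forall u, (0 <= f u)%E) ->
    (\int[P]_w (\esum_(x in [set x : p.-tuple E |
        uniq x /\ forall i, points (pp w) (tnth x i)]) f (x, pp w)) =
     \int[power_measure (lebesgue_vec R d) p]_x
       ((\int[palm p x]_X f (x, X)) * (rho p x)%:E))%E.

Definition score_function (xi : E -> N -> R) :=
  measurable_fun setT (fun u : E * N => xi u.1 u.2) /\
  forall x (X : N), ~ points X x -> xi x X = 0.

Definition translation_invariant (xi : E -> N -> R) :=
  forall (z x : E) (X : N), points X x -> xi (x + z) (config_shift X z) = xi x X.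

Definition stabilizes_at (xi : E -> N -> R) (x : E) (X : N) (r : R) :=
  forall Y : N, xi x (config_cap X (cball x r)) =
    xi x (config_cup (config_cap X (cball x r)) (config_cap Y (~` cball x r))).

(* Stabilization passes to larger radii, and the infimum below is attained
   when it is finite, since X and each Y are locally finite and the balls are
   closed. It is +oo when there is no radius of stabilization. *)
Definition stab_radius (xi : E -> N -> R) (x : E) (X : N) : \bar R :=
  ereal_inf [set r%:E | r in [set r | 0 <= r /\ stabilizes_at xi x X r]].

(* Phi is a function on R_+, and its values at negative reals are ignored. *)
Definition fast_decaying (ahat : R) (Phi : R -> R) :=
  exists c C, [/\ 0 < c, 0 < C &
    forall s, 0 <= s -> Phi s <= C * expR (- c * s `^ ahat)].

Definition subtuple (p : nat) (x : p.-tuple E) (I : {set 'I_p}) :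
  #|I|.-tuple E := [tuple tnth x (enum_val i) | i < #|I|].

Definition tdist (p q : nat) (x : p.-tuple E) (y : q.-tuple E) : R :=
  inf [set enorm (tnth x i - tnth y j) | i in setT & j in setT].

Definition EDC (rho : forall p, p.-tuple E -> R) (a ahat : R) :=
  exists (C : R) (Phi : R -> R),
    [/\ 1 <= C,
        forall s, 0 <= s -> 0 <= Phi s,
        {within `[0, +oo[, continuous Phi},
        fast_decaying ahat Phi &
        forall (p : nat) (x : p.-tuple E) (I : {set 'I_p}),
          (2 <= p)%N -> I != finset.set0 -> I \proper finset.setT ->
          `|rho p x -
            rho #|I| (subtuple x I) * rho #|~: I| (subtuple x (~: I))|
          <= C ^+ p * p`!%:R `^ a *
             Phi (tdist (subtuple x I) (subtuple x (~: I)))].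

(* In the next two conditions the number of points of x is q.+1 and x_1 is
   thead x. Palm expectations are taken in the extended reals. *)
Definition stabilization (palm : forall p, R.-pker p.-tuple E ~> N)
    (xi : E -> N -> R) (b : R) :=
  exists2 C : R, 0 < C &
    forall (p q : nat) (n : option nat) (x : q.+1.-tuple E),
      (q < p)%N -> n <> Some 0%N -> (forall i, window n (tnth x i)) ->
      (\int[palm q.+1 x]_X
         (`|stab_radius xi (thead x) (config_cap X (window n))| ^+ p)
       <= (C ^+ p * p`!%:R `^ b)%:E)%E.

Definition moment_growth (palm : forall p, R.-pker p.-tuple E ~> N)
    (xi : E -> N -> R) (beta : R) :=
  exists2 C : R, 1 <= C &
    forall (p q : nat) (n : option nat) (x : q.+1.-tuple E),
      (q < p)%N -> n <> Some 0%N -> (forall i, window n (tnth x i)) ->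
      (\int[palm q.+1 x]_X
         (`|xi (thead x) (config_cap X (window n))| ^+ p)%:E
       <= (C ^+ p * p`!%:R `^ beta)%:E)%E.

Definition power_growth (xi : E -> N -> R) (gamma1 gamma2 : R) :=
  exists2 C : R, 1 <= C &
    forall (X : N) (r : R) (x : E) (k : nat), 0 < r ->
      `|xi x (config_cap X (cball x r))| * (npts X (cball x r) == k)%:R
      <= C * Num.max 1 r `^ gamma1 * k%:R `^ gamma2.

Definition statistic (xi : E -> N -> R) (f : E -> R) (n : nat) (X : N) : R :=
  let Xn := config_cap X (window (Some n)) in
  \sum_(x \in points Xn) xi x Xn * f (n%:R `^ (- d%:R^-1) *: x).

Definition corr1 (rho : forall p, p.-tuple E -> R)
    (palm : forall p, R.-pker p.-tuple E ~> N) (xi : E -> N -> R) (x : E) : R :=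
  (\int[palm 1%N [tuple x]]_X xi x X) * rho 1%N [tuple x].

Definition corr11 (rho : forall p, p.-tuple E -> R)
    (palm : forall p, R.-pker p.-tuple E ~> N) (xi : E -> N -> R)
    (x y : E) : R :=
  (\int[palm 2%N [tuple x; y]]_X (xi x X * xi y X)) * rho 2%N [tuple x; y].

Definition sigma2 (rho : forall p, p.-tuple E -> R)
    (palm : forall p, R.-pker p.-tuple E ~> N) (xi : E -> N -> R) : R :=
  (\int[palm 1%N [tuple 0]]_X (xi 0 X ^+ 2)) * rho 1%N [tuple 0] +
  \int[lebesgue_vec R d]_x
    (corr11 rho palm xi 0 x - corr1 rho palm xi 0 ^+ 2).

End point_processes.

(* Main.v *)
Require Import Defs.
From HB Require Import structures.
From mathcomp Require Import all_boot all_order all_algebra.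
From mathcomp Require Import finmap.
From mathcomp Require Import all_classical all_reals all_analysis.
From mathcomp Require Import measurable_realfun.
From mathcomp Require Import ring lra zify.

Set Implicit Arguments.
Unset Strict Implicit.
Unset Printing Implicit Defensive.
Import Order.TTheory GRing.Theory Num.Theory.
Import numFieldNormedType.Exports.

Local Open Scope classical_set_scope.
Local Open Scope ring_scope.

(** Cut R^d into unit cubes and, for a point x of a cube Q, replace the score
    of x by the score computed from the points within distance about u of Q,
    set to 0 when it exceeds u. Under the Palm measure at x, Markov's
    inequality and the moments of the stabilization radius and of the score
    bound the error by any negative power of u, so that the statistic changes
    by O(n^-2) in L^1 when u is a small power of n. In the new statistic, the
    contribution of a cube only depends on a bounded region. Expanding such
    local functionals in factorial moments and applying the Campbell formula
    and the decay of correlations, contributions of cubes at distance of order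
    u^J have covariances smaller than every power of u; the factorials
    converge because a < 1. Group the cubes into classes of pairwise distant
    ones. Within a class the even moments behave as for independent variables,
    so the centered moment of order 2k+2 is O(n^(k+2)), where the spare factor
    n absorbs the powers of u. For k eps large, the normalized moments and the
    L^1 errors are summable, and random variables with summable expectations
    tend to 0 almost surely. *)

(** * Moments and almost sure convergence *)

(** The decoupling has a price. For regions of volume v the factorial series, the sums of t^m m!^a /
    m! with t of order v, are only bounded by an exponential of v^q, where q (1 - a) >= 1. With v of
    order u^d this is the exponential of a multiple of u^(d q). At distance u^J the correlations
    decay like expR (- c u^(J ahat)), so the choice J ahat >= d q + 1 pays the price and still
    leaves every negative power of u. The centered moments of a single cube must avoid this price:
    they are bounded through the number of points of the unit cube alone, not of its neighbourhood,
    and cost only a power of u. The order 2k+2 comes from the normalization, whose power of that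
    order is n^((k+1)(1+eps)). This is at least n^(k+4) once (k+1) eps >= 3, so that the moment
    bound n^(k+2) leaves the summable n^-2. *)

Ltac nonneg := repeat first [ assumption | exact: expR_ge0 | exact: powR_ge0
  | exact: ler0n | exact: normr_ge0 | apply: ltW; assumption | apply: exprn_ge0
  | rewrite invr_ge0 | apply: addr_ge0 | apply: mulr_ge0 ].

Lemma exprn_fact_le_expR (R : realType) (u : R) (m : nat) :
  0 <= u -> u ^+ m / m`!%:R <= expR u.
Proof.
move=> u0; case: m => [|m]; first by rewrite expr0 divr1 (le_trans _ (expR_ge1Dx u)) // lerDl.
by apply: (le_trans _ (expR_ge1Dxn m u0)); rewrite lerDr.
Qed.

(** With u = (2 t)^q, the q-th power of (2 t)^m m!^a / m! is at most u^m / m!, because q (1 - a) >=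
    1, hence at most [expR u], which is below its own q-th power. The factor 2^-m split off from t^m
    gives a geometric series of sum at most 2. *)
Lemma powR_fact_series_le (R : realType) (a t : R) (q M : nat) :
  0 <= a -> 1 <= q%:R * (1 - a) -> 0 <= t ->
  \sum_(m < M) t ^+ m * m`!%:R `^ a / m`!%:R <= 2 * expR ((2 * t) ^+ q).
Proof.
move=> a0 qa t0.
have q0 : (0 < q)%N.
  by case: q qa => //; rewrite mul0r ler10.
set u := (2 * t) ^+ q.
have u0 : 0 <= u by rewrite exprn_ge0 // mulr_ge0.
have key m : (2 * t) ^+ m * m`!%:R `^ a / m`!%:R <= expR u.
  have f1 : (1 : R) <= m`!%:R by rewrite ler1n fact_gt0.
  have f0 : (0 : R) < m`!%:R by apply: lt_le_trans f1.
  rewrite -(@ler_pXn2r _ q) // ?nnegrE ?expR_ge0 //; last first.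
    by rewrite !mulr_ge0 ?exprn_ge0 ?powR_ge0 ?invr_ge0 ?mulr_ge0 // ltW.
  apply: (@le_trans _ _ (expR u)); last first.
    by rewrite -expRM_natl; rewrite ler_expR ler_peMl // ler1n.
  apply: (le_trans _ (exprn_fact_le_expR m u0)).
  have -> : ((2 * t) ^+ m * m`!%:R `^ a / m`!%:R) ^+ q =
      u ^+ m * (m`!%:R `^ a ^+ q / m`!%:R ^+ q).
    by rewrite 2!exprMn exprVn /u -!exprM mulnC mulrA.
  apply: ler_wpM2l; first by rewrite exprn_ge0.
  rewrite -powR_mulrn ?powR_ge0 // -powRrM ler_pdivrMr ?exprn_gt0 //.
  rewrite -{2}[q]prednK // exprS mulrA mulVf ?mul1r ?gt_eqF //.
  rewrite -powR_mulrn ?(ltW f0) //; apply: (ler_powR f1).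
  by rewrite -subn1 natrB //; lra.
apply: (@le_trans _ _ (\sum_(m < M) (2^-1 ^+ m * expR u))).
  apply: ler_sum => m _.
  have := key m; rewrite exprMn -!mulrA => {}key.
  by rewrite exprVn -ler_pdivrMl ?invr_gt0 ?exprn_gt0 // invrK.
rewrite -mulr_suml ler_wpM2r ?expR_ge0 //.
have -> : \sum_(m < M) (2^-1 : R) ^+ m = 2 - 2 * 2^-1 ^+ M.
  elim: M => [|M IH]; first by rewrite big_ord0 expr0; lra.
  by rewrite big_ord_recr /= IH exprS; lra.
by rewrite lerBlDr lerDl mulr_ge0 // exprn_ge0 // invr_ge0.
Qed.

Lemma exprn_double_ge0 (R : realDomainType) (x : R) (k : nat) : 0 <= x ^+ k.*2.
Proof. by rewrite exprn_even_ge0 // odd_double. Qed.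

Lemma exprn_doubleS_ge0 (R : realDomainType) (x : R) (k : nat) :
  0 <= x ^+ k.*2.+2.
Proof. by rewrite -doubleS exprn_double_ge0. Qed.

(** The terms of degree 0 and 1 in z are kept exactly, since the linear one will be small by
    decoupling and not by size. In the others, z^2 is factored out and the remaining monomial is at
    most t^(2k) or z^(2k), according to which of |t| and |z| is larger. All binomial coefficients
    together sum to 4^(k+1). *)
Lemma exprD_even_le (R : realType) (t z : R) (k : nat) :
  (t + z) ^+ (k.*2.+2) <= t ^+ (k.*2.+2) + (k.*2.+2)%:R * (t ^+ (k.*2.+1) * z) +
    4 ^+ k.+1 * (t ^+ k.*2 * z ^+ 2 + z ^+ k.*2.+2).
Proof.
rewrite exprDn; under eq_bigr do rewrite -mulr_natl.
rewrite 2!big_ord_recl /= expr0 mulr1 subn0 bin0 mul1r.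
rewrite /bump /= expr1 bin1 subSS subn0 addrA lerD2l.
set B := t ^+ k.*2 * z ^+ 2 + z ^+ k.*2.+2.
have B0 : 0 <= B.
  apply: addr_ge0; last exact: exprn_doubleS_ge0.
  by apply: mulr_ge0; [exact: exprn_double_ge0|exact: sqr_ge0].
have -> : (4 : R) ^+ k.+1 = \sum_(i < k.*2.+3) 'C(k.*2.+2, i)%:R.
  rewrite -natr_sum.
  have -> : (4 : R) = 2 ^+ 2 by rewrite expr2 -natrM.
  rewrite -exprM mulnC muln2 doubleS -natrX; congr (_%:R).
  rewrite (_ : 2 = 1 + 1)%N // expnDn.
  by apply: eq_bigr => i _; rewrite !exp1n !muln1.
rewrite [X in _ <= X * _]big_ord_recl [X in _ <= (_ + X) * _]big_ord_recl /=.
rewrite mulrDl mulrDl addrA ler_wpDl ?addr_ge0 // ?mulr_ge0 //.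
rewrite mulr_suml; apply: ler_sum => -[i ik] _ /=; rewrite /bump /= !add1n.
apply: ler_wpM2l => //.
rewrite !subSS -[i.+2]addn2 exprD [z ^+ 2](_ : _ = `|z| ^+ 2); last first.
  by rewrite real_normK // num_real.
rewrite mulrA; apply: (le_trans (ler_norm _)); rewrite 2!normrM !normrX normr_id.
have -> : B = (`|t| ^+ k.*2 + `|z| ^+ k.*2) * `|z| ^+ 2.
  rewrite /B mulrDl -exprD addn2 -!normrX (ger0_norm (exprn_double_ge0 t k)).
  by rewrite (ger0_norm (exprn_doubleS_ge0 z k)) (ger0_norm (sqr_ge0 z)).
apply: ler_wpM2r; first by rewrite exprn_ge0.
have ik' : (i <= k.*2)%N by rewrite -ltnS -ltnS.
have [tz|zt] := leP `|t| `|z|.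
  apply: ler_wpDl; first by rewrite exprn_ge0.
  by rewrite -[X in _ <= _ ^+ X](subnK ik') exprD ler_wpM2r ?exprn_ge0 // lerXn2r ?nnegrE.
apply: ler_wpDr; first by rewrite exprn_ge0.
by rewrite -[X in _ <= _ ^+ X](subnK ik') exprD ler_wpM2l ?exprn_ge0 // lerXn2r ?nnegrE // ltW.
Qed.

(** Young's inequality with weight 1/N, by cases: either z^2 <= t^2 / N, and the first term
    suffices, or t^2 < N z^2, and the second one does. *)
Lemma exprM2_young (R : realType) (t z : R) (k N : nat) : (0 < N)%N ->
  t ^+ k.*2 * z ^+ 2 <= N%:R^-1 * t ^+ k.*2.+2 + N%:R ^+ k * z ^+ k.*2.+2.
Proof.
move=> N0; have N0' : (0 : R) < N%:R by rewrite ltr0n.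
have [h|h] := leP (z ^+ 2) (N%:R^-1 * t ^+ 2).
  apply: ler_wpDr; first by apply: mulr_ge0; [exact: exprn_ge0|exact: exprn_doubleS_ge0].
  rewrite -[k.*2.+2]addn2 exprD [X in _ <= X]mulrCA; apply: ler_wpM2l => //.
  exact: exprn_double_ge0.
apply: ler_wpDl.
  by apply: mulr_ge0; [rewrite invr_ge0 ltW|exact: exprn_doubleS_ge0].
rewrite -[k.*2.+2]addn2 exprD mulrA; apply: ler_wpM2r; first exact: sqr_ge0.
rewrite -muln2 mulnC !exprM -exprMn; apply: lerXn2r; rewrite ?nnegrE ?sqr_ge0 //.
  by apply: mulr_ge0; [exact: ltW|exact: sqr_ge0].
by rewrite -ler_pdivrMl //; exact: ltW.
Qed.

Lemma ler_norm_sum_size (R : numDomainType) (I : eqType) (s : seq I)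
    (F : I -> R) (c : R) :
  (forall i, i \in s -> `|F i| <= c) -> `|\sum_(i <- s) F i| <= (size s)%:R * c.
Proof.
elim: s => [_|i s IH h]; first by rewrite big_nil normr0 mul0r.
rewrite big_cons /= -natr1 mulrDl mul1r addrC.
apply: le_trans (ler_normD _ _) _; apply: lerD; last by rewrite h ?mem_head.
by apply: IH => j js; apply: h; rewrite inE js orbT.
Qed.

Section moment_algebra.
Context d (T : measurableType d) (R : realType) (P : probability T R).

(* A class of random variables stable under the algebra operations and
   contained in L^1, hence one whose members have all moments. *)
Definition moment_algebra (adm : (T -> R) -> Prop) :=
  [/\ forall X, adm X -> P.-integrable setT (EFin \o X),
      forall c, adm (fun=> c),
      forall X Y, adm X -> adm Y -> adm (fun w => X w + Y w) &
      forall X Y, adm X -> adm Y -> adm (fun w => X w * Y w)].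

Context (adm : (T -> R) -> Prop).
Hypothesis algA : moment_algebra adm.

Lemma adm_integrable X : adm X -> P.-integrable setT (EFin \o X).
Proof. by case: algA => + _ _ _; exact. Qed.

Lemma adm_cst c : adm (fun=> c).
Proof. by case: algA => _ + _ _; exact. Qed.

Lemma admD X Y : adm X -> adm Y -> adm (fun w => X w + Y w).
Proof. by case: algA => _ _ + _; exact. Qed.

Lemma admM X Y : adm X -> adm Y -> adm (fun w => X w * Y w).
Proof. by case: algA => _ _ _ +; exact. Qed.

Lemma admZ c X : adm X -> adm (fun w => c * X w).
Proof. by move=> aX; apply: admM => //; exact: adm_cst. Qed.

Lemma admB X Y : adm X -> adm Y -> adm (fun w => X w - Y w).
Proof.
move=> aX aY; rewrite (_ : (fun w => _) = (fun w => X w + (-1) * Y w)).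
  by apply: admD => //; exact: admZ.
by apply/funext => w; rewrite mulN1r.
Qed.

Lemma admX X n : adm X -> adm (fun w => X w ^+ n).
Proof.
move=> aX; elim: n => [|n IH].
  by rewrite (_ : (fun w => _) = (fun=> 1)); [exact: adm_cst|].
rewrite (_ : (fun w => _) = (fun w => X w * X w ^+ n)); first exact: admM.
by apply/funext => w; rewrite exprS.
Qed.

Lemma adm_sum (I : Type) (s : seq I) (X : I -> T -> R) :
  (forall i, adm (X i)) -> adm (fun w => \sum_(i <- s) X i w).
Proof.
move=> aX; elim: s => [|i s IH].
  rewrite (_ : (fun w => _) = (fun=> 0)); first exact: adm_cst.
  by apply/funext => w; rewrite big_nil.
rewrite (_ : (fun w => _) = (fun w => X i w + \sum_(j <- s) X j w)).
  exact: admD.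
by apply/funext => w; rewrite big_cons.
Qed.

Lemma adm_prod (I : Type) (s : seq I) (X : I -> T -> R) :
  (forall i, adm (X i)) -> adm (fun w => \prod_(i <- s) X i w).
Proof.
move=> aX; elim: s => [|i s IH].
  rewrite (_ : (fun w => _) = (fun=> 1)); first exact: adm_cst.
  by apply/funext => w; rewrite big_nil.
rewrite (_ : (fun w => _) = (fun w => X i w * \prod_(j <- s) X j w)).
  exact: admM.
by apply/funext => w; rewrite big_cons.
Qed.

Local Notation E X := (\int[P]_w (X w)).

Lemma expD X Y : adm X -> adm Y ->
  \int[P]_w (X w + Y w) = \int[P]_w X w + \int[P]_w Y w.
Proof. by move=> aX aY; apply: RintegralD => //; exact: adm_integrable. Qed.

Lemma expB X Y : adm X -> adm Y ->
  \int[P]_w (X w - Y w) = \int[P]_w X w - \int[P]_w Y w.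
Proof. by move=> aX aY; apply: RintegralB => //; exact: adm_integrable. Qed.

Lemma expZ c X : adm X -> \int[P]_w (c * X w) = c * \int[P]_w X w.
Proof. by move=> aX; apply: RintegralZl => //; exact: adm_integrable. Qed.

Lemma exp_cst c : \int[P]_w c = c.
Proof. by rewrite Rintegral_cst // [X in fine X](_ : _ = 1%E) ?mulr1 //; exact: probability_setT. Qed.

Lemma exp_le X Y : adm X -> adm Y -> (forall w, X w <= Y w) ->
  \int[P]_w X w <= \int[P]_w Y w.
Proof. by move=> aX aY XY; apply: le_Rintegral => //; exact: adm_integrable. Qed.

Lemma exp_sum (I : Type) (s : seq I) (X : I -> T -> R) :
  (forall i, adm (X i)) ->
  \int[P]_w (\sum_(i <- s) X i w) = \sum_(i <- s) \int[P]_w X i w.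
Proof.
move=> aX; elim: s => [|i s IH].
  under eq_Rintegral do rewrite big_nil.
  by rewrite big_nil exp_cst.
under eq_Rintegral do rewrite big_cons.
by rewrite big_cons expD // ?IH //; exact: adm_sum.
Qed.

Lemma exp_norm_le X Y : adm X -> adm Y -> (forall w, `|X w| <= Y w) ->
  `|\int[P]_w X w| <= \int[P]_w Y w.
Proof.
move=> aX aY XY; rewrite ler_norml; apply/andP; split.
  rewrite lerNl -mulN1r -expZ //; apply: exp_le => //; first exact: admZ.
  by move=> w; rewrite mulN1r (le_trans _ (XY w)) // -normrN ler_norm.
by apply: exp_le => // w; rewrite (le_trans _ (XY w)) // ler_norm.
Qed.

(* The Z i are added one at a time: with N := size s, the power
   (T + Z)^(2k+2) is at most T^(2k+2) + (2k+2) T^(2k+1) Z +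
   4^(k+1) (T^(2k+2) / N + (N^k + 1) Z^(2k+2)), the linear term is controlled
   by t, and (1 + 4^(k+1) / N)^N by expR (4^(k+1)). *)
Lemma even_moment_le (I : eqType) (Z : I -> T -> R) (k : nat) (K t : R)
    (s : seq I) : 0 <= t -> uniq s -> (forall i, adm (Z i)) ->
  (forall i, i \in s -> \int[P]_w Z i w ^+ k.*2.+2 <= K) ->
  (forall i js, i \in s -> size js = k.*2.+1 -> {subset js <= s} ->
    i \notin js -> `|\int[P]_w (Z i w * \prod_(j <- js) Z j w)| <= t) ->
  \int[P]_w (\sum_(i <- s) Z i w) ^+ k.*2.+2 <=
  expR (4 ^+ k.+1) * ((size s)%:R * (k.*2.+2%:R * (size s)%:R ^+ k.*2.+1 * t +
    4 ^+ k.+1 * (((size s)%:R ^+ k + 1) * K))).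
Proof.
move=> t0 us aZ ZK Zt; set N := size s.
have [N0|N0] := posnP N.
  rewrite /N; have -> : s = [::] by exact: size0nil.
  under eq_Rintegral do rewrite big_nil expr0n /=.
  by rewrite exp_cst mul0r mulr0.
have N0' : (0 : R) < N%:R by rewrite ltr0n.
set D := _ + _.
(* Induction on the exponent: one factor of the power is expanded and its index moved to [js]. Once
   [js] has 2k+1 entries the decoupling hypothesis applies, since [i :: s'] is duplicate-free and so
   i is not in [js]. *)
have expand s' i : uniq (i :: s') -> {subset i :: s' <= s} -> forall m js,
    (size js + m = k.*2.+1)%N -> {subset js <= s'} ->
    `|\int[P]_w (Z i w * \prod_(j <- js) Z j w * (\sum_(j <- s') Z j w) ^+ m)|
      <= (size s')%:R ^+ m * t.
  move=> ui sub; elim => [|m IH] js hs hsub.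
    under eq_Rintegral do rewrite expr0 mulr1.
    rewrite expr0 mul1r; apply: Zt.
    - by apply: sub; rewrite mem_head.
    - by rewrite -hs addn0.
    - by move=> j /hsub js'; apply: sub; rewrite inE js' orbT.
    - by move: ui => /= /andP[+ _]; apply: contra => /hsub.
  have -> : \int[P]_w (Z i w * \prod_(j <- js) Z j w *
      (\sum_(j <- s') Z j w) ^+ m.+1) =
      \sum_(l <- s') \int[P]_w (Z i w * \prod_(j <- l :: js) Z j w *
      (\sum_(j <- s') Z j w) ^+ m).
    rewrite -exp_sum; last first.
      move=> l; apply: admM; last by apply: admX; exact: adm_sum.
      by apply: admM => //; exact: adm_prod.
    apply: eq_Rintegral => w _; rewrite exprS mulrA mulr_sumr mulr_suml.
    by apply: eq_bigr => l _; rewrite big_cons; ring.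
  rewrite exprS -mulrA; apply: ler_norm_sum_size => l ls.
  apply: IH; first by rewrite /= -hs addSnnS.
  by move=> j; rewrite inE => /orP[/eqP ->//|/hsub].
have K0 : 0 <= K.
  move: N0; rewrite /N; case: (s) ZK => // i s' /(_ i (mem_head _ _)) + _.
  apply: le_trans; rewrite -(exp_cst 0); apply: exp_le => //.
  - exact: adm_cst.
  - exact: admX.
  - by move=> w; exact: exprn_doubleS_ge0.
have D0 : 0 <= D.
  by rewrite /D; nonneg.
have main : forall s', uniq s' -> {subset s' <= s} ->
   \int[P]_w (\sum_(i <- s') Z i w) ^+ k.*2.+2 <=
   (1 + 4 ^+ k.+1 / N%:R) ^+ (size s') * ((size s')%:R * D).
  elim => [|i s' IH] us' sub.
    under eq_Rintegral do rewrite big_nil expr0n /=.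
    by rewrite exp_cst !mul0r mulr0.
  have us'' : uniq s' by case/andP: us'.
  have sub' : {subset s' <= s} by move=> j js; apply: sub; rewrite inE js orbT.
  have ss : (size s' <= N)%N by exact: uniq_leq_size.
  pose S w := \sum_(j <- s') Z j w.
  have aS : adm S by exact: adm_sum.
  have {}IH := IH us'' sub'.
  apply: (@le_trans _ _ ((1 + 4 ^+ k.+1 / N%:R) * \int[P]_w S w ^+ k.*2.+2 + D)).
    apply: (@le_trans _ _ (\int[P]_w ((1 + 4 ^+ k.+1 / N%:R) * S w ^+ k.*2.+2 +
        (k.*2.+2%:R * (Z i w * \prod_(j <- [::]) Z j w * S w ^+ k.*2.+1) +
        (4 ^+ k.+1 * (N%:R ^+ k + 1)) * Z i w ^+ k.*2.+2)))).
      apply: exp_le.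
      - by apply: admX; exact: adm_sum.
      - apply: admD; first by apply: admZ; exact: admX.
        apply: admD; apply: admZ; last exact: admX.
        by apply: admM; [apply: admM => //; exact: adm_prod|exact: admX].
      - move=> w; rewrite big_nil mulr1 big_cons addrC.
        apply: le_trans (exprD_even_le _ _ _) _.
        have := exprM2_young (S w) (Z i w) k N0.
        have h4 : (0 : R) <= 4 ^+ k.+1 by rewrite exprn_ge0.
        move=> /(ler_wpM2l h4); rewrite -/(S w); lra.
    rewrite expD; last 2 first.
    - by apply: admZ; exact: admX.
    - apply: admD; apply: admZ; last exact: admX.
      by apply: admM; [apply: admM => //; exact: adm_prod|exact: admX].
    rewrite expZ; last exact: admX.
    rewrite lerD2l expD; last 2 first.
    - apply: admZ.
      by apply: admM; [apply: admM => //; exact: adm_prod|exact: admX].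
    - by apply: admZ; exact: admX.
    rewrite expZ; last first.
      by apply: admM; [apply: admM => //; exact: adm_prod|exact: admX].
    rewrite expZ; last exact: admX.
    apply: lerD; last first.
      rewrite mulrA ler_wpM2l ?mulr_ge0 ?addr_ge0 ?exprn_ge0 //.
      by apply: ZK; apply: sub; rewrite mem_head.
    rewrite -mulrA ler_wpM2l //.
    apply: le_trans (ler_norm _) _; apply: le_trans (expand s' i us' sub _ _ _ _) _ => //.
    by rewrite ler_wpM2r // lerXn2r ?nnegrE // ler_nat.
  rewrite /=; set q := 1 + _.
  have q1 : 1 <= q by rewrite /q lerDl mulr_ge0 ?exprn_ge0 ?invr_ge0.
  have qn : 1 <= q * q ^+ size s' by rewrite -exprS exprn_ege1.
  apply: (@le_trans _ _ (q * (q ^+ size s' * ((size s')%:R * D)) + q * q ^+ size s' * D)).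
    apply: lerD; first by apply: ler_wpM2l => //; exact: le_trans q1.
    by rewrite ler_peMl.
  by rewrite exprS -natr1; lra.
apply: le_trans (main s us (fun _ h => h)) _.
apply: ler_wpM2r; first by rewrite mulr_ge0.
apply: (@le_trans _ _ (expR (4 ^+ k.+1 / N%:R) ^+ N)).
  apply: lerXn2r; rewrite ?nnegrE ?expR_ge0 ?expR_ge1Dx //.
by rewrite -expRM_natl mulrCA mulfV ?mulr1 // gt_eqF.
Qed.
End moment_algebra.

(** By monotone convergence the series of the [V n] has integral at most C, so it is finite almost
    everywhere, and then its terms tend to 0. *)
Lemma ae_cvg0_of_summable_integral d (T : measurableType d) (R : realType)
    (P : {measure set T -> \bar R}) (V : nat -> T -> R) (C : R) :
  (forall n, measurable_fun setT (V n)) -> (forall n w, 0 <= V n w) ->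
  (forall n, \int[P]_w (V n w)%:E <= (C / (n.+1%:R * n.+2%:R))%:E)%E ->
  {ae P, forall w, V n w @[n --> \oo] --> (0 : R)}.
Proof.
move=> mV V0 VC.
have mEV n : measurable_fun setT (fun w => (V n w)%:E) by exact/measurable_EFinP.
have EV0 n w : (0 <= (V n w)%:E)%E by rewrite lee_fin.
have C0 : 0 <= C.
  have := VC 0%N; have := @integral_ge0 _ _ _ P setT _ (fun w _ => EV0 0%N w).
  move=> /le_trans /[apply]; rewrite lee_fin => h.
  by move: h; rewrite pmulr_lge0 // invr_gt0 mulr_gt0.
(* The bounds telescope: 1/((k+1)(k+2)) = 1/(k+1) - 1/(k+2). *)
have psum n : \sum_(k < n) (C / (k.+1%:R * k.+2%:R)) = C * (1 - n.+1%:R^-1).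
  elim: n => [|n IH]; first by rewrite big_ord0 invr1 subrr mulr0.
  rewrite big_ord_recr /= IH.
  have n0 : (n.+1%:R : R) != 0 by rewrite pnatr_eq0.
  have n1 : (n.+2%:R : R) != 0 by rewrite pnatr_eq0.
  have e : (n.+2%:R : R) = n.+1%:R + 1 by rewrite -natr1.
  by move: n0 n1; rewrite e; move: (n.+1%:R : R) => x x0 x1; field; rewrite x0 x1.
pose S w := (\sum_(0 <= n <oo) (V n w)%:E)%E.
have mS : measurable_fun setT S.
  by apply: ge0_emeasurable_sum.
have S0 w : (0 <= S w)%E by apply: nneseries_ge0 => n _ _.
have iS : (\int[P]_w S w <= C%:E)%E.
  rewrite /S integral_nneseries //.
  apply: lime_le; first by apply: is_cvg_nneseries => n _ _; exact: integral_ge0.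
  near=> n; rewrite big_mkord.
  apply: (@le_trans _ _ (\sum_(k < n) (C / (k.+1%:R * k.+2%:R))%:E)%E).
    by apply: lee_sum => k _; exact: VC.
  rewrite sumEFin lee_fin psum ler_piMr // lerBlDr lerDl invr_ge0 //.
have intS : P.-integrable setT S.
  apply/integrableP; split => //.
  under eq_integral do rewrite gee0_abs //.
  by apply: le_lt_trans iS _; rewrite ltry.
have := integrable_ae measurableT intS; apply: filterS => w /(_ I) Sfin.
apply: (@cvg_series_cvg_0 _ R^o (fun n => V n w)); apply: nnseries_is_cvg => //.
by rewrite -/(S w) ltey_eq Sfin.
Unshelve. all: by end_near. Qed.

(** * Measurability of configurations *)

Section power_measure_integral.
Context d (T : measurableType d) (R : realType)
  (mu : {sigma_finite_measure set T -> \bar R}).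
Local Open Scope ereal_scope.

Lemma measurable_cat_tuple (m n : nat) :
  measurable_fun setT (fun u : m.-tuple T * n.-tuple T => cat_tuple u.1 u.2).
Proof.
apply/measurable_fun_tnthP => i.
have [j ->|j ->] := split_ordP i.
  rewrite (_ : _ \o _ = (fun t => tnth t j) \o fst); last first.
    by apply/funext => u /=; rewrite tnth_lshift.
  by apply: measurableT_comp => //; exact: measurable_tnth.
rewrite (_ : _ \o _ = (fun t => tnth t j) \o snd); last first.
  by apply/funext => u /=; rewrite tnth_rshift.
by apply: measurableT_comp => //; exact: measurable_tnth.
Qed.

Lemma measurable_tuple_cons (n : nat) : measurable_fun setT (@tuple_cons _ T n).
Proof. exact: measurable_funPT. Qed.

Lemma integral_power_measure0 (f : 0.-tuple T -> \bar R) :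
  measurable_fun setT f -> \int[power_measure mu 0]_z f z = f [tuple].
Proof.
by move=> mf; rewrite integral_dirac // diracE mem_set // mul1e.
Qed.

Lemma integral_power_measureS (n : nat) (f : n.+1.-tuple T -> \bar R) :
  measurable_fun setT f -> (forall z, 0 <= f z) ->
  \int[power_measure mu n.+1]_z f z =
  \int[mu]_x \int[power_measure mu n]_z f (tuple_cons (x, z)).
Proof.
move=> mf f0.
rewrite [LHS](@ge0_integral_pushforward _ _ _ _ _ (@tuple_cons _ T n)
  (@measurable_tuple_cons n) (mu \x power_measure mu n) setT f) //.
rewrite preimage_setT fubini_tonelli1 //; last by move=> u; exact: f0.
by apply: measurableT_comp => //; exact: measurable_tuple_cons.
Qed.

(** Tonelli's theorem, peeling off one coordinate of the first block at a time. *)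
Lemma integral_power_measure_cat (m n : nat) (f : (m + n).-tuple T -> \bar R) :
  measurable_fun setT f -> (forall z, 0 <= f z) ->
  \int[power_measure mu (m + n)]_z f z =
  \int[power_measure mu m]_x \int[power_measure mu n]_y f (cat_tuple x y).
Proof.
elim: m f => [|m IH] f mf f0.
  have mF := @measurable_fun_fubini_tonelli_F _ _ (0.-tuple T) (n.-tuple T) R
    (power_measure mu n) _ (measurableT_comp mf (@measurable_cat_tuple 0 n))
    (fun _ => f0 _).
  rewrite integral_power_measure0 //; apply: eq_integral => y _.
  by congr f; exact: val_inj.
rewrite [LHS](@integral_power_measureS (m + n) f) //.
have mF := @measurable_fun_fubini_tonelli_F _ _ (m.+1.-tuple T) (n.-tuple T) R
    (power_measure mu n) _ (measurableT_comp mf (@measurable_cat_tuple m.+1 n))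
    (fun _ => f0 _).
rewrite integral_power_measureS //; last by move=> z; exact: integral_ge0.
apply: eq_integral => x _; rewrite IH //.
  by apply: eq_integral => u _; apply: eq_integral => y _; congr f; exact: val_inj.
apply: measurableT_comp => //.
apply: (@measurableT_comp _ _ _ _ _ _ (@tuple_cons _ T (m + n))) => //.
Qed.

Lemma measurable_tuple_box (n : nat) (A : 'I_n -> set T) :
  (forall i, measurable (A i)) ->
  measurable [set z : n.-tuple T | forall i, A i (tnth z i)].
Proof.
move=> mA; rewrite (_ : mkset _ =
    \bigcap_(i in [set: 'I_n]) ((fun z => tnth z i) @^-1` A i)); last first.
  by apply/seteqP; split => [z h i _|z h i]; [exact: h|exact: h].
apply: fin_bigcap_measurable; first exact: finite_finset.
by move=> i _; rewrite -[X in measurable X]setTI; exact: measurable_tnth.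
Qed.

Lemma power_measure_box_le (n : nat) (A : 'I_n -> set T) (a : R) :
  (forall i, measurable (A i)) -> (forall i, mu (A i) <= a%:E) ->
  power_measure mu n [set z | forall i, A i (tnth z i)] <= (a ^+ n)%:E.
Proof.
elim: n A => [|n IH] A mA Aa.
  rewrite expr0 (_ : [set _ | _] = setT); last by apply/seteqP; split => // z _ [].
  by rewrite /= diracT.
rewrite [leLHS](_ : _ = (mu \x power_measure mu n) (A ord0 `*`
    [set z : n.-tuple T | forall i : 'I_n, A (lift ord0 i) (tnth z i)])); last first.
  rewrite /= /iso_measure /pushforward; congr (_ _); apply/seteqP; split.
    move=> [x z] /= h; split; first by have := h ord0; rewrite (tnth_nth x).
    by move=> i; have := h (lift ord0 i); rewrite !(tnth_nth x).
  move=> [x z] /= [h1 h2] i; have [j ->|->] := unliftP ord0 i.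
    by have := h2 j; rewrite !(tnth_nth x).
  by rewrite (tnth_nth x).
rewrite product_measure1E //; last exact: (@measurable_tuple_box n (fun i => A (lift ord0 i))).
have a0 : (0 <= a)%R by rewrite -lee_fin (le_trans _ (Aa ord0)).
have h := IH (fun i => A (lift ord0 i)) (fun i => mA _) (fun i => Aa _).
rewrite exprS EFinM.
apply: lee_pmul; [exact: measure_ge0|exact: measure_ge0|exact: Aa|exact: h].
Qed.

End power_measure_integral.

Section vectors.
Context (R : realType) (d : nat).
Local Notation E := 'rV[R]_d.

Lemma measurable_coord (i : 'I_d) : measurable_fun setT (fun x : E => x ord0 i).
Proof.
move=> _ A mA; rewrite setTI; apply: sub_sigma_algebra => /=.
rewrite -bigcup_seq/=; exists i => /=; first by rewrite mem_index_enum.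
by exists A => //; rewrite setTI.
Qed.

Lemma measurable_eq_vec dT (T : measurableType dT) (f g : T -> E) :
  measurable_fun setT f -> measurable_fun setT g ->
  measurable [set t | f t = g t].
Proof.
move=> mf mg; rewrite (_ : mkset _ =
    \bigcap_(i in [set: 'I_d]) ((fun t => f t ord0 i - g t ord0 i) @^-1` [set 0])).
  apply: fin_bigcap_measurable; first exact: finite_finset.
  move=> i _; rewrite -[X in measurable X]setTI.
  apply: measurable_funB => //.
  - exact: (measurableT_comp (measurable_coord i)).
  - exact: (measurableT_comp (measurable_coord i)).
apply/seteqP; split => [t e i _|t h] /=; first by rewrite e subrr.
by apply/rowP => i; apply/eqP; rewrite -subr_eq0; apply/eqP; exact: h.
Qed.

End vectors.

Section configurations.
Context (R : realType) (d : nat).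
Local Notation E := 'rV[R]_d.
Local Notation N := (config R d).

Lemma config_inj (X Y : N) : points X = points Y -> X = Y.
Proof.
case: X => x hx; case: Y => y hy /= xy; move: hx hy; rewrite xy => hx hy.
by rewrite (Prop_irrelevance hx hy).
Qed.

Definition bounded_borel (A : set E) := measurable A /\ bounded_set A.

Lemma bounded_setS (A B : set E) : A `<=` B -> bounded_set B -> bounded_set A.
Proof.
by move=> AB [M [rM BM]]; exists M; split => // y My x /AB; exact: BM.
Qed.

Lemma bounded_borelI (A B : set E) :
  measurable A -> bounded_borel B -> bounded_borel (A `&` B).
Proof.
move=> mA [mB bB]; split; first exact: measurableI.
by apply: (@bounded_setS _ B) => // x [].
Qed.

Definition pts (X : N) (A : set E) : seq E := fset_set (points X `&` A).

Lemma pts_uniq (X : N) (A : set E) : uniq (pts X A).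
Proof. exact: fset_uniq. Qed.

Lemma npts_size (X : N) (A : set E) : npts X A = size (pts X A).
Proof. by []. Qed.

Lemma mem_pts (X : N) (A : set E) : bounded_set A -> forall x,
  (x \in pts X A) = (x \in points X `&` A).
Proof.
by move=> bA x; rewrite /pts in_fset_set //; exact: points_locally_finite.
Qed.

Lemma eq_pts (X : N) A (Y : N) B : points X `&` A = points Y `&` B -> pts X A = pts Y B.
Proof. by rewrite /pts => ->. Qed.

Lemma pts_cap (X : N) (A B : set E) : pts (config_cap X A) B = pts X (A `&` B).
Proof. by apply: eq_pts => /=; rewrite setIA. Qed.

Lemma npts_cap (X : N) (A B : set E) : npts (config_cap X A) B = npts X (A `&` B).
Proof. by rewrite !npts_size pts_cap. Qed.

Lemma leq_npts (X : N) (A B : set E) : A `<=` B -> bounded_set B -> (npts X A <= npts X B)%N.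
Proof.
move=> AB bB; rewrite !npts_size; apply: uniq_leq_size; first exact: pts_uniq.
have bA : bounded_set A by exact: (@bounded_setS A B).
by move=> x; rewrite !mem_pts // !inE => -[Xx /AB].
Qed.

Lemma measurable_npts (B : set E) : bounded_borel B ->
  measurable_fun setT (fun X : N => npts X B).
Proof.
move=> [mB bB] _ A _; rewrite setTI.
rewrite (_ : _ @^-1` A = \bigcup_(k in A) [set X : N | npts X B = k]); last first.
  apply/seteqP; split => [X /= AX|X [k Ak /= e]]; first by exists (npts X B).
  by rewrite e.
apply: bigcup_measurable => k _; apply: sub_sigma_algebra.
by exists B, k.
Qed.

Lemma measurable_to_config dT (T : measurableType dT) (f : T -> N) :
  (forall B, bounded_borel B -> measurable_fun setT (fun t => npts (f t) B)) ->
  measurable_fun setT f.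
Proof.
move=> h; apply: (@measurability _ _ _ _ _ _ (@count_events R d)) => //.
move=> _ [_ [B [k [mB bB ->]]] <-].
have := h B (conj mB bB) measurableT [set k] I.
by apply; exact: measurableT.
Qed.

Lemma measurable_config_cap (A : set E) : measurable A ->
  measurable_fun setT (fun X : N => config_cap X A).
Proof.
move=> mA; apply: measurable_to_config => B bB.
under eq_fun do rewrite npts_cap.
by apply: measurable_npts; exact: bounded_borelI.
Qed.

End configurations.

Lemma sum_indic_count (R : realType) (I : choiceType) (U : set I) (s : seq I) :
  \sum_(i <- s) (\1_U i : R) = (count (mem U) s)%:R.
Proof.
elim: s => [|x s IH]; first by rewrite big_nil.
by rewrite big_cons /= IH natrD indicE.
Qed.

(** * Measurability of sums over the points of a random configuration *)

Section random_sums.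
Context (R : realType) (d : nat).
Local Notation E := 'rV[R]_d.
Local Notation N := (config R d).
Context dT (T : measurableType dT) (phi : T -> N) (A : set E).

(** The counting measure of the points in A. Writing sums over points as integrals against it lets
    the theory of kernels provide their measurability in t. *)
Definition pts_measure (t : T) : {measure set E -> \bar R} :=
  msum (fun i => \d_(nth 0 (pts (phi t) A) i)) (size (pts (phi t) A)).

Lemma integral_pts_measure (t : T) (f : E -> \bar R) :
  measurable_fun setT f -> (forall x, 0 <= f x)%E ->
  (\int[pts_measure t]_x f x = \sum_(x <- pts (phi t) A) f x)%E.
Proof.
move=> mf f0; rewrite ge0_integral_measure_sum //.
rewrite (big_nth 0) big_mkord; apply: eq_bigr => i _.
by rewrite integral_dirac // diracE mem_set // mul1e.
Qed.

Hypotheses (mphi : measurable_fun setT phi) (bA : bounded_borel A).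

Lemma pts_measureE t U : measurable U ->
  pts_measure t U = (npts (phi t) (A `&` U))%:R%:E.
Proof.
move=> mU; rewrite -[U in pts_measure t U]setIT -integral_indic //.
rewrite integral_pts_measure; last 2 first.
- by apply/measurable_EFinP; exact: measurable_indic.
- by move=> x; rewrite lee_fin.
rewrite sumEFin; congr (_%:E).
have -> : npts (phi t) (A `&` U) = count (mem U) (pts (phi t) A).
  rewrite npts_size -size_filter; apply: perm_size.
  apply: uniq_perm; [exact: pts_uniq|exact/filter_uniq/pts_uniq|move=> x].
  rewrite mem_filter !mem_pts //; last 2 first.
  - by case: bA.
  - by apply: (@bounded_setS _ _ _ A); [move=> y []|case: bA].
  by rewrite setIA in_setI andbC.
exact: sum_indic_count.
Qed.

(** The two hypotheses are arguments so that the kernel structure, whose measurability rests on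
    them, can be attached to this name. *)
Definition pts_kernel of measurable_fun setT phi & bounded_borel A := pts_measure.

Let measurable_pts_kernel U : measurable U ->
  measurable_fun setT (pts_kernel mphi bA ^~ U).
Proof.
move=> mU; rewrite (_ : (fun t => _) = EFin \o (fun t => (npts (phi t) (A `&` U))%:R)).
  apply/measurable_EFinP; apply: (@measurableT_comp _ _ _ _ _ _ (fun n : nat => n%:R : R)) => //.
  apply: (@measurableT_comp _ _ _ _ _ _ (fun X : N => npts X (A `&` U))) => //.
  by apply: measurable_npts; rewrite setIC; exact: bounded_borelI.
by apply/funext => t; rewrite /pts_kernel /= pts_measureE.
Qed.

HB.instance Definition _ := isKernel.Build _ _ _ _ _ (pts_kernel mphi bA)
  measurable_pts_kernel.

Import HBNNSimple.

Lemma emeasurable_sum_pts (g : E * T -> \bar R) :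
  measurable_fun setT g -> (forall u, 0 <= g u)%E ->
  measurable_fun setT (fun t => \sum_(x <- pts (phi t) A) g (x, t))%E.
Proof.
move=> mg g0; pose k (u : T * E) := g (u.2, u.1).
have mk : measurable_fun setT k.
  by apply: measurableT_comp => //; exact: measurable_fun_pair.
rewrite (_ : (fun t => _) = fun t => \int[pts_kernel mphi bA t]_x k (t, x))%E; last first.
  apply/funext => t; rewrite integral_pts_measure // => [|x]; last exact: g0.
  by apply: measurableT_comp => //; exact: measurable_pair1.
pose k_ := nnsfun_approx measurableT mk.
apply: (@measurable_fun_xsection_integral _ _ _ _ _ _ _ k_).
- by move=> a b ab; exact/nd_nnsfun_approx.
- by move=> z; apply: cvg_nnsfun_approx => // u _; exact: g0.
- move=> n r; set B := _ @^-1` _.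
  have mB : measurable B by exact: measurable_funPTI.
  have [] := @measurable_prod_subset_xsection_kernel _ _ _ _ _
    (pts_kernel mphi bA) setT measurableT _ B mB.
    (* The bound on the total mass may depend on t; adding 1 makes it strict. *)
    move=> t; exists ((npts (phi t) A)%:R + 1) => X mX.
    rewrite /mrestr setIT /= /pts_kernel pts_measureE // lte_fin ltr_pwDr //.
    by rewrite ler_nat; apply: leq_npts; [move=> ? []|case: bA].
  by move=> _; rewrite /mrestr; under eq_fun do rewrite setIT.
Qed.

Lemma measurable_sum_pts (g : E * T -> R) : measurable_fun setT g ->
  measurable_fun setT (fun t => \sum_(x <- pts (phi t) A) g (x, t)).
Proof.
move=> mg.
rewrite (_ : (fun t => _) = fun t => fine (\sum_(x <- pts (phi t) A) (g^\+ (x, t))%:E)%E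
   - fine (\sum_(x <- pts (phi t) A) (g^\- (x, t))%:E)%E).
  apply: measurable_funB.
  - apply: measurableT_comp => //; apply: (emeasurable_sum_pts (g := EFin \o g^\+)).
      by apply/measurable_EFinP; exact: measurable_funrpos.
    by move=> u; rewrite lee_fin.
  - apply: measurableT_comp => //; apply: (emeasurable_sum_pts (g := EFin \o g^\-)).
      by apply/measurable_EFinP; exact: measurable_funrneg.
    by move=> u; rewrite lee_fin.
apply/funext => t; rewrite !sumEFin /= -sumrB; apply: eq_bigr => x _.
by rewrite -[in LHS](funrposBneg g).
Qed.

End random_sums.

(** * Factorial moment expansion *)

Section distinct_tuples.
Context (T : eqType).

(** Tuples grow at their right end, so that summing out the last entry leaves a sum over prefixes,
    the form used by [sum_dtup_take]. *)
Fixpoint dtup (s : seq T) (p : nat) : seq (p.-tuple T) :=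
  if p is q.+1
  then [seq rcons_tuple w y | w <- dtup s q, y <- [seq y <- s | y \notin (w : seq T)]]
  else [:: [tuple]].

Arguments dtup : simpl never.

Lemma dtupS (s : seq T) p : dtup s p.+1 =
  [seq rcons_tuple w y | w <- dtup s p, y <- [seq y <- s | y \notin (w : seq T)]].
Proof. by []. Qed.

Lemma tuple_rconsP p (z : p.+1.-tuple T) : exists w y, z = rcons_tuple w y.
Proof.
case: z => z; case/lastP: z => [//|z y] sz.
have sz' : size z == p by rewrite -eqSS -(eqP sz) size_rcons.
by exists (Tuple sz'), y; exact: val_inj.
Qed.

Lemma mem_dtup (s : seq T) p (z : p.-tuple T) :
  (z \in dtup s p) = uniq z && all (mem s) z.
Proof.
elim: p z => [|p IH] z; first by rewrite tuple0 inE eqxx.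
have [w [y ->]] := tuple_rconsP z.
have -> : uniq (rcons_tuple w y) && all (mem s) (rcons_tuple w y) =
    (uniq w && all (mem s) w) && ((y \in s) && (y \notin (w : seq T))).
  rewrite rcons_uniq all_rcons (_ : mem s y = (y \in s)) //.
  by case: (y \in w); case: (uniq w); case: (y \in s); case: (all _ _).
rewrite dtupS; apply/allpairsPdep/idP => [[w' [y' [wd yd e]]]|].
  have [ew ->] : w = w' /\ y = y'.
    have /eqP := congr1 val e; rewrite /= eqseq_rcons => /andP[/eqP ew /eqP ey].
    by split => //; exact: val_inj.
  move: wd; rewrite ew IH => ->.
  by move: yd; rewrite mem_filter => /andP[-> ->].
move=> /andP[hw /andP[ys yw]].
by exists w, y; rewrite IH hw mem_filter yw ys.
Qed.

Lemma dtup_uniq (s : seq T) p : uniq s -> uniq (dtup s p).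
Proof.
move=> us; elim: p => [//|p IH]; rewrite dtupS; apply: allpairs_uniq_dep => //.
  by move=> w _; exact: filter_uniq.
move=> [w y] [w' y'] _ _ /= /(congr1 val) /= /eqP.
by rewrite eqseq_rcons => /andP[/eqP ew /eqP ->]; rewrite (val_inj ew).
Qed.

Lemma big_dtupS (V : nmodType) (s : seq T) p (G : p.+1.-tuple T -> V) :
  \sum_(z <- dtup s p.+1) G z =
  \sum_(w <- dtup s p) \sum_(y <- s | y \notin (w : seq T)) G (rcons_tuple w y).
Proof.
by rewrite dtupS big_allpairs_dep; apply: eq_bigr => w _; rewrite big_filter.
Qed.

Lemma count_notin_dtup (s : seq T) p (w : p.-tuple T) : uniq s ->
  w \in dtup s p -> count [pred y | y \notin (w : seq T)] s = (size s - p)%N.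
Proof.
rewrite mem_dtup => us /andP[uw /allP ws].
rewrite -(count_predC [pred y | y \notin (w : seq T)] s).
rewrite [X in (_ + X - _)%N](_ : _ = p) ?addnK //.
transitivity (size w); last exact: size_tuple.
rewrite -size_filter; apply: perm_size; apply: uniq_perm => //.
  exact: filter_uniq.
by move=> y; rewrite mem_filter /= negbK andb_idr // => /ws.
Qed.

(** A distinct p-tuple has |s| - p distinct extensions by one entry, so each prefix of length k is
    counted a falling factorial number of times. *)
Lemma sum_dtup_take (R : comNzRingType) (F : seq T -> R) (s : seq T) k m :
  uniq s -> (k <= m)%N ->
  \sum_(z <- dtup s m) F (take k z) =
  ((size s - k) ^_ (m - k))%:R * \sum_(w <- dtup s k) F w.
Proof.
move=> us; elim: m => [|m IH].
  by rewrite leqn0 => /eqP ->; rewrite /= !big_seq1 subnn ffactn0 mul1r.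
rewrite leq_eqVlt => /orP[/eqP ->|km].
  rewrite subnn ffactn0 mul1r; apply: eq_bigr => z _.
  by rewrite take_oversize // size_tuple.
rewrite big_dtupS subSn // ffactnSr natrM mulrAC -IH // mulr_suml.
rewrite big_seq [RHS]big_seq; apply: eq_bigr => w wd.
rewrite (eq_bigr (fun=> F (take k w))) => [|y _]; last first.
  rewrite /= -cats1 takel_cat ?size_tuple //.
rewrite big_const_seq iter_addr_0 -subnDA subnKC // (count_notin_dtup us wd).
by rewrite mulr_natr.
Qed.

Lemma size_dtup (s : seq T) p : uniq s -> size (dtup s p) = (size s ^_ p)%N.
Proof.
move=> us; have := sum_dtup_take (fun=> 1%R : int) us (leq0n p).
rewrite subn0 /= subn0 big_seq1 mulr1 big_const_seq count_predT iter_addr_0.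
by move/eqP; rewrite !natz eqz_nat => /eqP.
Qed.

End distinct_tuples.

Section factorial_expansion.
Context (T : eqType) (R : numFieldType).

(* Coefficients of the factorial moment expansion. Using the prefixes of z
   instead of all its subsets gives a function that is not symmetric in z but
   has the same sum over the distinct tuples. *)
Definition fexp (F : seq T -> R) (m : nat) (z : seq T) : R :=
  \sum_(k < m.+1) 'C(m, k)%:R * (-1) ^+ (m - k) * F (take k z).

Lemma sum_sign_bin (n M : nat) : (n < M)%N ->
  \sum_(l < M) (-1) ^+ l * 'C(n, l)%:R = (n == 0%N)%:R :> R.
Proof.
move=> nM; transitivity (\sum_(l < n.+1) (-1) ^+ l * 'C(n, l)%:R : R).
  rewrite [RHS](big_ord_widen M (fun l => (-1) ^+ l * 'C(n, l)%:R)) // [RHS]big_mkcond.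
  apply: eq_bigr => l _; case: ifP => // /negbT; rewrite ltnS -ltnNge => nl.
  by rewrite bin_small // mulr0.
have := exprDn (1 : R) (-1) n; rewrite subrr expr0n => ->.
by apply: eq_bigr => l _; rewrite expr1n mul1r mulr_natr.
Qed.

(** After substitution of [fexp], the sum of F over the distinct k-tuples receives from order m the
    coefficient (-1)^(m-k) C(n-k, m-k) / k!, with n the size of s. Summed over m, these coefficients
    cancel unless k = n. *)
Lemma factorial_expansion (F : seq T -> R) (s : seq T) (M : nat) : uniq s ->
  (forall s1 s2, perm_eq s1 s2 -> F s1 = F s2) -> (size s < M)%N ->
  \sum_(m < M) (m`!%:R)^-1 * (\sum_(z <- dtup s m) fexp F m z) = F s.
Proof.
move=> us Fperm sM; set n := size s.
pose S k := \sum_(w <- dtup s k) F w.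
have nz k : (k`!%:R : R) != 0 by rewrite pnatr_eq0 -lt0n fact_gt0.
(* The factor [(k <= m)] lets k range over all values below M, so that the two sums can be
   exchanged. *)
pose c k m : R := (-1) ^+ (m - k) * ('C(n - k, m - k) * (k <= m))%:R.
have step (m : 'I_M) : (m`!%:R)^-1 * (\sum_(z <- dtup s m) fexp F m z) =
    \sum_(k < M) (k`!%:R)^-1 * S k * c k m.
  rewrite /fexp exchange_big /=.
  rewrite [RHS](bigID (fun k : 'I_M => (k < m.+1)%N)) /= [X in _ + X]big1 ?addr0; last first.
    by move=> k; rewrite ltnS => /negbTE km; rewrite /c km muln0 !mulr0.
  rewrite -(big_ord_widen M (fun k => (k`!%:R)^-1 * S k * c k m)) // mulr_sumr.
  apply: eq_bigr => k _; have km : (k <= m)%N by rewrite -ltnS.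
  rewrite -mulr_sumr sum_dtup_take // /c km muln1 -/(S k) -/n.
  have := bin_ffact (n - k) (m - k) => /(congr1 (fun i => i%:R : R)).
  rewrite natrM => <-.
  have := bin_fact km => /(congr1 (fun i => i%:R : R)); rewrite !natrM => <-.
  have h0 := nz k; have h1 := nz (m - k)%N.
  have h2 : ('C(m, k)%:R : R) != 0 by rewrite pnatr_eq0 -lt0n bin_gt0.
  by field; rewrite h0 h1 h2.
under eq_bigr do rewrite step.
rewrite exchange_big /=.
have inner (k : 'I_M) : \sum_(m < M) (k`!%:R)^-1 * S k * c k m =
    (k == Ordinal sM)%:R * ((n`!%:R)^-1 * S n).
  rewrite -mulr_sumr; have [kn|nk] := leqP k n; last first.
    have -> : S k = 0.
      rewrite /S; have : size (dtup s k) = 0%N by rewrite size_dtup // ffact_small.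
      by move/size0nil => ->; rewrite big_nil.
    by rewrite mulr0 mul0r -val_eqE /= gtn_eqF // mul0r.
  rewrite -(big_mkord xpredT (c k)) (@big_cat_nat _ _ _ k) //=; last exact: ltnW.
  rewrite big_nat big1 ?add0r => [|i /andP[_ ik]]; last first.
    by rewrite /c leqNgt ik muln0 mulr0.
  rewrite (_ : \sum_(k <= i < M) c k i = \sum_(0 + k <= i < M) c k i) // big_addn big_mkord.
  rewrite (eq_bigr (fun l : 'I_(M - k) => (-1) ^+ l * 'C(n - k, l)%:R)) => [|l _]; last first.
    by rewrite /c addnK leq_addl muln1.
  rewrite sum_sign_bin; last by rewrite ltn_sub2r // (leq_ltn_trans kn).
  rewrite subn_eq0 -val_eqE /= eqn_leq kn /= mulrC.
  have [nk|] := boolP (n <= k)%N; last by rewrite !mul0r.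
  by have -> : k = n :> nat by apply/eqP; rewrite eqn_leq kn.
rewrite (eq_bigr _ (fun k _ => inner k)) -mulr_suml (bigD1 (Ordinal sM)) //= eqxx.
rewrite big1 ?addr0 ?mul1r => [|k /negbTE -> //].
(* The distinct n-tuples are the n! orderings of s, and F takes the same value on all of them. *)
rewrite /S (eq_big_seq (fun=> F s)) => [|w]; last first.
  rewrite mem_dtup => /andP[uw /allP ws]; apply: Fperm.
  have [||_ h] := @uniq_min_size _ w s uw; [exact: ws|by rewrite size_tuple|exact: uniq_perm].
by rewrite big_const_seq count_predT iter_addr_0 size_dtup // ffactnn -(mulr_natl (F s)) mulKf.
Qed.

(** By the binomial theorem, the sum of C(m, k) (c+1)^k is (c+2)^m: the expansion raises the base by
    one. *)
Lemma norm_fexp_le (F : seq T -> R) (V : R) (c m : nat) (z : seq T) :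
  (forall s, `|F s| <= V * c.+1%:R ^+ size s) -> `|fexp F m z| <= V * c.+2%:R ^+ m.
Proof.
move=> hF; have V0 : 0 <= V.
  by have := hF [::]; rewrite expr0 mulr1; apply: le_trans.
apply: le_trans (ler_norm_sum _ _ _) _.
rewrite -[c.+2]add1n natrD exprDn mulr_sumr; apply: ler_sum => k _.
have -> : `|'C(m, k)%:R * (-1) ^+ (m - k) * F (take k z)| =
    'C(m, k)%:R * `|F (take k z)|.
  by rewrite 2!normrM normrX normrN1 expr1n mulr1 ger0_norm.
rewrite expr1n mul1r mulrnAr -[X in _ <= X]mulr_natl; apply: ler_wpM2l => //; apply: le_trans (hF _) _.
apply: ler_wpM2l => //; apply: ler_weXn2l; first by rewrite ler1n.
by rewrite size_take; case: ltnP.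
Qed.

End factorial_expansion.

(** * Configurations built from tuples *)

Section tuple_configurations.
Context (R : realType) (d : nat).
Local Notation E := 'rV[R]_d.
Local Notation N := (config R d).

Lemma locally_finite_seq (s : seq E) : locally_finite [set` s].
Proof. by move=> B _; apply: (@sub_finite_set _ _ [set` s]) => [x []|]. Qed.

Definition conf (s : seq E) : N := Config (@locally_finite_seq s).

Lemma eq_conf (s1 s2 : seq E) : perm_eq s1 s2 -> conf s1 = conf s2.
Proof.
move=> /perm_mem h; apply: config_inj; apply/seteqP.
by split => x /=; rewrite h.
Qed.

Lemma conf_pts (X : N) (A : set E) : bounded_set A ->
  conf (pts X A) = config_cap X A.
Proof.
move=> bA; apply: config_inj; apply/seteqP; split => x /=.
  by rewrite mem_pts // inE.
by move=> h; rewrite mem_pts // inE.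
Qed.

Lemma npts_conf_le (s : seq E) (A : set E) : bounded_set A ->
  (npts (conf s) A <= size s)%N.
Proof.
move=> bA; rewrite npts_size; apply: uniq_leq_size; first exact: pts_uniq.
by move=> x; rewrite mem_pts // inE => -[].
Qed.

Lemma npts_conf_rcons (s : seq E) (x : E) (B : set E) : bounded_set B ->
  npts (conf (rcons s x)) B =
  (npts (conf s) B + (`[< B x >] && (x \notin s)))%N.
Proof.
move=> bB; rewrite !npts_size.
have [xs|xs] := boolP (x \in s).
  rewrite andbF addn0; congr size; congr pts; apply: config_inj.
  apply/seteqP; split => y /=; rewrite mem_rcons inE.
    by move=> /orP[/eqP ->|].
  by move=> ->; rewrite orbT.
rewrite andbT; case: asboolP => [Bx|nBx].
  rewrite addn1 -/(size (x :: pts (conf s) B)); apply: perm_size.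
  apply: uniq_perm; first exact: pts_uniq.
    by rewrite /= pts_uniq andbT mem_pts // notin_setE /= (negbTE xs) => -[].
  move=> y; rewrite inE !mem_pts //; apply/idP/idP; rewrite !inE /=.
    by rewrite mem_rcons inE => -[/orP[->//|ys] By]; apply/orP; right; rewrite inE.
  by move=> /orP[/eqP ->|]; rewrite ?inE /= mem_rcons inE ?eqxx // => -[-> ?]; rewrite orbT.
rewrite addn0; congr size; apply: eq_pts; apply/seteqP; split => y /=.
  by rewrite mem_rcons inE => -[/orP[/eqP ->//|]].
by rewrite mem_rcons inE => -[-> ?]; rewrite orbT.
Qed.

Lemma measurable_mem_take p k (i : 'I_p) :
  measurable [set z : p.-tuple E | tnth z i \in take k z].
Proof.
rewrite (_ : mkset _ = \bigcup_(j in [set j : 'I_p | (j < k)%N])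
    [set z : p.-tuple E | tnth z i = tnth z j]).
  apply: fin_bigcup_measurable; first exact: finite_finset.
  by move=> j _; apply: measurable_eq_vec; exact: measurable_tnth.
apply/seteqP; split => z /=.
  move=> /(nthP 0)[j]; rewrite size_take size_tuple => jk zj.
  have jp : (j < p)%N by move: jk; case: ifP => // kp jk; exact: ltn_trans kp.
  have jk' : (j < k)%N.
    by move: jk; case: ifP => // /negbT; rewrite -leqNgt => pk jp'; exact: leq_trans pk.
  exists (Ordinal jp) => //=.
  by rewrite -zj nth_take // (tnth_nth 0).
move=> [j /= jk ->]; rewrite (tnth_nth 0) -(nth_take _ jk); apply: mem_nth.
by rewrite size_take size_tuple; case: ifP.
Qed.

(** This makes the coefficients [fexp] of a measurable functional measurable in the tuple. The
    induction on k adds one point at a time. *)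
Lemma measurable_conf_take p k :
  measurable_fun setT (fun z : p.-tuple E => conf (take k z)).
Proof.
wlog kp : k / (k <= p)%N => [H|].
  have [/H //|pk] := leqP k p.
  rewrite (_ : (fun z => _) = (fun z : p.-tuple E => conf (take p z))); first exact: H.
  by apply/funext => z; rewrite !take_oversize ?size_tuple // ltnW.
apply: measurable_to_config => B [mB bB].
suff H n : measurable [set z : p.-tuple E | npts (conf (take k z)) B = n].
  move=> _ A _; rewrite setTI (_ : _ @^-1` A =
    \bigcup_(n in A) [set z : p.-tuple E | npts (conf (take k z)) B = n]).
    by apply: bigcup_measurable => n _; exact: H.
  apply/seteqP; split => [z /= Az|z [n An /= e]]; first by exists (npts (conf (take k z)) B).
  by rewrite e.
elim: k kp n => [|k IH] kp n.
  under eq_set do rewrite take0.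
  have [e|ne] := eqVneq (npts (conf [::]) B) n.
    by rewrite (_ : mkset _ = setT) //; apply/seteqP; split => // z _; rewrite /= take0.
  rewrite (_ : mkset _ = set0) //; apply/seteqP; split => // z /=.
  by move/eqP; rewrite (negbTE ne).
pose i := Ordinal kp.
(* The new point raises the count only if it lies in B and repeats no earlier entry, since
   configurations carry no multiplicities. *)
pose S := [set z : p.-tuple E | B (tnth z i)] `&`
  ~` [set z : p.-tuple E | tnth z i \in take k z].
have mS : measurable S.
  apply: measurableI.
    rewrite -[X in measurable X]setTI; exact: measurable_tnth.
  by apply: measurableC; exact: measurable_mem_take.
have takeS (z : p.-tuple E) : npts (conf (take k.+1 z)) B =
    (npts (conf (take k z)) B + `[< S z >])%N.
  rewrite (take_nth 0) ?size_tuple // npts_conf_rcons //; congr (_ + _)%N.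
  have -> : z`_k = tnth z i by rewrite (tnth_nth 0).
  congr nat_of_bool; apply/idP/asboolP => [/andP[/asboolP Bz /negP zk] //|[Bz zk]].
  by apply/andP; split; [exact/asboolP|exact/negP].
have {}IH := IH (ltnW kp).
rewrite (_ : mkset _ = (~` S `&` [set z : p.-tuple E | npts (conf (take k z)) B = n]) `|`
   (S `&` (if n is n'.+1 then [set z : p.-tuple E | npts (conf (take k z)) B = n'] else set0))).
  apply: measurableU; apply: measurableI => //; first exact: measurableC.
  by case: n.
apply/seteqP; split => z /=; rewrite takeS.
  by case: asboolP => Sz; rewrite ?addn1 ?addn0 => <-; [right|left].
move=> [[nS <-]|[Sz]]; first by rewrite asboolF // addn0.
by case: n => // n /= <-; rewrite asboolT // addn1.
Qed.

End tuple_configurations.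

Section sum_over_tuples.
Context (R : realType) (d : nat).
Local Notation E := 'rV[R]_d.
Local Notation N := (config R d).
Context dT (T : measurableType dT) (phi : T -> N) (A : set E).
Hypotheses (mphi : measurable_fun setT phi) (bA : bounded_borel A).

Lemma measurable_rcons_tuple p :
  measurable_fun setT (fun u : E * p.-tuple E => rcons_tuple u.2 u.1).
Proof.
apply/measurable_fun_tnthP => i.
have [ip|pi] := ltnP i p.
  rewrite (_ : _ \o _ = (fun z => tnth z (Ordinal ip)) \o snd); last first.
    by apply/funext => u /=; rewrite !(tnth_nth 0) /= nth_rcons size_tuple ip.
  by apply: measurableT_comp => //; exact: measurable_tnth.
rewrite (_ : _ \o _ = fst) //; apply/funext => u /=.
have -> : i = ord_max by apply: val_inj => /=; apply/eqP; rewrite eqn_leq pi -ltnS ltn_ord.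
by rewrite (tnth_nth 0) /= nth_rcons size_tuple ltnn eqxx.
Qed.

(** Induction on p: the sum over the last entry is measurable jointly in the prefix and t, by
    [measurable_sum_pts] over the parameter space of pairs of a prefix and t. The condition that the
    entry is new becomes an indicator factor. *)
Lemma measurable_sum_dtup p (g : p.-tuple E * T -> R) :
  measurable_fun setT g ->
  measurable_fun setT (fun t => \sum_(z <- dtup (pts (phi t) A) p) g (z, t)).
Proof.
elim: p g => [|p IH] g mg.
  rewrite (_ : (fun t => _) = (fun t => g ([tuple], t))).
    by apply: measurableT_comp => //; exact: measurable_pair1.
  by apply/funext => t; rewrite big_seq1.
pose h (u : E * (p.-tuple E * T)) : R :=
  (u.1 \notin (u.2.1 : seq E))%:R * g (rcons_tuple u.2.1 u.1, u.2.2).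
have mh : measurable_fun setT h.
  apply: measurable_funM.
    apply: (@measurableT_comp _ _ _ _ _ _ (fun b : bool => b%:R : R)) => //.
    apply: measurable_neg; apply: (@measurable_fun_bool _ _ _ _ true).
    rewrite setTI (_ : _ @^-1` _ = \bigcup_(j in [set: 'I_p])
        [set u : E * (p.-tuple E * T) | u.1 = tnth u.2.1 j]).
      apply: fin_bigcup_measurable; first exact: finite_finset.
      move=> j _; apply: measurable_eq_vec => //.
      apply: (@measurableT_comp _ _ _ _ _ _ (fun z : p.-tuple E => tnth z j)).
        exact: measurable_tnth.
      by apply: measurableT_comp.
    apply/seteqP; split => u /=.
      by move=> /tnthP[j e]; exists j.
    by move=> [j _ /= ->]; exact: mem_tnth.
  apply: measurableT_comp => //; apply: measurable_fun_pair => /=.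
    have h2 : measurable_fun setT (fun u : E * (p.-tuple E * T) => (u.1, u.2.1)).
      by apply: measurable_fun_pair => //; exact: measurableT_comp.
    exact: (measurableT_comp (@measurable_rcons_tuple p) h2).
  exact: measurableT_comp.
have mG : measurable_fun setT (fun v : p.-tuple E * T =>
    \sum_(y <- pts (phi v.2) A) h (y, v)).
  apply: (@measurable_sum_pts _ _ _ (p.-tuple E * T)%type (phi \o snd)) => //.
  exact: measurableT_comp.
apply: eq_measurable_fun (IH _ mG) => t _.
rewrite big_dtupS; apply: eq_bigr => w _; rewrite [RHS]big_mkcond.
by apply: eq_bigr => y _; rewrite /h /=; case: ifP; rewrite ?mul1r ?mul0r.
Qed.

End sum_over_tuples.

(** * Campbell formula and decay of correlations *)

Lemma esum_uniq_seq (R : realType) (I : choiceType) (D : set I) (L : seq I)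
    (G : I -> \bar R) : uniq L -> (forall z, 0 <= G z)%E ->
  (forall z, z \in L -> D z) -> (forall z, D z -> z \notin L -> G z = 0%E) ->
  (\esum_(z in D) G z = \sum_(z <- L) G z)%E.
Proof.
move=> uL G0 LD G0'.
have -> : (\esum_(z in D) G z = \esum_(z in [set` L]) G z)%E.
  rewrite esum_mkcond [RHS]esum_mkcond; apply: eq_esum => z _.
  rewrite !mem_setE; case: (boolP (z \in L)) => zL.
    by rewrite ifT // inE; exact: LD.
  by case: ifPn => //; rewrite inE => Dz; exact: G0'.
by rewrite esum_fset // -fsbig_seq.
Qed.

Lemma mem_dtup_pts (R : realType) (d : nat) (X : config R d) (A : set 'rV[R]_d)
    p (z : p.-tuple 'rV[R]_d) : bounded_set A ->
  z \in dtup (pts X A) p <-> uniq z /\ forall i, (points X `&` A) (tnth z i).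
Proof.
move=> bA; rewrite mem_dtup; split => [/andP[uz /allP hz]|[uz hz]].
  split => // i; have : tnth z i \in pts X A by apply: hz; exact: mem_tnth.
  by rewrite mem_pts // inE.
rewrite uz; apply/allP => u /tnthP[i ->].
by change (tnth z i \in pts X A); rewrite mem_pts // inE.
Qed.

Section tuple_split.
Context d (T : measurableType d) (m l : nat).

Definition ltup (z : (m + l).-tuple T) : m.-tuple T :=
  [tuple tnth z (lshift l i) | i < m].

Definition rtup (z : (m + l).-tuple T) : l.-tuple T :=
  [tuple tnth z (rshift m i) | i < l].

Lemma ltup_cat x y : ltup (cat_tuple x y) = x.
Proof. by apply: eq_from_tnth => i; rewrite tnth_mktuple tnth_lshift. Qed.

Lemma rtup_cat x y : rtup (cat_tuple x y) = y.
Proof. by apply: eq_from_tnth => i; rewrite tnth_mktuple tnth_rshift. Qed.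

Lemma cat_ltup_rtup z : cat_tuple (ltup z) (rtup z) = z.
Proof.
apply: eq_from_tnth => i; have [j ->|j ->] := split_ordP i.
  by rewrite tnth_lshift tnth_mktuple.
by rewrite tnth_rshift tnth_mktuple.
Qed.

Lemma measurable_ltup : measurable_fun setT ltup.
Proof.
apply/measurable_fun_tnthP => i.
rewrite (_ : _ \o _ = fun z => tnth z (lshift l i)); first exact: measurable_tnth.
by apply/funext => z /=; rewrite tnth_mktuple.
Qed.

Lemma measurable_rtup : measurable_fun setT rtup.
Proof.
apply/measurable_fun_tnthP => i.
rewrite (_ : _ \o _ = fun z => tnth z (rshift m i)); first exact: measurable_tnth.
by apply/funext => z /=; rewrite tnth_mktuple.
Qed.

End tuple_split.

Definition pw (R : realType) (d : nat) (A : set 'rV[R]_d) m :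
    set (m.-tuple 'rV[R]_d) :=
  [set x | forall i, A (tnth x i)].
Arguments pw {R d} A m.

Lemma measurable_pw (R : realType) (d : nat) (A : set 'rV[R]_d) m :
  measurable A -> measurable (pw A m).
Proof. by move=> mA; exact: (@measurable_tuple_box _ _ m (fun=> A)). Qed.

Section campbell.
Context (R : realType) (d : nat).
Local Notation E := 'rV[R]_d.
Local Notation N := (config R d).
Context (disp : measure_display) (Omega : measurableType disp)
  (P : probability Omega R) (pp : {RV P >-> N})
  (rho : forall p, p.-tuple E -> R) (palm : forall p, R.-pker p.-tuple E ~> N).
Local Notation leb := (power_measure (lebesgue_vec R d)).

(* EDC and the Palm formula do not constrain rho 0, the empty correlation. *)
Definition corr0 p (x : p.-tuple E) : R := if p is 0 then 1 else rho x.

Hypotheses (ppalm : is_palm pp rho palm) (pcorr : is_correlation pp rho).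

Lemma corr0_ge0 p (x : p.-tuple E) : 0 <= corr0 x.
Proof. by case: p x => [|p] x //=; have [] := pcorr (ltn0Sn p). Qed.

Lemma measurable_corr0 p : measurable_fun setT (@corr0 p).
Proof.
by case: p => [|p]; [exact: measurable_cst|have [] := pcorr (ltn0Sn p)].
Qed.

(** For functions of the tuple alone, the Palm measures enter the Palm formula only through their
    total mass 1. For p = 0 both sides are the value of G at the empty tuple. *)
Lemma campbell p (G : p.-tuple E -> R) : measurable_fun setT G ->
  (forall x, 0 <= G x) ->
  (\int[P]_w (\esum_(x in [set x : p.-tuple E |
        uniq x /\ forall i, points (pp w) (tnth x i)]) (G x)%:E) =
   \int[leb p]_x (G x * corr0 x)%:E)%E.
Proof.
move=> mG G0; case: p G mG G0 => [|p] G mG G0.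
  rewrite integral_power_measure0; last first.
    by apply/measurable_EFinP; apply: measurable_funM => //; exact: measurable_corr0.
  rewrite /= mulr1 (eq_integral (cst (G [tuple])%:E)) => [|w _].
    by rewrite integral_cst // [X in (_ * X)%E](@probability_setT _ _ _ P) mule1.
  rewrite (_ : [set _ | _] = [set [tuple]]) ?esum_set1 ?lee_fin //.
  apply/seteqP; split => x /=; first by rewrite tuple0.
  by move=> ->; split => // -[].
have := @ppalm p.+1 (ltn0Sn p) (fun u => (G u.1)%:E).
move=> -> //; last by move=> u; rewrite lee_fin.
  apply: eq_integral => x _; rewrite [X in (X * _)%E](integral_cst _ _ (G x)%:E) //.
  by rewrite [X in (_ * X * _)%E]prob_kernel mule1 EFinM.
by apply/measurable_EFinP; exact: measurableT_comp.
Qed.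

Lemma campbell_dtup (A : set E) m (phi : m.-tuple E -> R) :
  bounded_borel A -> measurable_fun setT phi -> (forall x, 0 <= phi x) ->
  (\int[P]_w (\sum_(z <- dtup (pts (pp w) A) m) phi z)%:E =
   \int[leb m]_x (\1_(pw A m) x * phi x * corr0 x)%:E)%E.
Proof.
move=> [mA bA] mphi phi0.
rewrite -campbell; last 2 first.
- by apply: measurable_funM => //; apply: measurable_indic; exact: measurable_pw.
- by move=> x; rewrite mulr_ge0.
apply: eq_integral => w _; rewrite (@esum_uniq_seq _ _ _ (dtup (pts (pp w) A) m)).
- rewrite -sumEFin big_seq [RHS]big_seq; apply: eq_bigr => z /(mem_dtup_pts _ _ bA).
  by move=> [_ hz]; rewrite indicE mem_set ?mul1r // => i; have [] := hz i.
- by apply: dtup_uniq; exact: pts_uniq.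
- by move=> z; rewrite lee_fin mulr_ge0.
- by move=> z /(mem_dtup_pts _ _ bA)[uz hz]; split => // i; have [] := hz i.
- move=> z [uz hz] /negP hn; rewrite indicE memNset ?mul0r // => Az.
  by apply: hn; apply/(mem_dtup_pts _ _ bA); split => // i; split; move: i.
Qed.

(** Since A and B are disjoint, a distinct tuple in A followed by a distinct tuple in B is again
    distinct. The product of the two sums is thus one sum over distinct (m+l)-tuples, to which the
    formula of order m + l and Tonelli apply. *)
Lemma campbell_dtup2 (A B : set E) m l (phi : m.-tuple E -> R)
    (psi : l.-tuple E -> R) :
  bounded_borel A -> bounded_borel B -> A `&` B = set0 ->
  measurable_fun setT phi -> (forall x, 0 <= phi x) ->
  measurable_fun setT psi -> (forall x, 0 <= psi x) ->
  (\int[P]_w ((\sum_(z <- dtup (pts (pp w) A) m) phi z) *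
              (\sum_(z <- dtup (pts (pp w) B) l) psi z))%:E =
   \int[leb m]_x \int[leb l]_y
     (\1_(pw A m) x * phi x * (\1_(pw B l) y * psi y) *
      corr0 (cat_tuple x y))%:E)%E.
Proof.
move=> [mA bA] [mB bB] AB mphi phi0 mpsi psi0.
pose G (z : (m + l).-tuple E) := \1_(pw A m) (ltup z) * phi (ltup z) *
  (\1_(pw B l) (rtup z) * psi (rtup z)).
have mG : measurable_fun setT G.
  apply: measurable_funM; apply: measurable_funM.
  - apply: measurableT_comp; last exact: measurable_ltup.
    by apply: measurable_indic; exact: measurable_pw.
  - by apply: measurableT_comp => //; exact: measurable_ltup.
  - apply: measurableT_comp; last exact: measurable_rtup.
    by apply: measurable_indic; exact: measurable_pw.
  - by apply: measurableT_comp => //; exact: measurable_rtup.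
have G0 z : 0 <= G z by rewrite /G !mulr_ge0.
transitivity (\int[leb (m + l)]_z (G z * corr0 z)%:E)%E; last first.
  rewrite integral_power_measure_cat; last 2 first.
  - by apply/measurable_EFinP; apply: measurable_funM => //; exact: measurable_corr0.
  - by move=> z; rewrite lee_fin mulr_ge0 // corr0_ge0.
  by apply: eq_integral => x _; apply: eq_integral => y _; rewrite /G ltup_cat rtup_cat.
rewrite -campbell //; apply: eq_integral => w _.
have inA z : z \in dtup (pts (pp w) A) m -> uniq z /\ forall i, (pp w `&` A) (tnth z i).
  by move/(mem_dtup_pts _ _ bA).
have inB z : z \in dtup (pts (pp w) B) l -> uniq z /\ forall i, (pp w `&` B) (tnth z i).
  by move/(mem_dtup_pts _ _ bB).
rewrite (@esum_uniq_seq _ _ _ [seq cat_tuple x y | x <- dtup (pts (pp w) A) m,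
   y <- dtup (pts (pp w) B) l]).
- rewrite sumEFin big_allpairs_dep mulr_suml; congr (_%:E).
  rewrite big_seq [RHS]big_seq; apply: eq_bigr => x xA.
  rewrite mulr_sumr big_seq [RHS]big_seq; apply: eq_bigr => y yB.
  rewrite /G ltup_cat rtup_cat !indicE !mem_set ?mul1r //.
    by move=> i; have [_ /(_ i)[]] := inB y yB.
  by move=> i; have [_ /(_ i)[]] := inA x xA.
- apply: allpairs_uniq; [exact/dtup_uniq/pts_uniq|exact/dtup_uniq/pts_uniq|].
  move=> [x y] [x' y'] _ _ /= e; have := congr1 (@ltup _ _ m l) e.
  by have := congr1 (@rtup _ _ m l) e; rewrite !ltup_cat !rtup_cat => -> ->.
- by move=> z; rewrite lee_fin.
- move=> z /allpairsP[[x y] /= [xA yB ->]]; split.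
    have [ux hx] := inA x xA; have [uy hy] := inB y yB.
    rewrite /= cat_uniq ux uy andbT /=; apply/hasPn => u /tnthP[j ->]; apply/negP => /tnthP[i e].
    have [_ hB] := hy j; have [_ hA] := hx i.
    have : (A `&` B) (tnth y j) by split => //; rewrite e.
    by rewrite AB.
  move=> i; have [j ->|j ->] := split_ordP i; rewrite ?tnth_lshift ?tnth_rshift.
    by have [_ /(_ j)[]] := inA x xA.
  by have [_ /(_ j)[]] := inB y yB.
- move=> z [uz hz] zL; rewrite /G.
  have [hA|hA] := pselect (pw A m (ltup z)); last by rewrite indicE memNset // !mul0r.
  have [hB|hB] := pselect (pw B l (rtup z)); last by rewrite [X in _ * (X * _)]indicE memNset // mul0r mulr0.
  exfalso; move/negP: zL; apply; apply/allpairsP.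
  exists (ltup z, rtup z); rewrite cat_ltup_rtup; split => //=.
    apply/(mem_dtup_pts _ _ bA); split.
      by move: uz; rewrite -{1}(cat_ltup_rtup z) cat_uniq => /andP[].
    by move=> i; split; [rewrite tnth_mktuple; exact: hz|exact: hA].
  apply/(mem_dtup_pts _ _ bB); split.
    by move: uz; rewrite -{1}(cat_ltup_rtup z) cat_uniq => /and3P[].
  by move=> i; split; [rewrite tnth_mktuple; exact: hz|exact: hB].
Qed.

End campbell.

(** * Consequences of the decay of correlations *)

Section correlation_decay.
Context (R : realType) (d : nat).
Local Notation E := 'rV[R]_d.
Local Notation N := (config R d).
Context (rho : forall p, p.-tuple E -> R).

Lemma val_subtuple p (x : p.-tuple E) (I : {set 'I_p}) :
  subtuple x I = [seq tnth x i | i <- enum I] :> seq E.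
Proof.
have sI : size (enum I) = #|I| by rewrite -cardE.
apply: (@eq_from_nth _ 0); first by rewrite size_tuple size_map sI.
move=> i; rewrite size_tuple => iI.
rewrite -[i]/(val (Ordinal iI)) -tnth_nth tnth_mktuple /=.
have x0 := enum_val (Ordinal iI).
by rewrite (nth_map x0) ?sI // (enum_val_nth x0).
Qed.

Lemma map_tnth_filter p (x : p.-tuple E) (a : pred nat) :
  [seq tnth x i | i <- enum (finset (fun i : 'I_p => a i))] =
  [seq nth 0 x i | i <- iota 0 p & a i].
Proof.
rewrite -val_enum_ord filter_map -map_comp.
rewrite (_ : enum (finset (fun i : 'I_p => a i)) = seq.filter (preim val a) (enum 'I_p)).
  by apply: eq_map => i /=; rewrite (tnth_nth 0).
rewrite {1}/enum_mem -enumT; apply: eq_filter => i /=.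
by rewrite inE.
Qed.

(** The length #|I| of a subtuple equals the expected length only up to a proof, so correlations are
    compared through the underlying sequences. *)
Lemma corr0_val p q (x : p.-tuple E) (y : q.-tuple E) :
  x = y :> seq E -> corr0 rho x = corr0 rho y.
Proof.
move=> xy; have pq : p = q by rewrite -(size_tuple x) -(size_tuple y) xy.
by subst q; congr (corr0 rho _); exact: val_inj.
Qed.

Lemma enorm_ge0 (x : E) : 0 <= enorm x.
Proof. exact: sqrtr_ge0. Qed.

Context (disp : measure_display) (Omega : measurableType disp)
  (P : probability Omega R) (pp : {RV P >-> N}) (a ahat : R).
Hypotheses (pcorr : is_correlation pp rho) (edc : EDC rho a ahat).
Hypotheses (a0 : 0 <= a) (ahat0 : 0 < ahat).

(** EDC with I the set of the first m indices. When one of the tuples is empty the difference is 0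
    by the convention in [corr0]. *)
Lemma EDC_corr0_decay : exists K c, [/\ 1 <= K, 0 < c &
  forall m l (x : m.-tuple E) (y : l.-tuple E) s, 0 <= s ->
    (forall i j, s <= enorm (tnth x i - tnth y j)) ->
    `|corr0 rho (cat_tuple x y) - corr0 rho x * corr0 rho y| <=
    K ^+ (m + l) * (m + l)`!%:R `^ a * expR (- c * s `^ ahat)].
Proof.
have [C [Phi [C1 Phi0 _ [c [C' [c0 C'0 Phile]]] hC]]] := edc.
(* The factor 1 + C', raised to a power at least 2, absorbs the constant C' in front of the
   exponential bounding [Phi]. *)
exists (C * (1 + C')), c; split => //.
  by rewrite mulr_ege1 // lerDl ltW.
move=> m l x y s s0 hs.
have rhs0 : 0 <= (C * (1 + C')) ^+ (m + l) * (m + l)`!%:R `^ a * expR (- c * s `^ ahat).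
  by have C0 : 0 <= C by [exact: le_trans C1]; nonneg.
have [m0|m0] := posnP m.
  subst m; rewrite (tuple0 x) (@corr0_val _ _ (cat_tuple [tuple] y) y) //.
  by rewrite /= mul1r subrr normr0.
have [l0|l0] := posnP l.
  subst l; rewrite (tuple0 y) (@corr0_val _ _ (cat_tuple x [tuple]) x) //; last exact: cats0.
  by rewrite /= mulr1 subrr normr0.
set z := cat_tuple x y.
pose I : {set 'I_(m + l)} := finset (fun i : 'I_(m + l) => (i < m)%N).
have vI : subtuple z I = x :> seq E.
  rewrite val_subtuple (map_tnth_filter z (fun i => i < m)%N) iotaD filter_cat.
  rewrite (eq_in_filter (a2 := xpredT)); last by move=> i; rewrite mem_iota => /andP[].
  rewrite [X in _ ++ X](eq_in_filter (a2 := xpred0)); last first.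
    by move=> i; rewrite mem_iota add0n => /andP[mi _]; rewrite ltnNge mi.
  rewrite filter_predT filter_pred0 cats0 map_nth_iota0; last by rewrite size_tuple leq_addr.
  by rewrite /= take_size_cat // size_tuple.
have cI : ~: I = finset (fun i : 'I_(m + l) => (m <= i)%N).
  by apply/setP => i; rewrite !inE -leqNgt.
have vI' : subtuple z (~: I) = y :> seq E.
  rewrite cI val_subtuple (map_tnth_filter z (fun i => m <= i)%N) iotaD filter_cat.
  rewrite (eq_in_filter (a2 := xpred0)); last first.
    by move=> i; rewrite mem_iota add0n => /andP[_ im]; rewrite leqNgt im.
  rewrite [X in _ ++ X](eq_in_filter (a2 := xpredT)); last first.
    by move=> i; rewrite mem_iota add0n => /andP[].
  rewrite filter_predT filter_pred0 cat0s map_nth_iota; last by rewrite size_tuple addKn.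
  by rewrite /= drop_size_cat ?size_tuple // take_oversize // size_tuple.
have ml2 : (2 <= m + l)%N by lia.
have I0 : I != finset.set0.
  apply/set0Pn; exists (lshift l (Ordinal m0)); by rewrite inE /=.
have IT : I \proper finset.setT.
  rewrite properT; apply/negP => /eqP/setP/(_ (rshift m (Ordinal l0))).
  by rewrite !inE /= ltnNge leq_addr.
have := hC (m + l)%N z I ml2 I0 IT.
have cE p (u : p.-tuple E) : (0 < p)%N -> corr0 rho u = rho u by case: p u.
have sI : #|I| = m by rewrite -(size_tuple (subtuple z I)) vI size_tuple.
have sI' : #|~: I| = l by rewrite -(size_tuple (subtuple z (~: I))) vI' size_tuple.
rewrite -(cE _ z) ?(leq_trans _ ml2) // -(cE _ (subtuple z I)) ?sI //.
rewrite -(cE _ (subtuple z (~: I))) ?sI' //.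
rewrite (corr0_val vI) (corr0_val vI') => h; apply: (le_trans h).
have sle : s <= tdist (subtuple z I) (subtuple z (~: I)).
  apply: lb_le_inf.
    have i0 : 'I_#|I| by rewrite sI; exact: Ordinal m0.
    have j0 : 'I_#|~: I| by rewrite sI'; exact: Ordinal l0.
    by exists (enorm (tnth (subtuple z I) i0 - tnth (subtuple z (~: I)) j0)), i0 => //; exists j0.
  move=> _ [i _ [j _ <-]].
  have hx : tnth (subtuple z I) i \in (x : seq E) by rewrite -vI; exact: mem_tnth.
  have hy : tnth (subtuple z (~: I)) j \in (y : seq E) by rewrite -vI'; exact: mem_tnth.
  move: hx hy => /tnthP[i' ->] /tnthP[j' ->].
  exact: hs.
have C0 : 0 <= C by exact: le_trans C1.
apply: (@le_trans _ _ (C ^+ (m + l) * (m + l)`!%:R `^ a * (C' * expR (- c * s `^ ahat)))).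
  apply: ler_wpM2l; first by nonneg.
  apply: le_trans (Phile _ (le_trans s0 sle)) _.
  apply: ler_wpM2l; first exact: ltW.
  rewrite ler_expR !mulNr lerN2 ler_pM2l //; apply: ge0_ler_powR => //; first exact: ltW.
  by rewrite nnegrE (le_trans s0).
rewrite exprMn mulrACA mulrA; apply: ler_wpM2r; first by nonneg.
rewrite -!mulrA; apply: ler_wpM2l; first by nonneg.
apply: ler_wpM2r; first by nonneg.
have h1 : 1 <= 1 + C' by rewrite lerDl ltW.
apply: (@le_trans _ _ (1 + C')); first by rewrite lerDr.
by rewrite -{1}[1 + C']expr1; apply: ler_weXn2l => //; exact: ltnW.
Qed.

(** EDC also bounds the correlations themselves. At the pair (x, x) the second correlation vanishes,
    so EDC bounds the square of the first one. Higher orders follow by splitting off one point at a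
    time, with s = 0. *)
Lemma EDC_corr0 : exists K c, [/\ 1 <= K, 0 < c,
  forall p (x : p.-tuple E), corr0 rho x <= K ^+ p * p`!%:R `^ a &
  forall m l (x : m.-tuple E) (y : l.-tuple E) s, 0 <= s ->
    (forall i j, s <= enorm (tnth x i - tnth y j)) ->
    `|corr0 rho (cat_tuple x y) - corr0 rho x * corr0 rho y| <=
    K ^+ (m + l) * (m + l)`!%:R `^ a * expR (- c * s `^ ahat)].
Proof.
have [K [c [K1 c0 hK]]] := EDC_corr0_decay.
have K0 : 0 <= K by exact: le_trans K1.
have e1 s : 0 <= s -> expR (- c * s `^ ahat) <= 1.
  by move=> s0; rewrite -expR0 ler_expR mulNr oppr_le0; nonneg.
(* The summand 1 makes [kap] at least 1, so that a nonnegative number whose square is at most [kap]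
   is itself at most [kap]. *)
pose kap := 1 + K ^+ 2 * 2%:R `^ a.
have kap1 : 1 <= kap by rewrite /kap lerDl; nonneg.
have kap0 : 0 <= kap by exact: le_trans kap1.
have rho1 (x : 1.-tuple E) : corr0 rho x <= kap.
  have := hK 1%N 1%N x x 0 (lexx 0) (fun _ _ => enorm_ge0 _).
  have -> : corr0 rho (cat_tuple x x) = 0.
    have [_ _ + _] := pcorr (ltn0Sn 1); apply.
    by case: x => -[//|u [|//]] /= _; rewrite mem_seq1 eqxx.
  rewrite sub0r normrN normrM ger0_norm ?(corr0_ge0 pcorr) // => h.
  have {}h : corr0 rho x * corr0 rho x <= kap.
    apply: (le_trans h); rewrite /kap ler_wpDl //.
    by rewrite ler_piMr ?e1 //; nonneg.
  rewrite leNgt; apply/negP => xk; move: h; rewrite leNgt => /negP; apply.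
  apply: (lt_le_trans xk); rewrite ler_pMl ?(lt_le_trans _ (ltW xk)) //.
    exact: ltW (le_lt_trans kap1 xk).
  exact: lt_le_trans kap1.
(* In the induction step one factor of the power is split as kap + K: kap pays for the product of
   correlations, K for the decay error. *)
exists (kap + K), c; split => //.
- by rewrite -[leLHS]addr0 lerD.
- elim => [|p IH] x; first by rewrite /= expr0 mul1r fact0 powR1.
  have [x1 [x2 xE]] : exists (x1 : 1.-tuple E) (x2 : p.-tuple E), x = cat_tuple x1 x2.
    exists [tuple thead x], [tuple of behead x].
    by apply: val_inj; rewrite {1}(tuple_eta x).
  rewrite xE.
  have := hK 1%N p x1 x2 0 (lexx 0) (fun _ _ => enorm_ge0 _).
  rewrite ler_norml => /andP[_]; rewrite lerBlDr => h; apply: (le_trans h).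
  rewrite exprS mulrDl mulrDl addrC; apply: lerD.
    rewrite -mulrA; apply: ler_pM => //; rewrite ?(corr0_ge0 pcorr) //.
    apply: (le_trans (IH x2)); apply: ler_wpM2l; first by nonneg.
    by apply: ge0_ler_powR; rewrite ?nnegrE // ler_nat factS leq_pmull.
  rewrite -[leRHS]mulr1; apply: ler_pM; [by nonneg|by nonneg| |exact: e1].
  rewrite add1n exprS; apply: ler_wpM2r; first by nonneg.
  apply: ler_wpM2l => //; apply: lerXn2r; rewrite ?nnegrE //.
    by rewrite addr_ge0 // (le_trans _ kap1).
  by rewrite lerDr (le_trans _ kap1).
move=> m l x y s s0 hs; apply: (le_trans (hK _ _ _ _ _ s0 hs)).
apply: ler_wpM2r; first by nonneg.
apply: ler_wpM2r; first by nonneg.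
apply: lerXn2r; rewrite ?nnegrE //.
  by rewrite addr_ge0 // (le_trans _ kap1).
by rewrite lerDr (le_trans _ kap1).
Qed.

End correlation_decay.

(** * Decoupling of distant regions *)

Definition cov2 d (T : measurableType d) (R : realType)
    (P : probability T R) (X Y : T -> R) : R :=
  \int[P]_w (X w * Y w) - \int[P]_w X w * \int[P]_w Y w.

Section cov2_theory.
Context d (T : measurableType d) (R : realType) (P : probability T R)
  (adm : (T -> R) -> Prop).
Hypothesis algA : moment_algebra P adm.

Lemma cov2C X Y : cov2 P X Y = cov2 P Y X.
Proof.
by rewrite /cov2 mulrC; congr (_ - _); apply: eq_Rintegral => w _; rewrite mulrC.
Qed.

Lemma cov2Bl X X' Y : adm X -> adm X' -> adm Y ->
  cov2 P (fun w => X w - X' w) Y = cov2 P X Y - cov2 P X' Y.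
Proof.
move=> aX aX' aY; rewrite /cov2.
under eq_Rintegral do rewrite mulrBl.
rewrite (expB algA (admM algA aX aY) (admM algA aX' aY)) (expB algA aX aX').
by ring.
Qed.

Lemma cov2_suml n (c : 'I_n -> R) X Y : (forall i, adm (X i)) -> adm Y ->
  cov2 P (fun w => \sum_(i < n) c i * X i w) Y = \sum_(i < n) c i * cov2 P (X i) Y.
Proof.
move=> aX aY; rewrite /cov2.
under eq_Rintegral do rewrite mulr_suml.
rewrite (exp_sum algA); last first.
  by move=> i; apply: (admM algA) => //; exact: (admZ algA).
rewrite (exp_sum algA); last by move=> i; exact: (admZ algA).
rewrite mulr_suml -sumrB; apply: eq_bigr => i _.
under eq_Rintegral do rewrite -mulrA.
rewrite (expZ algA); last exact: (admM algA).
by rewrite (expZ algA) //; ring.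
Qed.

Lemma cov2_norm_le X Y U U' e : adm X -> adm Y -> adm U -> adm U' -> 0 <= e ->
  (forall w, `|X w| <= e * U w) -> (forall w, `|Y w| <= U' w) ->
  `|cov2 P X Y| <= e * (\int[P]_w (U w * U' w) + \int[P]_w U w * \int[P]_w U' w).
Proof.
move=> aX aY aU aU' e0 XU YU; apply: (le_trans (ler_normB _ _)).
rewrite mulrDr; apply: lerD.
  rewrite -(expZ algA); last exact: (admM algA).
  apply: (exp_norm_le algA); first exact: (admM algA).
    by apply: (admZ algA); exact: (admM algA).
  by move=> w; rewrite normrM mulrA ler_pM.
rewrite normrM mulrA -(expZ algA e aU); apply: ler_pM => //.
  by apply: (exp_norm_le algA) => //; exact: (admZ algA).
exact: (exp_norm_le algA).
Qed.

End cov2_theory.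

Lemma ler_pM_norm (R : realDomainType) (V x y : R) (n : nat) : 0 <= x -> x <= y ->
  V * x ^+ n <= `|V| * y ^+ n.
Proof.
move=> x0 xy; apply: (@le_trans _ _ (`|V| * x ^+ n)).
  by apply: ler_wpM2r; [exact: exprn_ge0|exact: ler_norm].
apply: ler_wpM2l => //; apply: lerXn2r; rewrite ?nnegrE //.
exact: le_trans xy.
Qed.

Lemma integral_prod_indep d1 d2 (T1 : measurableType d1) (T2 : measurableType d2)
    (R : realType) (m1 : {sigma_finite_measure set T1 -> \bar R})
    (m2 : {sigma_finite_measure set T2 -> \bar R}) (u : T1 -> R) (v : T2 -> R) :
  measurable_fun setT u -> measurable_fun setT v ->
  (forall x, 0 <= u x) -> (forall y, 0 <= v y) ->
  (\int[m1 \x m2]_z (u z.1 * v z.2)%:E =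
   \int[m1]_x (u x)%:E * \int[m2]_y (v y)%:E)%E.
Proof.
move=> mu mv u0 v0; rewrite fubini_tonelli1; last 2 first.
- by apply/measurable_EFinP; apply: measurable_funM; exact: measurableT_comp.
- by move=> z; rewrite lee_fin mulr_ge0.
rewrite -ge0_integralZr //; last 3 first.
- exact/measurable_EFinP.
- by move=> x _; rewrite lee_fin.
- by apply: integral_ge0 => y _; rewrite lee_fin.
apply: eq_integral => x _; rewrite /fubini_F /=.
under eq_integral do rewrite EFinM.
rewrite ge0_integralZl_EFin //; last exact/measurable_EFinP.
by move=> y _; rewrite lee_fin.
Qed.

Section tuple_sum_moments.
Context (R : realType) (d : nat).
Local Notation E := 'rV[R]_d.
Local Notation N := (config R d).
Context (disp : measure_display) (Omega : measurableType disp)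
  (P : probability Omega R) (pp : {RV P >-> N})
  (rho : forall p, p.-tuple E -> R) (palm : forall p, R.-pker p.-tuple E ~> N).
Local Notation leb := (power_measure (lebesgue_vec R d)).
Hypotheses (ppalm : is_palm pp rho palm) (pcorr : is_correlation pp rho).
Context (K a : R).
Hypotheses (K1 : 1 <= K)
  (hrho : forall p (x : p.-tuple E), corr0 rho x <= K ^+ p * p`!%:R `^ a).

Lemma measurable_pp : measurable_fun setT (pp : Omega -> N).
Proof. exact: measurable_funPT. Qed.

Lemma K_ge0 : 0 <= K.
Proof. exact: le_trans K1. Qed.

(** The Campbell formula, with the correlation bounded pointwise and the tuples confined to a power
    of A. *)
Lemma integral_dtup_le (A : set E) (al V : R) m (phi : m.-tuple E -> R) :
  bounded_borel A -> (lebesgue_vec R d A <= al%:E)%E ->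
  measurable_fun setT phi -> (forall x, 0 <= phi x <= V) ->
  (\int[P]_w (\sum_(z <- dtup (pts (pp w) A) m) phi z)%:E <=
   (V * al ^+ m * (K ^+ m * m`!%:R `^ a))%:E)%E.
Proof.
move=> bA Aal mphi phiV; have K0 := K_ge0.
have V0 : 0 <= V.
  by have /andP[] := phiV (nseq_tuple m 0); exact: le_trans.
have mA : measurable A by case: bA.
rewrite (campbell_dtup ppalm pcorr) //; last by move=> x; have /andP[] := phiV x.
apply: (@le_trans _ _ (\int[leb m]_x ((V * (K ^+ m * m`!%:R `^ a))%:E * (\1_(pw A m) x)%:E))%E).
  apply: ge0_le_integral => //.
  - move=> x _; rewrite lee_fin; have /andP[h _] := phiV x.
    by rewrite !mulr_ge0 // (corr0_ge0 pcorr).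
  - apply/measurable_EFinP; apply: measurable_funM; last exact: (measurable_corr0 pcorr).
    by apply: measurable_funM => //; apply: measurable_indic; exact: measurable_pw.
  - apply/measurable_EFinP; apply: measurable_funM => //.
    by apply: measurable_indic; exact: measurable_pw.
  - move=> x _; rewrite lee_fin [leRHS]mulrC -mulrA; apply: ler_wpM2l => //.
    by have /andP[h1 h2] := phiV x; apply: ler_pM => //; exact: (corr0_ge0 pcorr).
rewrite ge0_integralZl_EFin //; last 2 first.
- by apply/measurable_EFinP; apply: measurable_indic; exact: measurable_pw.
- by nonneg.
rewrite integral_indic //; last exact: measurable_pw.
rewrite setIT [X in (_ <= X%:E)%E]mulrAC [leRHS]EFinM; apply: lee_wpmul2l; first by rewrite lee_fin; nonneg.
exact: (@power_measure_box_le _ _ _ _ m (fun=> A)).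
Qed.

Lemma integral_ffact_npts_le (A : set E) (al : R) m :
  bounded_borel A -> (lebesgue_vec R d A <= al%:E)%E ->
  (\int[P]_w ((npts (pp w) A ^_ m)%:R)%:E <= (al ^+ m * (K ^+ m * m`!%:R `^ a))%:E)%E.
Proof.
move=> bA Aal.
have := @integral_dtup_le A al 1 m (fun=> 1) bA Aal (measurable_cst _).
rewrite mul1r => h; apply: le_trans (h _); last by rewrite ler01 lexx.
rewrite le_eqVlt; apply/orP; left; apply/eqP; apply: eq_integral => w _.
rewrite big_const_seq count_predT iter_addr_0 size_dtup; last exact: pts_uniq.
by rewrite npts_size.
Qed.

Context (q : nat).
Hypotheses (a0 : 0 <= a) (qa : 1 <= q%:R * (1 - a)).

Lemma measurable_npts_pp (A : set E) : bounded_borel A ->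
  measurable_fun setT (fun w => npts (pp w) A).
Proof.
move=> bA; apply: (@measurableT_comp _ _ _ _ _ _ (fun X : N => npts X A)).
  exact: measurable_npts.
exact: measurable_pp.
Qed.

Lemma measurable_comp_npts (A : set E) (g : nat -> R) : bounded_borel A ->
  measurable_fun setT (fun w => g (npts (pp w) A)).
Proof.
by move=> bA; apply: (@measurableT_comp _ _ _ _ _ _ g) => //; exact: measurable_npts_pp.
Qed.

(** Expand (1 + c)^n as the sum of c^m / m! times the falling factorials of n and integrate
    termwise. Factorial moments of order m are at most (al K)^m m!^a, so the resulting series is the
    one of [powR_fact_series_le]. *)
Lemma integral_expn_npts_le (A : set E) (al : R) c :
  bounded_borel A -> (lebesgue_vec R d A <= al%:E)%E -> 0 <= al ->
  (\int[P]_w (c.+1%:R ^+ npts (pp w) A)%:E <=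
   (2 * expR ((2 * (c%:R * al * K)) ^+ q))%:E)%E.
Proof.
move=> bA Aal al0; have K0 := K_ge0.
pose u m w : \bar R := (c%:R ^+ m / m`!%:R * (npts (pp w) A ^_ m)%:R)%:E.
have u0 m w : (0 <= u m w)%E by rewrite lee_fin; nonneg.
have mu m : measurable_fun setT (u m).
  apply/measurable_EFinP; apply: measurable_funM => //.
  exact: (@measurable_comp_npts A (fun n => (n ^_ m)%:R)).
apply: (@le_trans _ _ (\int[P]_w \sum_(0 <= m <oo) u m w)%E).
  apply: ge0_le_integral => //.
  - apply/measurable_EFinP; exact: (@measurable_comp_npts A (fun n => c.+1%:R ^+ n)).
  - exact: ge0_emeasurable_sum.
  - move=> w _; set n := npts _ _.
    apply: le_trans (nneseries_lim_ge n.+1 (fun m _ _ => u0 m w)).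
    rewrite big_mkord sumEFin lee_fin -[c.+1]add1n natrD exprDn.
    rewrite le_eqVlt; apply/orP; left; apply/eqP; apply: eq_bigr => i _.
    rewrite expr1n mul1r -/n -bin_ffact natrM mulrCA.
    by rewrite -!mulrA mulVf ?mulr1 ?pnatr_eq0 -?lt0n ?fact_gt0 // mulr_natl.
rewrite integral_nneseries //.
apply: lime_le; first by apply: is_cvg_nneseries => m _ _; exact: integral_ge0.
near=> M; rewrite big_mkord.
apply: (@le_trans _ _ (\sum_(m < M) ((c%:R * al * K) ^+ m * m`!%:R `^ a / m`!%:R)%:E)%E).
  apply: lee_sum => m _; rewrite /u.
  under eq_integral do rewrite EFinM.
  rewrite ge0_integralZl_EFin //; last first.
    by apply/measurable_EFinP; exact: (@measurable_comp_npts A (fun n => (n ^_ m)%:R)).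
  apply: (@le_trans _ _ ((c%:R ^+ m / m`!%:R)%:E * (al ^+ m * (K ^+ m * m`!%:R `^ a))%:E)%E).
    apply: lee_wpmul2l; first by rewrite lee_fin; nonneg.
    exact: integral_ffact_npts_le.
  by rewrite -EFinM lee_fin !exprMn le_eqVlt; apply/orP; left; apply/eqP; ring.
rewrite sumEFin lee_fin; apply: powR_fact_series_le => //.
by nonneg.
Unshelve. all: by end_near. Qed.

Context (W : set E) (om : R).
Hypotheses (bW : bounded_borel W) (om0 : 0 <= om)
  (Wom : (lebesgue_vec R d W <= om%:E)%E).

(** Domination by an exponential of the number of points of W is stable under sums and products and
    implies integrability, so this is the moment algebra of the proof. Writing the base as [c.+1]
    keeps it at least 1. *)
Definition exp_npts_bounded (X : Omega -> R) := measurable_fun setT X /\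
  exists (V : R) (c : nat), forall w, `|X w| <= V * c.+1%:R ^+ npts (pp w) W.

Lemma exp_npts_bounded_algebra : moment_algebra P exp_npts_bounded.
Proof.
have prodS (c1 c2 : nat) : exists c, (c.+1 = c1.+1 * c2.+1)%N.
  by exists (c1.+1 * c2.+1).-1; rewrite prednK // muln_gt0.
split.
- move=> X [mX [V [c XV]]].
  apply: (@le_integrable _ _ _ _ _ measurableT _ (fun w => (V * c.+1%:R ^+ npts (pp w) W)%:E)).
  + exact/measurable_EFinP.
  + move=> w _; rewrite /= lee_fin; apply: (le_trans (XV w)); exact: ler_norm.
  + under eq_fun do rewrite EFinM.
    apply: integrableZl => //; apply/integrableP; split.
      by apply/measurable_EFinP; exact: (@measurable_comp_npts W (fun n => c.+1%:R ^+ n)).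
    under eq_integral => w _ do rewrite gee0_abs ?lee_fin ?exprn_ge0 //.
    by apply: le_lt_trans (integral_expn_npts_le c bW Wom om0) _; rewrite ltry.
- move=> c; split; first exact: measurable_cst.
  by exists `|c|, 0%N => w; rewrite expr1n mulr1.
- move=> X Y [mX [V [c XV]]] [mY [V' [c' YV]]]; split; first exact: measurable_funD.
  have [b bE] := prodS c c'.
  exists (`|V| + `|V'|), b => w; apply: (le_trans (ler_normD _ _)).
  rewrite mulrDl; apply: lerD.
    apply: (le_trans (XV w)); apply: ler_pM_norm => //; rewrite bE natrM.
    by rewrite ler_peMr // ler1n.
  apply: (le_trans (YV w)); apply: ler_pM_norm => //; rewrite bE natrM.
  by rewrite ler_peMl // ler1n.
- move=> X Y [mX [V [c XV]]] [mY [V' [c' YV]]]; split; first exact: measurable_funM.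
  have [b bE] := prodS c c'.
  exists (V * V'), b => w; rewrite bE natrM exprMn normrM mulrACA.
  exact: ler_pM.
Qed.

End tuple_sum_moments.

Lemma sum_bin_expn_le (R : realDomainType) (n M : nat) (x : R) : 0 <= x ->
  \sum_(m < M) 'C(n, m)%:R * x ^+ m <= (1 + x) ^+ n.
Proof.
move=> x0; rewrite exprDn.
have t0 m : 0 <= 'C(n, m)%:R * x ^+ m by rewrite mulr_ge0 // exprn_ge0.
have -> : \sum_(i < n.+1) 1 ^+ (n - i) * x ^+ i *+ 'C(n, i) =
    \sum_(i < n.+1) 'C(n, i)%:R * x ^+ i.
  by apply: eq_bigr => i _; rewrite expr1n mul1r mulr_natl.
have [Mn|nM] := leqP M n.+1.
  rewrite (big_ord_widen n.+1 (fun m => 'C(n, m)%:R * x ^+ m)) //.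
  by rewrite big_mkcond; apply: ler_sum => i _; case: ifP.
rewrite [leRHS](big_ord_widen M (fun m => 'C(n, m)%:R * x ^+ m)); last exact: ltnW.
rewrite [leRHS]big_mkcond; apply: ler_sum => i _; case: ifP => // /negbT.
by rewrite ltnS -ltnNge => ni; rewrite bin_small // mul0r.
Qed.

(** (m+l)! is C(m+l, m) m! l!, and the binomial coefficient raised to a <= 1 is at most 2^(m+l).
    This separates the two orders. *)
Lemma powR_factD_le (R : realType) (a : R) (m l : nat) : 0 <= a <= 1 ->
  (m + l)`!%:R `^ a <= 2 ^+ (m + l) * m`!%:R `^ a * l`!%:R `^ a.
Proof.
move=> /andP[a0 a1].
rewrite -(bin_fact (leq_addr l m)) addKn natrM powRM // natrM powRM // mulrA.
apply: ler_wpM2r; first exact: powR_ge0.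
apply: ler_wpM2r; first exact: powR_ge0.
have b1 : (1 : R) <= 'C(m + l, m)%:R by rewrite ler1n bin_gt0 leq_addr.
apply: (@le_trans _ _ ('C(m + l, m)%:R `^ 1)); first exact: ler_powR.
rewrite powRr1 // -natrX ler_nat.
have h : (2 ^ (m + l) = \sum_(i < (m + l).+1) 'C(m + l, i))%N.
  by rewrite (_ : 2 = 1 + 1)%N // expnDn; apply: eq_bigr => i _; rewrite !exp1n !muln1.
have ml : (m < (m + l).+1)%N by rewrite ltnS leq_addr.
by rewrite h (bigD1 (Ordinal ml)) //= leq_addr.
Qed.

(** Once (m+l)!^a is split, the double series over m and l is a product of two series as in
    [powR_fact_series_le]. *)
Lemma factorial_series_term_le (R : realType) (V V' x x' al al' K a de : R) m l :
  0 <= V -> 0 <= V' -> 0 <= x -> 0 <= x' -> 0 <= al -> 0 <= al' -> 0 <= K ->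
  0 <= a <= 1 -> 0 <= de ->
  (m`!%:R)^-1 * ((l`!%:R)^-1 * (4 * (V * x ^+ m * (V' * x' ^+ l) * al ^+ m *
     al' ^+ l * (K ^+ (m + l) * (m + l)`!%:R `^ a * de)))) <=
  4 * (V * V') * de * (((2 * K * x * al) ^+ m * m`!%:R `^ a / m`!%:R) *
                       ((2 * K * x' * al') ^+ l * l`!%:R `^ a / l`!%:R)).
Proof.
move=> V0 V'0 x0 x'0 al0 al'0 K0 a01 de0.
pose Z := (m`!%:R)^-1 * (l`!%:R)^-1 * (4 * (V * V')) * de * (x ^+ m * x' ^+ l) *
  (al ^+ m * al' ^+ l) * K ^+ (m + l).
have Z0 : 0 <= Z by rewrite /Z; nonneg.
have h := ler_wpM2l Z0 (powR_factD_le m l a01).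
apply: (@le_trans _ _ (Z * (m + l)`!%:R `^ a)); first by rewrite /Z le_eqVlt; apply/orP; left; apply/eqP; ring.
apply: (le_trans h); rewrite /Z !exprMn !exprD le_eqVlt; apply/orP; left; apply/eqP.
by ring.
Qed.

Section decoupling.
Context (R : realType) (d : nat).
Local Notation E := 'rV[R]_d.
Local Notation N := (config R d).
Context (disp : measure_display) (Omega : measurableType disp)
  (P : probability Omega R) (pp : {RV P >-> N})
  (rho : forall p, p.-tuple E -> R) (palm : forall p, R.-pker p.-tuple E ~> N).
Local Notation leb := (power_measure (lebesgue_vec R d)).
Hypotheses (ppalm : is_palm pp rho palm) (pcorr : is_correlation pp rho).
Context (K a : R) (q : nat).
Hypotheses (K1 : 1 <= K)
  (hrho : forall p (x : p.-tuple E), corr0 rho x <= K ^+ p * p`!%:R `^ a)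
  (a0 : 0 <= a) (qa : 1 <= q%:R * (1 - a)).
Context (W : set E) (om : R).
Hypotheses (bW : bounded_borel W) (om0 : 0 <= om)
  (Wom : (lebesgue_vec R d W <= om%:E)%E).
Context (A B : set E) (al al' s de : R).
Hypotheses (bA : bounded_borel A) (bB : bounded_borel B) (AW : A `<=` W)
  (BW : B `<=` W) (Aal : (lebesgue_vec R d A <= al%:E)%E)
  (Bal : (lebesgue_vec R d B <= al'%:E)%E) (s0 : 0 < s) (de0 : 0 <= de)
  (sep : forall x y, A x -> B y -> s <= enorm (x - y))
  (hdec : forall m l (x : m.-tuple E) (y : l.-tuple E),
    (forall i j, s <= enorm (tnth x i - tnth y j)) ->
    `|corr0 rho (cat_tuple x y) - corr0 rho x * corr0 rho y| <=
    K ^+ (m + l) * (m + l)`!%:R `^ a * de).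

Local Notation adm := (exp_npts_bounded pp W).

Let algA : moment_algebra P adm.
Proof. exact: (exp_npts_bounded_algebra ppalm pcorr K1 hrho a0 qa bW om0 Wom). Qed.

Let a01 : 0 <= a <= 1.
Proof.
rewrite a0 /= leNgt; apply/negP => a1; move: qa; rewrite leNgt => /negP; apply.
by apply: (@le_lt_trans _ _ 0) => //; rewrite mulr_ge0_le0 // subr_le0 ltW.
Qed.

Let K0 : 0 <= K. Proof. exact: le_trans K1. Qed.

Let al0 : 0 <= al.
Proof. by rewrite -lee_fin; apply: le_trans Aal; exact: measure_ge0. Qed.

Let al'0 : 0 <= al'.
Proof. by rewrite -lee_fin; apply: le_trans Bal; exact: measure_ge0. Qed.

Let AB0 : A `&` B = set0.
Proof.
apply/seteqP; split => // x [Ax Bx]; have := sep Ax Bx.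
rewrite subrr leNgt (_ : enorm 0 = 0) ?s0 //.
by rewrite /enorm big1 ?sqrtr0 // => i _; rewrite mxE expr0n.
Qed.

Lemma leq_size_dtup (D : set E) m (X : N) : D `<=` W ->
  (size (dtup (pts X D) m) <= m`! * 2 ^ npts X W)%N.
Proof.
move=> DW; rewrite size_dtup; last exact: pts_uniq.
rewrite -bin_ffact mulnC leq_mul2l; apply/orP; right.
have h : (size (pts X D) <= npts X W)%N by rewrite -npts_size leq_npts //; case: bW.
apply: leq_trans (leq_pexp2l _ h) => //.
have [mn|nm] := leqP m (size (pts X D)); last by rewrite bin_small.
rewrite (_ : 2 = 1 + 1)%N // expnDn.
have mn' : (m < (size (pts X D)).+1)%N by [].
by rewrite (bigD1 (Ordinal mn')) //= !exp1n !muln1 leq_addr.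
Qed.

Lemma adm_sum_dtup (D : set E) m (phi : m.-tuple E -> R) V :
  bounded_borel D -> D `<=` W -> measurable_fun setT phi ->
  (forall z, `|phi z| <= V) ->
  adm (fun w => \sum_(z <- dtup (pts (pp w) D) m) phi z).
Proof.
move=> bD DW mphi phiV; split.
  apply: (@measurable_sum_dtup _ _ _ _ _ _ _ bD m (fun u => phi u.1)).
    exact: (measurable_pp pp).
  exact: measurableT_comp.
have V0 : 0 <= V by apply: le_trans (phiV (nseq_tuple m 0)).
exists (m`!%:R * V), 1%N => w.
apply: (le_trans (ler_norm_sum_size (fun z _ => phiV z))).
rewrite mulrAC; apply: ler_wpM2r => //.
by rewrite -natrX -natrM ler_nat; exact: leq_size_dtup.
Qed.

(** By the Campbell formulas, the expectation of the product and the product of expectations are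
    integrals over the same product space, with densities [corr0 (cat_tuple x y)] and
    [corr0 x * corr0 y]. These are close wherever the integrand does not vanish, because A and B are
    separated. *)
Lemma cov2_sum_dtup_ge0 m l (phi : m.-tuple E -> R) (psi : l.-tuple E -> R) V V' :
  measurable_fun setT phi -> measurable_fun setT psi ->
  (forall z, 0 <= phi z <= V) -> (forall z, 0 <= psi z <= V') ->
  `|cov2 P (fun w => \sum_(z <- dtup (pts (pp w) A) m) phi z)
           (fun w => \sum_(z <- dtup (pts (pp w) B) l) psi z)| <=
  V * V' * al ^+ m * al' ^+ l * (K ^+ (m + l) * (m + l)`!%:R `^ a * de).
Proof.
move=> mphi mpsi phiV psiV.
have phi0 z : 0 <= phi z by case/andP: (phiV z).
have psi0 z : 0 <= psi z by case/andP: (psiV z).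
have nphiV z : `|phi z| <= V by rewrite ger0_norm //; case/andP: (phiV z).
have npsiV z : `|psi z| <= V' by rewrite ger0_norm //; case/andP: (psiV z).
have V0 : 0 <= V by apply: le_trans (nphiV (nseq_tuple m 0)).
have V'0 : 0 <= V' by apply: le_trans (npsiV (nseq_tuple l 0)).
have [mA mB] : measurable A /\ measurable B by split; [case: bA|case: bB].
set Phi := fun w => _; set Psi := fun w => _.
have aPhi : adm Phi by exact: adm_sum_dtup nphiV.
have aPsi : adm Psi by exact: adm_sum_dtup npsiV.
set e := K ^+ _ * _ * _.
have e0 : 0 <= e by rewrite /e; nonneg.
pose u (x : m.-tuple E) := \1_(pw A m) x * phi x.
pose v (y : l.-tuple E) := \1_(pw B l) y * psi y.
have mu : measurable_fun setT u.
  by apply: measurable_funM => //; apply: measurable_indic; exact: measurable_pw.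
have mv : measurable_fun setT v.
  by apply: measurable_funM => //; apply: measurable_indic; exact: measurable_pw.
have u0 x : 0 <= u x by rewrite mulr_ge0.
have v0 x : 0 <= v x by rewrite mulr_ge0.
have r0 p (x : p.-tuple E) : 0 <= corr0 rho x by exact: (corr0_ge0 pcorr).
have mr p := measurable_corr0 pcorr (p := p).
pose f1 (z : m.-tuple E * l.-tuple E) := u z.1 * v z.2 * corr0 rho (cat_tuple z.1 z.2).
pose f2 (z : m.-tuple E * l.-tuple E) := (u z.1 * corr0 rho z.1) * (v z.2 * corr0 rho z.2).
pose f3 (z : m.-tuple E * l.-tuple E) := u z.1 * v z.2.
pose I (f : m.-tuple E * l.-tuple E -> R) := (\int[leb m \x leb l]_z (f z)%:E)%E.
have mf3 : measurable_fun setT f3.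
  by apply: measurable_funM; exact: measurableT_comp.
have mf1 : measurable_fun setT f1.
  apply: measurable_funM => //.
  by apply: (measurableT_comp (mr _)); exact: measurable_cat_tuple.
have mf2 : measurable_fun setT f2.
  apply: measurable_funM; apply: measurable_funM.
  - exact: (measurableT_comp mu).
  - exact: (measurableT_comp (mr m)).
  - exact: (measurableT_comp mv).
  - exact: (measurableT_comp (mr l)).
have f10 z : 0 <= f1 z by rewrite !mulr_ge0.
have f20 z : 0 <= f2 z by rewrite !mulr_ge0.
have f30 z : 0 <= f3 z by rewrite !mulr_ge0.
have f12 z : `|f1 z - f2 z| <= e * f3 z.
  case: z => x y; rewrite /f1 /f2 /f3 /=.
  have -> : u x * v y * corr0 rho (cat_tuple x y) -
      u x * corr0 rho x * (v y * corr0 rho y) =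
    (u x * v y) * (corr0 rho (cat_tuple x y) - corr0 rho x * corr0 rho y) by ring.
  rewrite normrM ger0_norm ?mulr_ge0 // mulrC.
  have [xA|xA] := pselect (pw A m x); last first.
    by rewrite /u indicE memNset // !mul0r !mulr0.
  have [yB|yB] := pselect (pw B l y); last first.
    by rewrite /v indicE memNset // mul0r !mulr0.
  apply: ler_wpM2r; first by rewrite mulr_ge0.
  by apply: hdec => i j; apply: sep; [exact: xA|exact: yB].
(* The comparison is one-sided and made in the extended reals, so that no integrability is required;
   it is used once in each direction. *)
have Ile (f g : m.-tuple E * l.-tuple E -> R) : (forall z, 0 <= f z) -> (forall z, 0 <= g z) ->
    measurable_fun setT f -> measurable_fun setT g ->
    (forall z, `|f z - g z| <= e * f3 z) -> (I f <= I g + e%:E * I f3)%E.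
  move=> f0 g0 mf mg fg.
  have Ef0 z : setT z -> (0 <= (f z)%:E)%E by rewrite lee_fin.
  have Eg0 z : setT z -> (0 <= (g z)%:E)%E by rewrite lee_fin.
  have Ef30 z : setT z -> (0 <= (f3 z)%:E)%E by rewrite lee_fin.
  have Ef3e z : setT z -> (0 <= e%:E * (f3 z)%:E)%E.
    by rewrite -EFinM lee_fin mulr_ge0.
  have mEf3 : measurable_fun setT (fun z => (f3 z)%:E) by exact/measurable_EFinP.
  have mEg : measurable_fun setT (fun z => (g z)%:E) by exact/measurable_EFinP.
  have mEf3e : measurable_fun setT (fun z => (e%:E * (f3 z)%:E)%E).
    exact: measurable_funeM.
  rewrite /I -(ge0_integralZl_EFin _ measurableT Ef30 mEf3 e0).
  rewrite -(ge0_integralD _ measurableT Eg0 mEg Ef3e mEf3e).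
  apply: ge0_le_integral => //.
  - exact/measurable_EFinP.
  - exact: emeasurable_funD.
  - move=> z _; rewrite -EFinM -EFinD lee_fin -lerBlDl.
    by apply: le_trans (fg z); exact: ler_norm.
have uvol : (\int[leb m]_x (u x)%:E <= (V * al ^+ m)%:E)%E.
  apply: (@le_trans _ _ (\int[leb m]_x (V%:E * (\1_(pw A m) x)%:E))%E).
    apply: ge0_le_integral => //.
    - by move=> x _; rewrite lee_fin.
    - exact/measurable_EFinP.
    - apply: measurable_funeM; apply/measurable_EFinP; apply: measurable_indic.
      exact: measurable_pw.
    - move=> x _; rewrite -EFinM lee_fin /u mulrC; apply: ler_wpM2r => //.
      by case/andP: (phiV x).
  rewrite ge0_integralZl_EFin //; last first.
    by apply/measurable_EFinP; apply: measurable_indic; exact: measurable_pw.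
  rewrite integral_indic //; last exact: measurable_pw.
  rewrite setIT EFinM; apply: lee_wpmul2l; first by rewrite lee_fin.
  exact: (@power_measure_box_le _ _ _ _ m (fun=> A)).
have vvol : (\int[leb l]_x (v x)%:E <= (V' * al' ^+ l)%:E)%E.
  apply: (@le_trans _ _ (\int[leb l]_x (V'%:E * (\1_(pw B l) x)%:E))%E).
    apply: ge0_le_integral => //.
    - by move=> x _; rewrite lee_fin.
    - exact/measurable_EFinP.
    - apply: measurable_funeM; apply/measurable_EFinP; apply: measurable_indic.
      exact: measurable_pw.
    - move=> x _; rewrite -EFinM lee_fin /v mulrC; apply: ler_wpM2r => //.
      by case/andP: (psiV x).
  rewrite ge0_integralZl_EFin //; last first.
    by apply/measurable_EFinP; apply: measurable_indic; exact: measurable_pw.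
  rewrite integral_indic //; last exact: measurable_pw.
  rewrite setIT EFinM; apply: lee_wpmul2l; first by rewrite lee_fin.
  exact: (@power_measure_box_le _ _ _ _ l (fun=> B)).
have If3 : (I f3 <= (V * al ^+ m * (V' * al' ^+ l))%:E)%E.
  rewrite /I /f3 (integral_prod_indep (leb m) (leb l) mu mv u0 v0) EFinM.
  by apply: lee_pmul => //; apply: integral_ge0 => x _; rewrite lee_fin.
have fin_adm X : adm X -> (\int[P]_w (X w)%:E)%E = (\int[P]_w X w)%:E.
  by move=> aX; rewrite fineK //; apply: integrable_fin_num => //; exact: (adm_integrable algA).
have If1 : I f1 = (\int[P]_w (Phi w * Psi w))%:E.
  rewrite -fin_adm; last exact: (admM algA).
  rewrite (campbell_dtup2 ppalm pcorr bA bB AB0 mphi phi0 mpsi psi0).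
  by rewrite /I fubini_tonelli1 //; exact/measurable_EFinP.
have If2 : I f2 = (\int[P]_w Phi w * \int[P]_w Psi w)%:E.
  rewrite EFinM -!fin_adm //.
  rewrite (campbell_dtup ppalm pcorr bA mphi phi0) (campbell_dtup ppalm pcorr bB mpsi psi0).
  rewrite /I /f2 (integral_prod_indep (leb m) (leb l) (u := fun x => u x * corr0 rho x)
    (v := fun x => v x * corr0 rho x)) //.
  - exact: (measurable_funM mu (mr m)).
  - exact: (measurable_funM mv (mr l)).
  - by move=> x; rewrite mulr_ge0.
  - by move=> x; rewrite mulr_ge0.
have f3fin : exists2 r, I f3 = r%:E & r <= V * al ^+ m * (V' * al' ^+ l).
  have I30 : (0 <= I f3)%E by apply: integral_ge0 => z _; rewrite lee_fin.
  by case: (I f3) I30 If3 => // r _; rewrite lee_fin; exists r.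
have [r rE rle] := f3fin.
have er : e * r <= V * V' * al ^+ m * al' ^+ l * e.
  by rewrite [leRHS](_ : _ = e * (V * al ^+ m * (V' * al' ^+ l))); [exact: ler_wpM2l|ring].
rewrite /cov2 ler_norml; apply/andP; split.
  have f21 z : `|f2 z - f1 z| <= e * f3 z by rewrite distrC.
  have := Ile f2 f1 f20 f10 mf2 mf1 f21.
  rewrite If1 If2 rE -EFinM -EFinD lee_fin => h.
  lra.
have := Ile f1 f2 f10 f20 mf1 mf2 f12.
rewrite If1 If2 rE -EFinM -EFinD lee_fin => h; lra.
Qed.

(** The factor 4 counts the covariances between the positive and negative parts of [phi] and
    [psi]. *)
Lemma cov2_sum_dtup m l (phi : m.-tuple E -> R) (psi : l.-tuple E -> R) V V' :
  measurable_fun setT phi -> measurable_fun setT psi ->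
  (forall z, `|phi z| <= V) -> (forall z, `|psi z| <= V') ->
  `|cov2 P (fun w => \sum_(z <- dtup (pts (pp w) A) m) phi z)
           (fun w => \sum_(z <- dtup (pts (pp w) B) l) psi z)| <=
  4 * (V * V' * al ^+ m * al' ^+ l * (K ^+ (m + l) * (m + l)`!%:R `^ a * de)).
Proof.
move=> mphi mpsi phiV psiV.
have posV (T : Type) (g : T -> R) v z : (forall z, `|g z| <= v) -> 0 <= g^\+ z <= v.
  move=> gv; rewrite funrpos_ge0 /= /funrpos ge_max.
  by rewrite (le_trans _ (gv z)) ?ler_norm // (le_trans _ (gv z)).
have negV (T : Type) (g : T -> R) v z : (forall z, `|g z| <= v) -> 0 <= g^\- z <= v.
  move=> gv; rewrite funrneg_ge0 /= /funrneg ge_max.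
  apply/andP; split; last exact: le_trans (gv z).
  by rewrite (le_trans (ler_norm _)) // normrN.
have split_sum (D : set E) p (g : p.-tuple E -> R) :
   (fun w => \sum_(z <- dtup (pts (pp w) D) p) g z) =
   (fun w => \sum_(z <- dtup (pts (pp w) D) p) g^\+ z -
             \sum_(z <- dtup (pts (pp w) D) p) g^\- z).
  apply/funext => w; rewrite -sumrB; apply: eq_bigr => z _.
  by rewrite -[in LHS](funrposBneg g).
have npos (T : Type) (g : T -> R) v z : 0 <= g^\+ z <= v -> `|g^\+ z| <= v.
  by move=> /andP[h ?]; rewrite ger0_norm.
have nneg (T : Type) (g : T -> R) v z : 0 <= g^\- z <= v -> `|g^\- z| <= v.
  by move=> /andP[h ?]; rewrite ger0_norm.
have mp p (g : p.-tuple E -> R) : measurable_fun setT g -> measurable_fun setT g^\+.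
  exact: measurable_funrpos.
have mn p (g : p.-tuple E -> R) : measurable_fun setT g -> measurable_fun setT g^\-.
  exact: measurable_funrneg.
have a1 : adm (fun w => \sum_(z <- dtup (pts (pp w) A) m) phi^\+ z).
  by apply: (@adm_sum_dtup _ _ _ V) => // [|z]; [exact: mp|exact/npos/posV].
have a2 : adm (fun w => \sum_(z <- dtup (pts (pp w) A) m) phi^\- z).
  by apply: (@adm_sum_dtup _ _ _ V) => // [|z]; [exact: mn|exact/nneg/negV].
have b1 : adm (fun w => \sum_(z <- dtup (pts (pp w) B) l) psi^\+ z).
  by apply: (@adm_sum_dtup _ _ _ V') => // [|z]; [exact: mp|exact/npos/posV].
have b2 : adm (fun w => \sum_(z <- dtup (pts (pp w) B) l) psi^\- z).
  by apply: (@adm_sum_dtup _ _ _ V') => // [|z]; [exact: mn|exact/nneg/negV].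
rewrite (split_sum A) (split_sum B).
rewrite (cov2Bl algA a1 a2 (admB algA b1 b2)).
rewrite !(cov2C P _ (fun w => _ - _)) (cov2Bl algA b1 b2 a1) (cov2Bl algA b1 b2 a2).
rewrite !(cov2C P (fun w => \sum_(z <- dtup (pts (pp w) B) l) _)).
have h1 := cov2_sum_dtup_ge0 (mp _ _ mphi) (mp _ _ mpsi) (fun z => posV _ _ _ z phiV) (fun z => posV _ _ _ z psiV).
have h2 := cov2_sum_dtup_ge0 (mp _ _ mphi) (mn _ _ mpsi) (fun z => posV _ _ _ z phiV) (fun z => negV _ _ _ z psiV).
have h3 := cov2_sum_dtup_ge0 (mn _ _ mphi) (mp _ _ mpsi) (fun z => negV _ _ _ z phiV) (fun z => posV _ _ _ z psiV).
have h4 := cov2_sum_dtup_ge0 (mn _ _ mphi) (mn _ _ mpsi) (fun z => negV _ _ _ z phiV) (fun z => negV _ _ _ z psiV).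
set b := V * V' * _ * _ * _ in h1 h2 h3 h4 *.
apply: (le_trans (ler_normB _ _)).
apply: (le_trans (lerD (ler_normB _ _) (ler_normB _ _))); lra.
Qed.

(** The factorial moment expansion of F on D stopped at order M, exact as soon as D has fewer than M
    points ([ftruncE]). Unlike the full expansion, it is a finite combination with deterministic
    range, so covariances can be taken termwise. *)
Definition ftrunc (D : set E) (F : N -> R) (M : nat) (w : Omega) : R :=
  \sum_(m < M) (m`!%:R)^-1 *
    \sum_(z <- dtup (pts (pp w) D) m) fexp (fun t => F (conf t)) m z.

Lemma measurable_fexp (F : N -> R) m : measurable_fun setT F ->
  measurable_fun setT (fun z : m.-tuple E => fexp (fun t => F (conf t)) m z).
Proof.
move=> mF; apply: measurable_sum => k.
apply: measurable_funM => //; apply: (measurableT_comp mF).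
exact: measurable_conf_take.
Qed.

Section truncation.
Context (D : set E) (F : N -> R) (V : R) (c : nat).
Hypotheses (bD : bounded_borel D) (DW : D `<=` W) (mF : measurable_fun setT F)
  (V0 : 0 <= V) (FV : forall X, `|F X| <= V * c.+1%:R ^+ npts X D).

Let FVs (t : seq E) : `|F (conf t)| <= V * c.+1%:R ^+ size t.
Proof.
apply: (le_trans (FV _)); apply: ler_wpM2l => //; apply: ler_weXn2l.
  by rewrite ler1n.
by apply: npts_conf_le; case: bD.
Qed.

Lemma norm_fexp_conf_le m (z : m.-tuple E) :
  `|fexp (fun t => F (conf t)) m z| <= V * c.+2%:R ^+ m.
Proof. exact: norm_fexp_le. Qed.

Lemma adm_ftrunc M : adm (ftrunc D F M).
Proof.
rewrite /ftrunc; apply: (adm_sum algA) => m; apply: (admZ algA).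
apply: (@adm_sum_dtup _ _ _ (V * c.+2%:R ^+ m)) => //; first exact: measurable_fexp.
by move=> z; exact: norm_fexp_conf_le.
Qed.

Lemma ftruncE M w : (npts (pp w) D < M)%N ->
  F (config_cap (pp w) D) = ftrunc D F M w.
Proof.
move=> nM; rewrite /ftrunc factorial_expansion //.
- by rewrite conf_pts //; case: bD.
- exact: pts_uniq.
- by move=> s1 s2 /eq_conf ->.
Qed.

(** A distinct-tuple sum of order m divided by m! has C(n, m) terms, so the binomial theorem raises
    the base once more, from c+2 to c+3, uniformly in M. *)
Lemma norm_ftrunc_le M w : `|ftrunc D F M w| <= V * c.+3%:R ^+ npts (pp w) D.
Proof.
rewrite /ftrunc; apply: (le_trans (ler_norm_sum _ _ _)).
apply: (@le_trans _ _ (\sum_(m < M) V * ('C(npts (pp w) D, m)%:R * c.+2%:R ^+ m))).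
  apply: ler_sum => m _; rewrite normrM (@ger0_norm _ (m`!%:R)^-1) ?invr_ge0 //.
  apply: (@le_trans _ _ ((m`!%:R)^-1 * ((npts (pp w) D ^_ m)%:R * (V * c.+2%:R ^+ m)))).
    apply: ler_wpM2l; first by rewrite invr_ge0.
    apply: (le_trans (ler_norm_sum_size (fun z _ => norm_fexp_conf_le z))).
    by rewrite size_dtup //; exact: pts_uniq.
  rewrite -bin_ffact natrM !mulrA.
  rewrite le_eqVlt; apply/orP; left; apply/eqP.
  have : (m`!%:R : R) != 0 by rewrite pnatr_eq0 -lt0n fact_gt0.
  move: (m`!%:R : R) ('C(_, _)%:R : R) (c.+2%:R ^+ m : R) => x y z x0.
  by field.
rewrite -mulr_sumr; apply: ler_wpM2l => //.
by rewrite -[c.+3]add1n natrD; exact: sum_bin_expn_le.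
Qed.

(** An integrable bound for all truncations at once. The spare factor 2 in the base is traded for
    the rate 2^-M in [norm_ftrunc_sub_le]. *)
Definition ftrunc_dom (w : Omega) : R := V * (c.+3 * 2)%:R ^+ npts (pp w) W.

Lemma ftrunc_domE w : ftrunc_dom w =
  V * (c.+3%:R ^+ npts (pp w) W * 2 ^+ npts (pp w) W).
Proof.
by rewrite /ftrunc_dom natrM exprMn.
Qed.

Lemma adm_ftrunc_dom : adm ftrunc_dom.
Proof.
split; last first.
  exists V, (c.+3 * 2).-1 => w; rewrite prednK ?muln_gt0 //.
  by rewrite ger0_norm // mulr_ge0 // exprn_ge0.
apply: measurable_funM => //.
exact: (@measurable_comp_npts _ _ _ _ _ pp W (fun n => (c.+3 * 2)%:R ^+ n)).
Qed.

Let nDW w : (npts (pp w) D <= npts (pp w) W)%N.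
Proof. by apply: leq_npts => //; case: bW. Qed.

Lemma norm_ftrunc_dom M w : `|ftrunc D F M w| <= ftrunc_dom w.
Proof.
apply: (le_trans (norm_ftrunc_le _ _)); rewrite ftrunc_domE; apply: ler_wpM2l => //.
apply: (@le_trans _ _ (c.+3%:R ^+ npts (pp w) W)).
  by apply: ler_weXn2l => //; rewrite ler1n.
by rewrite ler_peMr ?exprn_ge0 // exprn_ege1 // ler1n.
Qed.

Lemma norm_cap_dom w : `|F (config_cap (pp w) D)| <= ftrunc_dom w.
Proof. by rewrite (@ftruncE (npts (pp w) D).+1) //; exact: norm_ftrunc_dom. Qed.

Lemma adm_cap : adm (fun w => F (config_cap (pp w) D)).
Proof.
split; last by exists V, (c.+3 * 2).-1 => w; rewrite prednK ?muln_gt0 //; exact: norm_cap_dom.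
apply: (measurableT_comp mF).
apply: (measurableT_comp (f := fun X : N => config_cap X D)).
  by apply: measurable_config_cap; case: bD.
exact: (measurable_pp pp).
Qed.

(** The difference vanishes when D has fewer than M points. Otherwise W has at least M points and
    2^M <= 2^npts. *)
Lemma norm_ftrunc_sub_le M w :
  `|F (config_cap (pp w) D) - ftrunc D F M w| <= 2 * 2^-1 ^+ M * ftrunc_dom w.
Proof.
have [nM|Mn] := ltnP (npts (pp w) D) M.
  rewrite (ftruncE nM) subrr normr0 !mulr_ge0 ?exprn_ge0 ?invr_ge0 //.
have h c' : `|ftrunc D F c' w| <= V * c.+3%:R ^+ npts (pp w) W.
  apply: (le_trans (norm_ftrunc_le _ _)); apply: ler_wpM2l => //.
  by apply: ler_weXn2l => //; rewrite ler1n.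
apply: (le_trans (ler_normB _ _)).
apply: (@le_trans _ _ (2 * (V * c.+3%:R ^+ npts (pp w) W))).
  rewrite (@ftruncE (npts (pp w) D).+1) //.
  by rewrite mulr_natl mulr2n; exact: lerD.
rewrite ftrunc_domE -!mulrA; apply: ler_wpM2l => //.
rewrite [leRHS]mulrCA; apply: ler_wpM2l => //.
rewrite [leRHS]mulrCA -[leLHS]mulr1; apply: ler_wpM2l; first exact: exprn_ge0.
rewrite exprVn ler_pdivlMl ?exprn_gt0 // mulr1; apply: ler_weXn2l.
  by rewrite ler1n.
exact: leq_trans (nDW w).
Qed.

End truncation.

(* Term by term comparison of the factorial moment expansions of F and H by
   the decay of correlations. *)
Lemma cov2_cap_le (F H : N -> R) (V V' : R) (c c' : nat) :
  measurable_fun setT F -> measurable_fun setT H -> 0 <= V -> 0 <= V' ->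
  (forall X, `|F X| <= V * c.+1%:R ^+ npts X A) ->
  (forall X, `|H X| <= V' * c'.+1%:R ^+ npts X B) ->
  `|cov2 P (fun w => F (config_cap (pp w) A)) (fun w => H (config_cap (pp w) B))| <=
  16 * (V * V') * de * expR ((2 * (2 * K * c.+2%:R * al)) ^+ q) *
  expR ((2 * (2 * K * c'.+2%:R * al')) ^+ q).
Proof.
move=> mF mH V0 V'0 FV HV.
have aF := adm_cap bA AW mF V0 FV.
have aH := adm_cap bB BW mH V'0 HV.
set f := fun w => F _; set h := fun w => H _.
set U := ftrunc_dom V c; set U' := ftrunc_dom V' c'.
have aU : adm U by exact: adm_ftrunc_dom.
have aU' : adm U' by exact: adm_ftrunc_dom.
set bnd := 16 * _ * _ * _ * _.
(* Replacing F and H by their truncations makes two errors, each of 2 * 2^-M times this sum of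
   expectations. *)
pose C := 4 * (\int[P]_w (U w * U' w) + \int[P]_w U w * \int[P]_w U' w).
(* The truncation order is arbitrary: [bnd] does not depend on M, and the error is made to vanish at
   the end. *)
have key M : `|cov2 P f h| <= bnd + C * 2^-1 ^+ M.
  have aFM := adm_ftrunc bA AW mF V0 FV M.
  have aHM := adm_ftrunc bB BW mH V'0 HV M.
  set fM := ftrunc A F M in aFM; set hM := ftrunc B H M in aHM.
  have e0 : 0 <= 2 * 2^-1 ^+ M :> R by rewrite mulr_ge0 // exprn_ge0 // invr_ge0.
  have d1 := cov2_norm_le algA (admB algA aF aFM) aH aU aU' e0
    (norm_ftrunc_sub_le bA AW V0 FV M) (norm_cap_dom bB BW V'0 HV).
  have d2 := cov2_norm_le algA (admB algA aH aHM) aFM aU' aU e0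
    (norm_ftrunc_sub_le bB BW V'0 HV M) (norm_ftrunc_dom bA AW V0 FV M).
  have d3 : `|cov2 P fM hM| <= bnd.
    have aP (m : 'I_M) : adm (fun w => \sum_(z <- dtup (pts (pp w) A) m)
        fexp (fun t => F (conf t)) m z).
      apply: (@adm_sum_dtup _ _ _ (V * c.+2%:R ^+ m)) => //; first exact: measurable_fexp.
      by move=> z; exact: (norm_fexp_conf_le bA V0 FV).
    have aQ (l : 'I_M) : adm (fun w => \sum_(z <- dtup (pts (pp w) B) l)
        fexp (fun t => H (conf t)) l z).
      apply: (@adm_sum_dtup _ _ _ (V' * c'.+2%:R ^+ l)) => //; first exact: measurable_fexp.
      by move=> z; exact: (norm_fexp_conf_le bB V'0 HV).
    rewrite /fM /ftrunc (cov2_suml algA _ aP aHM).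
    apply: (le_trans (ler_norm_sum _ _ _)).
    pose S (y : R) := \sum_(m < M) y ^+ m * m`!%:R `^ a / m`!%:R.
    apply: (@le_trans _ _ (4 * (V * V') * de * (S (2 * K * c.+2%:R * al) * S (2 * K * c'.+2%:R * al')))).
      rewrite /S mulr_suml mulr_sumr; apply: ler_sum => m _.
      rewrite cov2C /hM /ftrunc (cov2_suml algA _ aQ (aP m)).
      rewrite normrM (@ger0_norm _ (m`!%:R)^-1) ?invr_ge0 //.
      rewrite mulr_sumr mulr_sumr.
      have M0 : 0 <= (m`!%:R)^-1 :> R by rewrite invr_ge0.
      apply: (le_trans (ler_wpM2l M0 (ler_norm_sum _ _ _))).
      rewrite mulr_sumr; apply: ler_sum => l _.
      rewrite normrM (@ger0_norm _ (l`!%:R)^-1) ?invr_ge0 // cov2C.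
      apply: le_trans (factorial_series_term_le m l V0 V'0 (ler0n _ c.+2) (ler0n _ c'.+2) al0 al'0 K0 a01 de0).
      apply: ler_wpM2l => //; apply: ler_wpM2l; first by rewrite invr_ge0.
      apply: cov2_sum_dtup => [||z|z]; [exact: measurable_fexp|exact: measurable_fexp| |].
        exact: (norm_fexp_conf_le bA V0 FV).
      exact: (norm_fexp_conf_le bB V'0 HV).
    have S0 y : 0 <= y -> 0 <= S y.
      by move=> y0; apply: sumr_ge0 => m _; nonneg.
    have t0 : 0 <= 2 * K * c.+2%:R * al by nonneg.
    have t'0 : 0 <= 2 * K * c'.+2%:R * al' by nonneg.
    have h1 := powR_fact_series_le M a0 qa t0.
    have h2 := powR_fact_series_le M a0 qa t'0.
    apply: (@le_trans _ _ (4 * (V * V') * de * (2 * expR ((2 * (2 * K * c.+2%:R * al)) ^+ q) *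
       (2 * expR ((2 * (2 * K * c'.+2%:R * al')) ^+ q))))).
      apply: ler_wpM2l; first by nonneg.
      by apply: ler_pM => //; exact: S0.
    rewrite /bnd le_eqVlt; apply/orP; left; apply/eqP.
    by move: (expR _) (expR _) => y y'; ring.
  have -> : cov2 P f h = cov2 P (fun w => f w - fM w) h +
      cov2 P (fun w => h w - hM w) fM + cov2 P fM hM.
    rewrite (cov2Bl algA aF aFM aH) (cov2Bl algA aH aHM aFM).
    by rewrite (cov2C P h fM) (cov2C P hM fM); ring.
  have eU : \int[P]_w (U' w * U w) = \int[P]_w (U w * U' w).
    by apply: eq_Rintegral => w _; rewrite mulrC.
  rewrite eU [X in _ * (_ + X)]mulrC in d2.
  apply: (le_trans (ler_normD _ _)).
  apply: (le_trans (lerD (ler_normD _ _) (lexx _))).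
  rewrite /C; move: d1 d2 d3; rewrite -/f -/h.
  move: (2^-1 ^+ M : R) (\int[P]_w (U w * U' w) + _) (cov2 P (fun w => f w - fM w) h)
    (cov2 P (fun w => h w - hM w) fM) (cov2 P fM hM) => y1 y2 y3 y4 y5 d1 d2 d3.
  have -> : bnd + 4 * y2 * y1 = 2 * y1 * y2 + 2 * y1 * y2 + bnd by ring.
  exact: lerD (lerD d1 d2) d3.
have C0 : 0 <= C.
  have [] := boolP (0 <= C) => // /negbTE C0.
  have := key 0%N; rewrite expr0 mulr1.
  have U0 w : 0 <= U w by rewrite mulr_ge0 // exprn_ge0.
  have U'0 w : 0 <= U' w by rewrite mulr_ge0 // exprn_ge0.
  rewrite /C mulr_ge0 // in C0.
  rewrite addr_ge0 // ?mulr_ge0 //; apply: Rintegral_ge0 => w _ //.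
  by rewrite mulr_ge0.
apply/ler_addgt0Pr => e e0.
have [M hM] : exists M : nat, C * 2^-1 ^+ M <= e.
  exists (Num.truncn (C / e)).+1.
  rewrite exprVn ler_pdivrMr ?exprn_gt0 // -ler_pdivrMl // mulrC.
  apply: (@le_trans _ _ (Num.truncn (C / e)).+1%:R); first exact/ltW/truncnS_gt.
  by rewrite -natrX ler_nat ltnW // ltn_expl.
by apply: (le_trans (key M)); rewrite lerD2l.
Qed.

End decoupling.

(** * Division into cubes *)

Section boxes.
Context (R : realType) (d : nat).
Local Notation E := 'rV[R]_d.

Definition box (lo : 'I_d -> R) (a : R) : set E :=
  [set x | forall j, lo j <= x ord0 j <= lo j + a].

Lemma measurable_box lo a : measurable (box lo a).
Proof.
rewrite (_ : box lo a = \bigcap_(j in [set: 'I_d])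
    ((fun x : E => x ord0 j) @^-1` `[lo j, lo j + a])); last first.
  by apply/seteqP; split => [x h j _|x h j] /=; [rewrite in_itv /=; exact: h|have := h j I; rewrite /= in_itv].
apply: fin_bigcap_measurable; first exact: finite_finset.
by move=> j _; rewrite -[X in measurable X]setTI; exact: measurable_coord.
Qed.

Lemma lebesgue_box_le lo a : 0 <= a -> (lebesgue_vec R d (box lo a) <= (a ^+ d)%:E)%E.
Proof.
move=> a0; rewrite /lebesgue_vec /= /iso_measure /pushforward.
apply: le_trans (@power_measure_box_le _ (measurableTypeR R) R (@lebesgue_measure R) d
  (fun j => `[lo j, lo j + a]%classic) a _ _); last 2 first.
- by move=> j; exact: measurable_itv.
- move=> j; rewrite [leLHS](_ : _ = lebesgue_measure `[lo j, lo j + a]) //.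
  rewrite lebesgue_measure_itv /= lte_fin; case: ifP => _; last by rewrite lee_fin.
  by rewrite -EFinD lee_fin; lra.
rewrite le_eqVlt; apply/orP; left; apply/eqP; congr (_ _).
by apply/seteqP; split => t h j; have := h j; rewrite /= in_itv /= mxE.
Qed.

Lemma bounded_box lo a : bounded_set (box lo a).
Proof.
exists (\sum_j (`|lo j| + `|a|)); split; first exact: num_real.
move=> M hM x hx; apply: (le_trans _ (ltW hM)).
suff : mx_norm x <= \sum_j (`|lo j| + `|a|) by [].
rewrite mx_normrE; apply: bigmax_le.
  by apply: sumr_ge0 => j _; rewrite addr_ge0.
move=> -[i j] _ /=; have -> : i = ord0 by apply: val_inj; case: i => -[].
rewrite (bigD1 j) //=.
apply: ler_wpDr; first by apply: sumr_ge0 => k _; rewrite addr_ge0.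
have /andP[h1 h2] := hx j.
rewrite ler_norml; apply/andP; split.
  have := ler_norm (- lo j); rewrite normrN; have := normr_ge0 a; lra.
have := ler_norm (lo j); have := ler_norm a; lra.
Qed.

Lemma coord_le_enorm (x : E) j : `|x ord0 j| <= enorm x.
Proof.
rewrite /enorm -sqrtr_sqr; apply: ler_wsqrtr.
by rewrite (bigD1 j) //= lerDl; apply: sumr_ge0 => i _; exact: sqr_ge0.
Qed.

End boxes.

Section cells.
Context (R : realType) (d n h u : nat).
Local Notation E := 'rV[R]_d.
Local Notation N := (config R d).
Local Notation W := (@window R d (Some n)).
Local Notation idx := {ffun 'I_d -> 'I_h.*2}.

Let r : R := 2^-1 * (n%:R `^ d%:R^-1).

Let r0 : 0 <= r. Proof. by rewrite /r; nonneg. Qed.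

Lemma window_box : W = box (fun=> - r) (2 * r).
Proof.
apply/seteqP; split => x /= hx j; have := hx j; rewrite ler_norml => /andP[h1 h2].
  by rewrite h1 /=; move: h2; rewrite -/r => h2; lra.
by apply/andP; split => //; rewrite -/r; lra.
Qed.

Lemma bounded_borel_window : bounded_borel W.
Proof. by rewrite window_box; split; [exact: measurable_box|exact: bounded_box]. Qed.

Lemma bounded_borel_setS (A : set E) : measurable A -> A `<=` W -> bounded_borel A.
Proof. by move=> mA AW; split => //; apply: (bounded_setS AW); case: bounded_borel_window. Qed.

Definition corner (i : idx) (j : 'I_d) : R := (i j)%:R - h%:R.

Definition cell (i : idx) : set E :=
  W `&` [set x | forall j, corner i j <= x ord0 j < corner i j + 1].

(** The box centred at the corner of the unit cube with half-side u+1. It contains all points of W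
    within distance u of the cube; the 1 pays for the cube lying on one side of its corner. *)
Definition cell_nbhd (i : idx) : set E :=
  W `&` box (fun j => corner i j - u.+1%:R) (2 * u.+1%:R).

Lemma measurable_cell i : measurable (cell i).
Proof.
apply: measurableI; first by case: bounded_borel_window.
rewrite [X in measurable X](_ : _ = \bigcap_(j in [set: 'I_d])
    ((fun x : E => x ord0 j) @^-1` `[corner i j, corner i j + 1[)); last first.
  by apply/seteqP; split => [x hx j _|x hx j] /=; [rewrite in_itv /=; exact: hx|have := hx j I; rewrite /= in_itv].
apply: fin_bigcap_measurable; first exact: finite_finset.
by move=> j _; rewrite -[X in measurable X]setTI; exact: measurable_coord.
Qed.

Lemma measurable_cell_nbhd i : measurable (cell_nbhd i).
Proof.
by apply: measurableI; [case: bounded_borel_window|exact: measurable_box].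
Qed.

Lemma bounded_borel_cell i : bounded_borel (cell i).
Proof. by apply: bounded_borel_setS; [exact: measurable_cell|move=> x []]. Qed.

Lemma bounded_borel_cell_nbhd i : bounded_borel (cell_nbhd i).
Proof. by apply: bounded_borel_setS; [exact: measurable_cell_nbhd|move=> x []]. Qed.

Lemma cell_nbhdW i : cell_nbhd i `<=` W. Proof. by move=> x []. Qed.

Lemma cellW i : cell i `<=` W. Proof. by move=> x []. Qed.

Lemma cell_subset_nbhd i : cell i `<=` cell_nbhd i.
Proof.
move=> x [Wx hx]; split => // j; have /andP[h1 h2] := hx j.
have u1 : (1 : R) <= u.+1%:R by rewrite ler1n.
by apply/andP; split; lra.
Qed.

Lemma cball_cell_subset i x : cell i x -> W `&` cball x u%:R `<=` cell_nbhd i.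
Proof.
move=> [_ hx] y [Wy xy]; split => // j; have /andP[h1 h2] := hx j.
have := le_trans (coord_le_enorm (x - y) j) xy; rewrite !mxE ler_norml => /andP[h3 h4].
rewrite -natr1.
by apply/andP; split; lra.
Qed.

Lemma lebesgue_cell_le i : (lebesgue_vec R d (cell i) <= 1%:E)%E.
Proof.
apply: le_trans (_ : lebesgue_vec R d (box (corner i) 1) <= _)%E.
  apply: le_measure; rewrite ?inE; [exact: measurable_cell|exact: measurable_box|].
  by move=> x [_ hx] j; have /andP[-> /ltW ->] := hx j.
by apply: le_trans (lebesgue_box_le _ _) _ => //; rewrite expr1n.
Qed.

Lemma lebesgue_cell_nbhd_le i :
  (lebesgue_vec R d (cell_nbhd i) <= ((2 * u.+1%:R) ^+ d)%:E)%E.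
Proof.
apply: le_trans (lebesgue_box_le (fun j => corner i j - u.+1%:R) (mulr_ge0 _ _)) => //.
apply: le_measure; rewrite ?inE; [exact: measurable_cell_nbhd|exact: measurable_box|].
by move=> x [].
Qed.

Hypotheses (h0 : (0 < h)%N) (rh : n%:R `^ d%:R^-1 <= h%:R :> R).

(** The half-open unit cubes tile [-h, h)^d. The window has half-side at most h/2 < h, so its closed
    faces are covered as well. *)
Lemma cellP x : W x -> exists i0, forall i, cell i x <-> i = i0.
Proof.
move=> Wx.
have hk j : exists k : 'I_h.*2, k%:R - h%:R <= x ord0 j < k%:R - h%:R + 1.
  have := Wx j; rewrite ler_norml => /andP[h1 h2].
  have hR : (0 : R) < h%:R by rewrite ltr0n.
  have x0 : 0 <= x ord0 j + h%:R by move: h1 rh; lra.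
  have := truncn_itv x0 => /andP[h3 h4].
  have kh : (Num.truncn (x ord0 j + h%:R) < h.*2)%N.
    rewrite -(ltr_nat R); apply: (le_lt_trans h3).
    rewrite -addnn natrD; move: h2 rh hR; lra.
  exists (Ordinal kh) => /=; rewrite lerBlDr h3 /=.
  by move: h4; rewrite -natr1; lra.
have [f hf] := fin_all_exists hk.
exists [ffun j => f j] => i; split => [[_ hi]|->]; last first.
  by split => // j; rewrite /corner ffunE; exact: hf.
apply/ffunP => j; rewrite ffunE; apply: val_inj => /=.
have /andP[h1 h2] := hi j; have /andP[h3 h4] := hf j.
move: h1 h2; rewrite /corner => h1 h2; apply/eqP; rewrite eqn_leq.
by apply/andP; split; rewrite -ltnS -(ltr_nat R) -natr1; lra.
Qed.

Lemma sum_cells (X : N) (V : nmodType) (g : E -> V) :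
  \sum_(x <- pts X W) g x = \sum_i \sum_(x <- pts X (cell i)) g x.
Proof.
have perm_cell i : perm_eq (pts X (cell i)) [seq x <- pts X W | `[< cell i x >]].
  apply: uniq_perm; [exact: pts_uniq|exact/filter_uniq/pts_uniq|move=> x].
  rewrite mem_filter !mem_pts; [|by case: bounded_borel_window|by case: (bounded_borel_cell i)].
  apply/idP/idP => [/set_mem[Xx Cx]|/andP[/asboolP Cx /set_mem[Xx Wx]]].
    by rewrite asboolT //=; apply/mem_set; split => //; case: Cx.
  by apply/mem_set.
under [RHS]eq_bigr => i _ do rewrite (perm_big _ (perm_cell i)) big_filter.
rewrite (exchange_big_dep xpredT) //=.
rewrite big_seq [RHS]big_seq; apply: eq_bigr => x.
rewrite mem_pts; last by case: bounded_borel_window.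
move=> /set_mem[_ /cellP[i0 hi0]]; rewrite (big_pred1 i0) // => i.
by apply/asboolP/eqP => /hi0.
Qed.

(** Distinct indices congruent modulo L differ by at least L in some coordinate, and each
    neighbourhood reaches at most u+1 from its corner. *)
Lemma cell_nbhd_separated (L : nat) (i i' : idx) (x y : E) :
  i != i' -> (forall j, i j = i' j %[mod L]) -> cell_nbhd i x -> cell_nbhd i' y ->
  L%:R - 2 * u.+1%:R <= enorm (x - y).
Proof.
move=> ii' hL [_ hx] [_ hy].
have [j ij] : exists j, i j != i' j.
  apply/existsP; rewrite -negb_forall; apply: contra ii' => /forallP hh.
  by apply/eqP/ffunP => j; apply/eqP; exact: hh.
apply: (le_trans _ (coord_le_enorm _ j)); rewrite !mxE.
have /andP[h1 h2] := hx j; have /andP[h3 h4] := hy j.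
move: h1 h2 h3 h4; rewrite /corner => h1 h2 h3 h4.
have [ltij|ltij|eqij] := ltngtP (i j) (i' j); last by rewrite (val_inj eqij) eqxx in ij.
  have := dvdn_leq _ (_ : L %| i' j - i j)%N.
  rewrite -eqn_mod_dvd ?(ltnW ltij) // subn_gt0 => /(_ ltij).
  rewrite eq_sym hL eqxx => /(_ isT); rewrite -(ler_nat R) natrB ?(ltnW ltij) // => hh.
  by rewrite distrC; apply: (le_trans _ (ler_norm _)); lra.
have := dvdn_leq _ (_ : L %| i j - i' j)%N.
rewrite -eqn_mod_dvd ?(ltnW ltij) // subn_gt0 => /(_ ltij).
rewrite hL eqxx => /(_ isT); rewrite -(ler_nat R) natrB ?(ltnW ltij) // => hh.
by apply: (le_trans _ (ler_norm _)); lra.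
Qed.

End cells.

(** * The truncated statistic *)

(** The sum is at most its number of terms times the largest |T c|, the m of the proof, and the even
    power of that maximum is one of the summands on the right. *)
Lemma exprn_sum_le (R : realDomainType) (I : Type) (s : seq I) (T : I -> R) k :
  (\sum_(c <- s) T c) ^+ k.*2.+2 <=
  (size s)%:R ^+ k.*2.+2 * \sum_(c <- s) T c ^+ k.*2.+2.
Proof.
have [m [m0 hm hs]] : exists m, [/\ 0 <= m, `|\sum_(c <- s) T c| <= (size s)%:R * m &
    m ^+ k.*2.+2 <= \sum_(c <- s) T c ^+ k.*2.+2].
  elim: s => [|x s [m [m0 hm hs]]].
    by exists 0; split; rewrite ?big_nil ?normr0 ?mul0r // expr0n.
  have s0 : 0 <= \sum_(c <- s) T c ^+ k.*2.+2.
    by apply: sumr_ge0 => c _; exact: exprn_doubleS_ge0.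
  have e : `|T x| ^+ k.*2.+2 = T x ^+ k.*2.+2.
    by rewrite -normrX ger0_norm // exprn_doubleS_ge0.
  have mx : 0 <= Num.max m `|T x| by rewrite le_max m0.
  exists (Num.max m `|T x|); split => //.
    rewrite big_cons /= -natr1 mulrDl mul1r addrC.
    apply: (le_trans (ler_normD _ _)); apply: lerD; last by rewrite le_max lexx orbT.
    by apply: (le_trans hm); apply: ler_wpM2l => //; rewrite le_max lexx.
  rewrite big_cons; case: (leP m `|T x|) => h; first by rewrite e lerDl.
  by apply: (le_trans hs); rewrite lerDr exprn_doubleS_ge0.
apply: (@le_trans _ _ (((size s)%:R * m) ^+ k.*2.+2)).
  rewrite -[leLHS]ger0_norm ?exprn_doubleS_ge0 // normrX.
  by apply: lerXn2r; rewrite ?nnegrE // mulr_ge0.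
by rewrite exprMn; apply: ler_wpM2l => //; exact: exprn_ge0.
Qed.

Lemma size_index_enum (T : finType) : size (index_enum T) = #|T|.
Proof. by rewrite -sum1_size -sum1_card; exact: eq_bigl. Qed.

Lemma measurable_to_vec (R : realType) (d : nat) dT (T : measurableType dT)
    (g : T -> 'rV[R]_d) :
  (forall j, measurable_fun setT (fun t => g t ord0 j)) -> measurable_fun setT g.
Proof.
move=> mg.
have mt : measurable_fun setT (fun t => [tuple g t ord0 j | j < d] : d.-tuple (measurableTypeR R)).
  apply/measurable_fun_tnthP => j.
  rewrite (_ : _ \o _ = (fun t => g t ord0 j)); first exact: mg.
  by apply/funext => t /=; rewrite tnth_mktuple.
have mv : measurable_fun setT (@vec_of_tuple R d) by exact: measurable_funPT.
rewrite (_ : g = @vec_of_tuple R d \o (fun t => [tuple g t ord0 j | j < d])).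
  exact: (measurableT_comp mv mt).
by apply/funext => t; apply/rowP => j; rewrite /= mxE tnth_mktuple.
Qed.

Section truncated_statistic.
Context (R : realType) (d : nat).
Local Notation E := 'rV[R]_d.
Local Notation N := (config R d).
Context (disp : measure_display) (Omega : measurableType disp)
  (P : probability Omega R) (pp : {RV P >-> N})
  (rho : forall p, p.-tuple E -> R) (palm : forall p, R.-pker p.-tuple E ~> N).
Hypotheses (ppalm : is_palm pp rho palm) (pcorr : is_correlation pp rho).
Context (K a ahat c : R) (q : nat).
Hypotheses (K1 : 1 <= K)
  (hrho : forall p (x : p.-tuple E), corr0 rho x <= K ^+ p * p`!%:R `^ a)
  (hdec : forall m l (x : m.-tuple E) (y : l.-tuple E) s, 0 <= s ->
    (forall i j, s <= enorm (tnth x i - tnth y j)) ->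
    `|corr0 rho (cat_tuple x y) - corr0 rho x * corr0 rho y| <=
    K ^+ (m + l) * (m + l)`!%:R `^ a * expR (- c * s `^ ahat))
  (a0 : 0 <= a) (qa : 1 <= q%:R * (1 - a)).
Context (xi : E -> N -> R) (f : E -> R) (Mf : R).
Hypotheses (mxi : measurable_fun setT (fun v : E * N => xi v.1 v.2))
  (mf : measurable_fun setT f) (Mf1 : 1 <= Mf) (fM : forall x, `|f x| <= Mf).
Context (n h u : nat).
Local Notation W := (@window R d (Some n)).
Local Notation idx := {ffun 'I_d -> 'I_h.*2}.
Local Notation cell := (@cell R d n h).
Local Notation cell_nbhd := (@cell_nbhd R d n h u).

Definition rescaled (x : E) : R := f (n%:R `^ (- d%:R^-1) *: x).

Lemma measurable_rescaled : measurable_fun setT rescaled.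
Proof.
apply: (measurableT_comp mf); apply: measurable_to_vec => j.
under eq_fun do rewrite mxE.
by apply: measurable_funM => //; exact: measurable_coord.
Qed.

Definition clip (y : R) : R := if `|y| <= u%:R then y else 0.

Lemma measurable_clip : measurable_fun setT clip.
Proof.
rewrite (_ : clip = fun y => y * \1_(`[- u%:R, u%:R]%classic) y).
  by apply: measurable_funM => //; exact: measurable_indic.
apply/funext => y; rewrite /clip indicE; case: ifPn => yu.
  by rewrite mem_set ?mulr1 //= in_itv /= -ler_norml.
by rewrite memNset ?mulr0 //= in_itv /= -ler_norml; apply/negP.
Qed.

Lemma norm_clip_le y : `|clip y| <= u%:R.
Proof. by rewrite /clip; case: ifP => //; rewrite normr0. Qed.

Definition cell_stat (i : idx) (X : N) : R :=
  \sum_(x <- pts X (cell i)) clip (xi x X) * rescaled x.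

Lemma measurable_cell_stat i : measurable_fun setT (cell_stat i).
Proof.
have mg : measurable_fun setT (fun v : E * N => clip (xi v.1 v.2) * rescaled v.1).
  apply: measurable_funM; first exact: (measurableT_comp measurable_clip).
  exact: (measurableT_comp measurable_rescaled).
have mid : measurable_fun setT (fun X : N => X) by exact: measurable_id.
have hh := measurable_sum_pts mid (bounded_borel_cell R n i) mg.
exact hh.
Qed.

Let Mf0 : 0 <= Mf. Proof. exact: le_trans Mf1. Qed.
Let K0 : 0 <= K. Proof. exact: le_trans K1. Qed.

Lemma norm_cell_stat_le i X : `|cell_stat i X| <= u%:R * Mf * (npts X (cell i))%:R.
Proof.
rewrite mulrC; apply: (ler_norm_sum_size (c := u%:R * Mf)) => x _.
by rewrite normrM; apply: ler_pM => //; [exact: norm_clip_le|exact: fM].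
Qed.

Lemma npts_cap_nbhd_cell i X : npts (config_cap X (cell_nbhd i)) (cell i) = npts X (cell i).
Proof.
rewrite npts_cap; congr npts; apply/seteqP; split => x; first by case.
by move=> Cx; split => //; exact: cell_subset_nbhd.
Qed.

Definition trunc_stat i (w : Omega) : R := cell_stat i (config_cap (pp w) (cell_nbhd i)).

Definition trunc_dev i (w : Omega) : R := trunc_stat i w - \int[P]_v trunc_stat i v.

Let om : R := (2 * (2^-1 * (n%:R `^ d%:R^-1))) ^+ d.

Let om0 : 0 <= om. Proof. by rewrite /om; nonneg. Qed.

Let Wom : (lebesgue_vec R d W <= om%:E)%E.
Proof. by rewrite window_box; apply: lebesgue_box_le; nonneg. Qed.

Let bW : bounded_borel W. Proof. exact: bounded_borel_window. Qed.

Local Notation adm := (exp_npts_bounded pp W).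

Lemma window_algebra : moment_algebra P adm.
Proof. exact: (exp_npts_bounded_algebra ppalm pcorr K1 hrho a0 qa bW om0 Wom). Qed.

Let algA := window_algebra.

Lemma natr_le_expn2 (m : nat) : m%:R <= 2 ^+ m :> R.
Proof. by rewrite -natrX ler_nat ltnW // ltn_expl. Qed.

Lemma norm_cell_stat_exp_le i X :
  `|cell_stat i X| <= u%:R * Mf * 2 ^+ npts X (cell_nbhd i).
Proof.
apply: (le_trans (norm_cell_stat_le i X)); apply: ler_wpM2l; first by nonneg.
apply: (le_trans (natr_le_expn2 _)); apply: ler_weXn2l; first by rewrite ler1n.
apply: leq_npts; [exact: cell_subset_nbhd|by case: (@bounded_borel_cell_nbhd R d n h u i)].
Qed.

Lemma adm_trunc_stat i : adm (trunc_stat i).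
Proof.
have V0 : 0 <= u%:R * Mf by nonneg.
exact: (adm_cap pp bW (bounded_borel_cell_nbhd R n u i) (@cell_nbhdW R d n h u i)
  (measurable_cell_stat i) V0 (norm_cell_stat_exp_le i)).
Qed.

Lemma adm_trunc_dev i : adm (trunc_dev i).
Proof. by apply: (admB algA); [exact: adm_trunc_stat|exact: (adm_cst algA)]. Qed.

Lemma exp_npts_cell_le i : \int[P]_w (npts (pp w) (cell i))%:R <= K.
Proof.
have := integral_ffact_npts_le ppalm pcorr K1 hrho 1 (bounded_borel_cell R n i) (lebesgue_cell_le R n i).
rewrite expr1n mul1r expr1 (_ : 1`! = 1%N) // powR1 mulr1 => hK.
under eq_Rintegral do rewrite -{1}[npts _ _]ffactn1.
rewrite /Rintegral -lee_fin fineK //.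
apply/fin_numPlt; rewrite (lt_le_trans (ltNyr 0)) ?integral_ge0 //=.
by apply: le_lt_trans hK _; rewrite ltry.
Qed.

Lemma adm_npts_cell i : adm (fun w => (npts (pp w) (cell i))%:R).
Proof.
split; first exact: (@measurable_comp_npts _ _ _ _ _ pp _ (fun m => m%:R) (bounded_borel_cell R n i)).
exists 1, 1%N => w; rewrite mul1r ger0_norm //; apply: (le_trans (natr_le_expn2 _)).
apply: ler_weXn2l; first by rewrite ler1n.
by apply: leq_npts; [exact: cellW|case: bW].
Qed.

Lemma norm_exp_trunc_stat_le i : `|\int[P]_w trunc_stat i w| <= u%:R * Mf * K.
Proof.
apply: (@le_trans _ _ (\int[P]_w (u%:R * Mf * (npts (pp w) (cell i))%:R))).
  apply: (exp_norm_le algA); first exact: adm_trunc_stat.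
    by apply: (admZ algA); exact: adm_npts_cell.
  by move=> w; rewrite -(npts_cap_nbhd_cell i); exact: norm_cell_stat_le.
rewrite (expZ algA); last exact: adm_npts_cell.
by apply: ler_wpM2l; [nonneg|exact: exp_npts_cell_le].
Qed.

(** K bounds the mean number of points of a unit cell, and the 1 accounts for [npts] itself, which
    is at most 2^npts. *)
Let V1 : R := u%:R * Mf * (K + 1).
Let V10 : 0 <= V1. Proof. by rewrite /V1; nonneg. Qed.

(** The exponent counts the points of the cell and not those of its neighbourhood; this keeps the
    moments of [trunc_dev] polynomial in u. *)
Lemma norm_cell_stat_dev_le i X :
  `|cell_stat i (config_cap X (cell_nbhd i)) - \int[P]_v trunc_stat i v| <=
  V1 * 2 ^+ npts X (cell i).
Proof.
apply: (le_trans (ler_normB _ _)).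
have h1 := norm_cell_stat_le i (config_cap X (cell_nbhd i)).
rewrite npts_cap_nbhd_cell in h1.
apply: (le_trans (lerD h1 (norm_exp_trunc_stat_le i))).
rewrite /V1 -mulrDr -mulrA; apply: ler_wpM2l; first by nonneg.
rewrite mulrDl mul1r addrC; apply: lerD; last exact: natr_le_expn2.
by rewrite ler_peMr // exprn_ege1 // ler1n.
Qed.

Definition dev_moment_bound k : R :=
  V1 ^+ k.*2.+2 * (2 * expR ((2 * ((2 ^ k.*2.+2).-1%:R * 1 * K)) ^+ q)).

Lemma exp_trunc_dev_moment_le i k :
  \int[P]_w trunc_dev i w ^+ k.*2.+2 <= dev_moment_bound k.
Proof.
pose g w : R := (2 ^ k.*2.+2).-1.+1%:R ^+ npts (pp w) (cell i).
have gE w : g w = (2 ^+ npts (pp w) (cell i)) ^+ k.*2.+2.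
  by rewrite /g prednK ?expn_gt0 // natrX -!exprM mulnC.
have ag : adm g.
  split; first exact: (@measurable_comp_npts _ _ _ _ _ pp _ (fun m => _ ^+ m) (bounded_borel_cell R n i)).
  exists 1, (2 ^ k.*2.+2).-1 => w; rewrite mul1r ger0_norm ?exprn_ge0 //.
  apply: ler_weXn2l; first by rewrite ler1n.
  by apply: leq_npts; [exact: cellW|case: bW].
apply: (@le_trans _ _ (\int[P]_w (V1 ^+ k.*2.+2 * g w))).
  apply: (exp_le algA).
  - by apply: (admX algA); exact: adm_trunc_dev.
  - exact: (admZ algA).
  - move=> w; rewrite gE -exprMn -[leLHS]ger0_norm ?exprn_doubleS_ge0 // normrX.
    apply: lerXn2r; rewrite ?nnegrE //; first by rewrite mulr_ge0 // exprn_ge0.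
    exact: norm_cell_stat_dev_le.
rewrite (expZ algA) //; apply: ler_wpM2l; first exact: exprn_ge0.
rewrite -lee_fin /Rintegral fineK.
  exact: (integral_expn_npts_le ppalm pcorr K1 hrho a0 qa _ (bounded_borel_cell R n i) (lebesgue_cell_le R n i) ler01).
by apply: integrable_fin_num => //; exact: (adm_integrable algA).
Qed.

Definition nbhd_union (js : seq idx) : set E := \big[setU/set0]_(j <- js) cell_nbhd j.

Lemma nbhd_unionP js x : nbhd_union js x <-> exists2 j, j \in js & cell_nbhd j x.
Proof.
rewrite /nbhd_union -bigcup_seq; split => [[j /= jjs h']|[j jjs h']].
  by exists j.
by exists j.
Qed.

Lemma measurable_nbhd_union js : measurable (nbhd_union js).
Proof. by apply: bigsetU_measurable => j _; exact: measurable_cell_nbhd. Qed.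

Let al : R := (2 * u.+1%:R) ^+ d.

Lemma lebesgue_nbhd_union_le js :
  (lebesgue_vec R d (nbhd_union js) <= ((size js)%:R * al)%:E)%E.
Proof.
elim: js => [|j js IH]; first by rewrite /nbhd_union big_nil measure0 mul0r.
rewrite /nbhd_union big_cons; apply: le_trans (measureU2 _ _ _) _.
- exact: measurable_cell_nbhd.
- exact: measurable_nbhd_union.
rewrite [X in (_ <= X%:E)%E](_ : _ = al + (size js)%:R * al).
  by rewrite EFinD; apply: leeD; [exact: lebesgue_cell_nbhd_le|exact: IH].
by rewrite /= -natr1 mulrDl mul1r addrC.
Qed.

(** The product of the deviations as one functional of the configuration on the union of the
    neighbourhoods, so that [cov2_cap_le] applies to one cell against all the others together. *)
Definition dev_prod (js : seq idx) (X : N) : R :=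
  \prod_(j <- js) (cell_stat j (config_cap X (cell_nbhd j)) - \int[P]_v trunc_stat j v).

Lemma measurable_dev_prod js : measurable_fun setT (dev_prod js).
Proof.
rewrite /dev_prod; apply: measurable_prod => j _.
apply: measurable_funB => //; apply: (measurableT_comp (measurable_cell_stat j)).
by apply: measurable_config_cap; exact: measurable_cell_nbhd.
Qed.

Lemma norm_dev_prod_le js X : `|dev_prod js X| <=
  V1 ^+ size js * (2 ^ size js).-1.+1%:R ^+ npts X (nbhd_union js).
Proof.
rewrite prednK ?expn_gt0 // natrX -exprM mulnC exprM -exprMn.
have BB : bounded_set (nbhd_union js).
  apply: (bounded_setS (B := W)); last by case: bW.
  by move=> x /nbhd_unionP[j _ []].
set m := npts X _.
suff : forall l, {subset l <= js} -> `|dev_prod l X| <= (V1 * 2 ^+ m) ^+ size l.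
  exact.
elim => [|j l IH] sub; first by rewrite /dev_prod big_nil normr1 expr0.
rewrite /dev_prod big_cons normrM exprS; apply: ler_pM => //.
  apply: (le_trans (norm_cell_stat_dev_le j X)); apply: ler_wpM2l => //.
  apply: ler_weXn2l; first by rewrite ler1n.
  apply: leq_npts => // x Cx; apply/nbhd_unionP; exists j; first by apply: sub; rewrite mem_head.
  exact: cell_subset_nbhd.
by apply: IH => j' j'l; apply: sub; rewrite inE j'l orbT.
Qed.

Lemma dev_prod_cap js w :
  dev_prod js (config_cap (pp w) (nbhd_union js)) = \prod_(j <- js) trunc_dev j w.
Proof.
rewrite /dev_prod big_seq [RHS]big_seq; apply: eq_bigr => j jjs.
rewrite /trunc_dev /trunc_stat; congr (cell_stat j _ - _).
apply: config_inj => /=; apply/seteqP; split => x [] => [[Xx _] jx //|Xx jx].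
by split => //; split => //; apply/nbhd_unionP; exists j.
Qed.

(** The bound of [cov2_cap_le] for one cell against p others. The cell statistic grows with base 2,
    whence the 3, and the product with base 2^p on a region of volume at most p times that of a
    neighbourhood. *)
Definition dev_cov_bound (p : nat) (s : R) : R :=
  16 * (u%:R * Mf * V1 ^+ p) * expR (- c * s `^ ahat) *
  expR ((2 * (2 * K * 3%:R * al)) ^+ q) *
  expR ((2 * (2 * K * (2 ^ p).-1.+2%:R * (p%:R * al))) ^+ q).

(** As [trunc_dev i] is [trunc_stat i] centered, this expectation is the covariance of
    [trunc_stat i] with the product. *)
Lemma norm_exp_trunc_dev_prod_le (i : idx) (js : seq idx) (s : R) : 0 < s ->
  (forall j, j \in js -> forall x y, cell_nbhd i x -> cell_nbhd j y -> s <= enorm (x - y)) ->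
  `|\int[P]_w (trunc_dev i w * \prod_(j <- js) trunc_dev j w)| <=
  dev_cov_bound (size js) s.
Proof.
move=> s0 sep.
have V0 : 0 <= u%:R * Mf by nonneg.
have Vp0 : 0 <= V1 ^+ size js by exact: exprn_ge0.
have BW : nbhd_union js `<=` W by move=> x /nbhd_unionP[j _ []].
have bB : bounded_borel (nbhd_union js).
  exact: (bounded_borel_setS (measurable_nbhd_union js) BW).
have sep' x y : cell_nbhd i x -> nbhd_union js y -> s <= enorm (x - y).
  by move=> ix /nbhd_unionP[j jjs jy]; exact: (sep j).
have := cov2_cap_le ppalm pcorr K1 hrho a0 qa bW om0 Wom
  (bounded_borel_cell_nbhd R n u i) bB (@cell_nbhdW R d n h u i) BW
  (lebesgue_cell_nbhd_le R n u i) (lebesgue_nbhd_union_le js) s0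
  (expR_ge0 (- c * s `^ ahat)) sep' (fun m l x y => hdec (ltW s0))
  (measurable_cell_stat i) (measurable_dev_prod js) V0 Vp0
  (norm_cell_stat_exp_le i) (norm_dev_prod_le js).
have aH : adm (fun w => \prod_(j <- js) trunc_dev j w).
  by apply: (adm_prod algA) => j; exact: adm_trunc_dev.
have -> : cov2 P (fun w => cell_stat i (config_cap (pp w) (cell_nbhd i)))
    (fun w => dev_prod js (config_cap (pp w) (nbhd_union js))) =
    \int[P]_w (trunc_dev i w * \prod_(j <- js) trunc_dev j w).
  rewrite (_ : (fun w => dev_prod _ _) = (fun w => \prod_(j <- js) trunc_dev j w)); last first.
    by apply/funext => w; rewrite dev_prod_cap.
  set H := fun w => \prod_(j <- js) _.
  rewrite /cov2 -(expZ algA _ aH) -(expB algA); last 2 first.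
  - by apply: (admM algA) => //; exact: adm_trunc_stat.
  - exact: (admZ algA).
  by apply: eq_Rintegral => w _; rewrite -mulrBl.
by [].
Qed.

Lemma dev_cov_bound_ge0 p s : 0 <= dev_cov_bound p s.
Proof. by rewrite /dev_cov_bound; nonneg. Qed.

Lemma dev_moment_bound_ge0 k : 0 <= dev_moment_bound k.
Proof. by rewrite /dev_moment_bound; nonneg. Qed.

(** The bound of [even_moment_le] for a class of at most Nm cells whose neighbourhoods are at mutual
    distance at least s. *)
Definition fluct_bound k (Nm : R) (s : R) : R :=
  expR (4 ^+ k.+1) * (Nm * (k.*2.+2%:R * Nm ^+ k.*2.+1 * dev_cov_bound k.*2.+1 s +
    4 ^+ k.+1 * ((Nm ^+ k + 1) * dev_moment_bound k))).

(* Cells congruent modulo L in every coordinate are at distance at least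
   L - 2 (u + 1). *)
Lemma exp_sum_trunc_dev_le k (L : nat) : (0 < L)%N -> 0 < L%:R - 2 * u.+1%:R :> R ->
  \int[P]_w (\sum_i trunc_dev i w) ^+ k.*2.+2 <=
  (L ^ d)%:R ^+ k.*2.+2 * ((L ^ d)%:R *
    fluct_bound k ((h.*2 ^ d)%:R) (L%:R - 2 * u.+1%:R)).
Proof.
move=> L0 s0; set s := L%:R - _.
(* There are L^d residue classes. [even_moment_le] handles each one, and [exprn_sum_le] combines
   them at the cost of powers of L^d. *)
pose cls (i : idx) : {ffun 'I_d -> 'I_L} := [ffun j => Ordinal (ltn_pmod (i j) L0)].
pose T cc w := \sum_(i <- [seq i <- index_enum idx | cls i == cc]) trunc_dev i w.
have aT cc : adm (T cc) by apply: (adm_sum algA) => i; exact: adm_trunc_dev.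
have sumT w : \sum_i trunc_dev i w = \sum_(cc <- index_enum {ffun 'I_d -> 'I_L}) T cc w.
  rewrite (partition_big cls xpredT) //=; apply: eq_bigr => cc _.
  by rewrite /T big_filter.
have cardC : size (index_enum {ffun 'I_d -> 'I_L}) = (L ^ d)%N.
  by rewrite size_index_enum card_ffun !card_ord.
have cardI : size (index_enum idx) = (h.*2 ^ d)%N.
  by rewrite size_index_enum card_ffun !card_ord.
have cov0 := dev_cov_bound_ge0 k.*2.+1 s.
have mom0 := dev_moment_bound_ge0 k.
have momT cc : \int[P]_w T cc w ^+ k.*2.+2 <= fluct_bound k ((h.*2 ^ d)%:R) s.
  set l := [seq i <- index_enum idx | cls i == cc].
  have ul : uniq l by apply: filter_uniq; exact: index_enum_uniq.
  have sl : (size l)%:R <= (h.*2 ^ d)%:R :> R.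
    by rewrite ler_nat -cardI /l size_filter count_size.
  have h1 := @even_moment_le _ _ _ _ _ algA _ trunc_dev k (dev_moment_bound k)
    (dev_cov_bound k.*2.+1 s) l cov0 ul adm_trunc_dev (fun i _ => exp_trunc_dev_moment_le i k).
  apply: (le_trans (h1 _)) => [i js il sjs sub ijs|].
    rewrite -sjs; apply: norm_exp_trunc_dev_prod_le => // j jjs x y.
    have ji : i != j by apply: contra ijs => /eqP ->.
    apply: cell_nbhd_separated => // j'.
    have /eqP ei : cls i == cc by move: il; rewrite mem_filter => /andP[].
    have /eqP ej : cls j == cc by move: (sub _ jjs); rewrite mem_filter => /andP[].
    have := congr1 (fun g : {ffun 'I_d -> 'I_L} => val (g j')) (etrans ei (esym ej)).
    by rewrite /= !ffunE.
  rewrite /fluct_bound; apply: ler_wpM2l; first exact: expR_ge0.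
  apply: ler_pM => //; first by nonneg.
  apply: lerD.
    apply: ler_wpM2r => //; apply: ler_wpM2l => //.
    by apply: lerXn2r; rewrite ?nnegrE.
  apply: ler_wpM2l; first exact: exprn_ge0.
  apply: ler_wpM2r => //; rewrite lerD2r.
  by apply: lerXn2r; rewrite ?nnegrE.
under eq_Rintegral do rewrite sumT.
apply: (@le_trans _ _ (\int[P]_w ((L ^ d)%:R ^+ k.*2.+2 *
   \sum_(cc <- index_enum {ffun 'I_d -> 'I_L}) T cc w ^+ k.*2.+2))).
  apply: (exp_le algA).
  - by apply: (admX algA); exact: (adm_sum algA).
  - by apply: (admZ algA); apply: (adm_sum algA) => cc; exact: (admX algA).
  - by move=> w; rewrite -cardC; exact: exprn_sum_le.
rewrite (expZ algA); last by apply: (adm_sum algA) => cc; exact: (admX algA).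
apply: ler_wpM2l; first exact: exprn_ge0.
rewrite (exp_sum algA); last by move=> cc; exact: (admX algA).
rewrite -cardC; apply: (le_trans (ler_norm _)).
apply: (ler_norm_sum_size (F := fun cc => \int[P]_w T cc w ^+ k.*2.+2)) => cc _.
rewrite ger0_norm; first exact: momT.
by apply: Rintegral_ge0 => w _; exact: exprn_doubleS_ge0.
Qed.

End truncated_statistic.

(** * Truncation error *)

(* No measurability of g, which makes this applicable to powers of the
   stabilization radius. *)
Lemma ge0_le_integralT d (T : measurableType d) (R : realType)
    (mu : {measure set T -> \bar R}) (f g : T -> \bar R) :
  (forall x, 0 <= f x)%E -> (forall x, f x <= g x)%E ->
  (\int[mu]_x f x <= \int[mu]_x g x)%E.
Proof.
move=> f0 fg; have g0 x : (0 <= g x)%E by exact: le_trans (fg x).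
rewrite !ge0_integralTE //; apply: ereal_sup_le => _ [k /= kf <-].
by exists k => //= x; exact: le_trans (kf x) (fg x).
Qed.

Section campbell_one.
Context (R : realType) (d : nat).
Local Notation E := 'rV[R]_d.
Local Notation N := (config R d).
Context (disp : measure_display) (Omega : measurableType disp)
  (P : probability Omega R) (pp : {RV P >-> N})
  (rho : forall p, p.-tuple E -> R) (palm : forall p, R.-pker p.-tuple E ~> N).
Hypotheses (ppalm : is_palm pp rho palm) (pcorr : is_correlation pp rho).

Lemma measurable_thead : measurable_fun setT (fun t : 1.-tuple E => thead t).
Proof. exact: measurable_tnth. Qed.

(** The Palm formula of order one, with g multiplied by the indicator of A so that the Palm bound is
    only required at points of A. *)
Lemma integral_sum_pts_le (A : set E) (g : E * N -> R) (B K L : R) :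
  bounded_borel A -> measurable_fun setT g -> (forall v, 0 <= g v) ->
  0 <= B -> 0 <= K -> (forall x : 1.-tuple E, rho x <= K) ->
  (forall x : 1.-tuple E, A (thead x) -> \int[palm 1%N x]_X (g (thead x, X))%:E <= B%:E)%E ->
  (lebesgue_vec R d A <= L%:E)%E ->
  (\int[P]_w (\sum_(x <- pts (pp w) A) g (x, pp w))%:E <= (B * K * L)%:E)%E.
Proof.
move=> bA mg g0 B0 K0 rhoK gB AL.
pose G (v : 1.-tuple E * N) : \bar R := (\1_A (thead v.1) * g (thead v.1, v.2))%:E.
have mth : measurable_fun setT (fun v : 1.-tuple E * N => thead v.1).
  exact: (measurableT_comp measurable_thead measurable_fst).
have mG : measurable_fun setT G.
  apply/measurable_EFinP; apply: measurable_funM.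
    apply: (measurableT_comp _ mth); apply: measurable_indic; by case: bA.
  by apply: (measurableT_comp mg); exact: measurable_fun_pair.
have G0 v : (0 <= G v)%E by rewrite lee_fin mulr_ge0 // indicE.
have box1 : [set t : 1.-tuple E | forall i, A (tnth t i)] = (fun t => thead t) @^-1` A.
  by apply/seteqP; split => t h; [exact: h|move=> i; rewrite ord1; exact: h].
have := ppalm (ltn0Sn 0) mG G0.
rewrite [X in X = _ -> _](_ : _ = \int[P]_w (\sum_(x <- pts (pp w) A) g (x, pp w))%:E)%E; last first.
  apply: eq_integral => w _.
  rewrite (@esum_uniq_seq _ _ _ [seq [tuple x] | x <- pts (pp w) A]) //.
  - rewrite big_map -sumEFin big_seq [RHS]big_seq; apply: eq_bigr => x.
    rewrite mem_pts; last by case: bA.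
    by move=> /set_mem[_ Ax]; rewrite /G /= theadE indicE mem_set // mul1r.
  - by rewrite map_inj_uniq ?pts_uniq // => x y [].
  - move=> t /mapP[x]; rewrite mem_pts; last by case: bA.
    by move=> /set_mem[Xx _] ->; split => // i; rewrite ord1.
  - move=> t [_ /(_ ord0) Xt] tA; rewrite /G /= indicE memNset ?mul0r // => At.
    move/negP: tA; apply; apply/mapP; exists (thead t).
      by rewrite mem_pts; [exact/mem_set|case: bA].
    by apply: eq_from_tnth => i; rewrite ord1.
move=> ->.
apply: (@le_trans _ _ (\int[power_measure (lebesgue_vec R d) 1]_t
    ((B * K)%:E * (\1_((fun t => thead t) @^-1` A) t)%:E))%E).
  apply: ge0_le_integralT => t.
    apply: mule_ge0; first by apply: integral_ge0.
    by rewrite lee_fin; have [] := pcorr (ltn0Sn 0).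
  rewrite -EFinM /G /=; case: (pselect (A (thead t))) => At; last first.
    under eq_integral do rewrite indicE memNset // mul0r.
    by rewrite integral0 mul0e indicE memNset // mulr0.
  under eq_integral do rewrite indicE mem_set // mul1r.
  rewrite indicE mem_set // mulr1 EFinM; apply: lee_pmul.
  - by apply: integral_ge0 => X _; rewrite lee_fin.
  - by rewrite lee_fin; have [] := pcorr (ltn0Sn 0).
  - exact: gB.
  - by rewrite lee_fin.
have mB : measurable ((fun t : 1.-tuple E => thead t) @^-1` A).
  by rewrite -[X in measurable X]setTI; apply: measurable_thead => //; case: bA.
rewrite ge0_integralZl_EFin //; [|by apply/measurable_EFinP; exact: measurable_indic|exact: mulr_ge0].
rewrite integral_indic // setIT [leRHS]EFinM; apply: lee_wpmul2l; first by rewrite lee_fin mulr_ge0.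
rewrite -box1 -[L]expr1; have [mA _] := bA.
exact: (@power_measure_box_le _ _ _ (lebesgue_vec R d) 1 (fun=> A) L (fun=> mA) (fun=> AL)).
Qed.

End campbell_one.

Section truncation_error.
Context (R : realType) (d : nat).
Local Notation E := 'rV[R]_d.
Local Notation N := (config R d).
Context (palm : forall p, R.-pker p.-tuple E ~> N) (xi : E -> N -> R).
Hypothesis mxi : measurable_fun setT (fun v : E * N => xi v.1 v.2).
Context (n h u : nat).
Hypotheses (n0 : (0 < n)%N) (u0 : (0 < u)%N).
Local Notation W := (@window R d (Some n)).
Local Notation cell := (@cell R d n h).
Local Notation cell_nbhd := (@cell_nbhd R d n h u).

Definition trunc_err i (x : E) (X : N) : R :=
  `|xi x (config_cap X W) - clip u (xi x (config_cap X (cell_nbhd i)))|.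

Lemma measurable_score_cap A : measurable A ->
  measurable_fun setT (fun v : E * N => xi v.1 (config_cap v.2 A)).
Proof.
move=> mA; have mc := measurable_config_cap mA.
have m2 : measurable_fun setT (fun v : E * N => (v.1, config_cap v.2 A)).
  by apply: measurable_fun_pair => //; exact: (measurableT_comp mc measurable_snd).
exact: (measurableT_comp mxi m2).
Qed.

Lemma measurable_trunc_err i : measurable_fun setT (fun v : E * N => trunc_err i v.1 v.2).
Proof.
apply: measurableT_comp => //; apply: measurable_funB.
  by apply: measurable_score_cap; case: (@bounded_borel_window R d n).
apply: (measurableT_comp (measurable_clip u)).
by apply: measurable_score_cap; exact: measurable_cell_nbhd.
Qed.

(* If some r < u were a radius of stabilization, then both scores would be
   equal to that of the ball of radius r, which lies in the neighbourhood. *)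
Lemma stab_radius_ge i x X : cell i x ->
  xi x (config_cap X W) != xi x (config_cap X (cell_nbhd i)) ->
  (u%:R%:E <= stab_radius xi x (config_cap X W))%E.
Proof.
move=> ix xineq; apply: le_ereal_inf_tmp => _ [r [r0 stabr] <-].
rewrite lee_fin leNgt; apply/negP => ru; move/negP: xineq; apply; apply/eqP.
have hW := stabr (config_cap X W); have hB := stabr (config_cap X (cell_nbhd i)).
have bu y : cball x r y -> cball x u%:R y by move=> xy; apply: (le_trans xy); exact: ltW.
rewrite (_ : config_cup _ _ = config_cap X W) in hW; last first.
  apply: config_inj; apply/seteqP; split => y /=; first by case=> -[].
  by case=> Xy Wy; case: (pselect (cball x r y)) => xy; [left|right].
rewrite (_ : config_cup _ _ = config_cap X (cell_nbhd i)) in hB; last first.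
  apply: config_inj; apply/seteqP; split => y /=.
    case=> -[]; last by [].
    by move=> [Xy Wy] xy; split => //; apply: (cball_cell_subset ix); split => //; exact: bu.
  case=> Xy By; case: (pselect (cball x r y)) => xy; [left|right] => //.
  by split => //; split => //; exact: cell_nbhdW By.
by rewrite -hW -hB.
Qed.

(** If y = z the error is |y| on the event |y| > u, at most |y|^(m+1) / u^m. If not, it is at most
    |y| + u, and comparing |y| with u^m gives |y| <= |y|^2 / u^m + u^m. The moments of y and the
    event y != z thus appear in separate terms, without a Cauchy-Schwarz step. *)
Lemma clip_error_le (m : nat) (y z : R) : (0 < m)%N ->
  `|y - clip u z| <= u%:R ^- m * (`|y| ^+ 2 + `|y| ^+ m.+1) + 2 * u%:R ^+ m * (y != z)%:R.
Proof.
move=> m0; have U1 : (1 : R) <= u%:R by rewrite ler1n.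
have U0 : (0 : R) < u%:R by rewrite ltr0n.
have Um0 : 0 < (u%:R : R) ^+ m by exact: exprn_gt0.
have Ui0 : 0 < (u%:R : R) ^- m by rewrite invr_gt0.
have y2 : 0 <= `|y| ^+ 2 by exact: exprn_ge0.
have ym : 0 <= `|y| ^+ m.+1 by exact: exprn_ge0.
case: (eqVneq y z) => [<-|yz].
  rewrite mulr0 addr0 /clip; case: ifPn => yu.
    by rewrite subrr normr0; apply: mulr_ge0; [exact: ltW|exact: addr_ge0].
  rewrite subr0 mulrC ler_pdivlMr //; apply: ler_wpDl => //; rewrite exprS.
  apply: ler_wpM2l => //; apply: lerXn2r; rewrite ?nnegrE //.
  by apply: ltW; rewrite ltNge.
rewrite mulr1; apply: (le_trans (ler_normB _ _)).
apply: (le_trans (lerD (lexx _) (norm_clip_le u z))).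
have Uum : (u%:R : R) <= u%:R ^+ m by rewrite -[leLHS]expr1; apply: ler_weXn2l.
have hy : `|y| <= u%:R ^- m * `|y| ^+ 2 + u%:R ^+ m.
  case: (lerP `|y| (u%:R ^+ m)) => hy; first by apply: ler_wpDl => //; apply: mulr_ge0 => //; exact: ltW.
  apply: ler_wpDr; first exact: ltW.
  rewrite mulrC ler_pdivlMr // expr2; apply: ler_wpM2l => //; exact: ltW.
have ym' : 0 <= u%:R ^- m * `|y| ^+ m.+1 by apply: mulr_ge0 => //; exact: ltW.
rewrite mulrDr; lra.
Qed.

Context (b beta Cs Cm : R).
Hypotheses
  (stab : forall (p q : nat) (k : option nat) (x : q.+1.-tuple E),
      (q < p)%N -> k <> Some 0%N -> (forall i, window k (tnth x i)) ->
      (\int[palm q.+1 x]_X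
         (`|stab_radius xi (thead x) (config_cap X (window k))| ^+ p)
       <= (Cs ^+ p * p`!%:R `^ b)%:E)%E)
  (mom : forall (p q : nat) (k : option nat) (x : q.+1.-tuple E),
      (q < p)%N -> k <> Some 0%N -> (forall i, window k (tnth x i)) ->
      (\int[palm q.+1 x]_X
         (`|xi (thead x) (config_cap X (window k))| ^+ p)%:E
       <= (Cm ^+ p * p`!%:R `^ beta)%:E)%E).

(** The radius enters with order 2m because [clip_error_le] multiplies the event y != z by u^m,
    which consumes half of the gain u^(-2m) of Markov's inequality. *)
Definition palm_err_const (m : nat) : R :=
  Cm ^+ 2 * 2`!%:R `^ beta + Cm ^+ m.+1 * m.+1`!%:R `^ beta +
  2 * (Cs ^+ m.*2 * m.*2`!%:R `^ b).

Lemma expe_le_EFin (r : R) (z : \bar R) k : 0 <= r -> (r%:E <= z)%E ->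
  ((r ^+ k)%:E <= `|z| ^+ k)%E.
Proof.
move=> r0; case: z => [s| |] //=.
- rewrite lee_fin => rs; rewrite -EFin_expe lee_fin; apply: lerXn2r; rewrite ?nnegrE //.
  by apply: (le_trans rs); exact: ler_norm.
- case: k => [|k] _; first by rewrite expr0 expe0.
  suff -> : (+oo ^+ k.+1 = +oo :> \bar R)%E by rewrite leey.
  by elim: k => [|k IH]; rewrite expeS ?IH ?expe0 ?mule1 ?mulyy.
Qed.

Lemma palm_err_const_ge0 m : 0 <= Cs -> 0 <= Cm -> 0 <= palm_err_const m.
Proof. by move=> c1 c2; rewrite /palm_err_const; nonneg. Qed.

Lemma palm_trunc_err_le m i (x : 1.-tuple E) : (0 < m)%N -> cell i (thead x) ->
  (\int[palm 1%N x]_X (trunc_err i (thead x) X)%:E <=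
   (u%:R ^- m * palm_err_const m)%:E)%E.
Proof.
move=> m0 ix; have U0 : (0 : R) < u%:R by rewrite ltr0n.
have Um0 : 0 < (u%:R : R) ^+ m by exact: exprn_gt0.
have Ui0 : 0 <= (u%:R : R) ^- m by rewrite invr_ge0 ltW.
have xW j : W (tnth x j) by rewrite ord1; exact: cellW ix.
have sn0 : Some n <> Some 0%N by case=> n'; move: n0; rewrite n'.
pose y X := xi (thead x) (config_cap X W).
pose z X := xi (thead x) (config_cap X (cell_nbhd i)).
have mW : measurable W by case: (@bounded_borel_window R d n).
have mpair : measurable_fun setT (fun X : N => (thead x, X)) by exact: measurable_pair1.
have my : measurable_fun setT y by exact: (measurableT_comp (measurable_score_cap mW) mpair).
have mz : measurable_fun setT z.
  have mB : measurable (cell_nbhd i) by exact: measurable_cell_nbhd.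
  exact: (measurableT_comp (measurable_score_cap mB) mpair).
have mD : measurable [set X | y X != z X].
  rewrite (_ : mkset _ = (fun X => y X - z X) @^-1` (~` [set 0])).
    rewrite -[X in measurable X]setTI; apply: measurable_funB => //; exact: measurableC.
  by apply/seteqP; split => X /=; rewrite -subr_eq0 => /eqP.
have mexp k : measurable_fun setT (fun X => (`|y X| ^+ k)%:E).
  by apply/measurable_EFinP; apply: measurable_funX; exact: measurableT_comp.
have mDi : measurable_fun setT (fun X => (\1_[set X | y X != z X] X)%:E : \bar R).
  by apply/measurable_EFinP; exact: measurable_indic.
have ey k : (0 < k)%N -> (\int[palm 1%N x]_X (`|y X| ^+ k)%:E <= (Cm ^+ k * k`!%:R `^ beta)%:E)%E.
  by move=> k0; exact: (mom k0 sn0 xW).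
(* Markov's inequality of order 2m: on this event the stabilization radius is at least u, by
   [stab_radius_ge]. *)
have eD : (\int[palm 1%N x]_X (\1_[set X | y X != z X] X)%:E <=
    (u%:R ^- m.*2 * (Cs ^+ m.*2 * m.*2`!%:R `^ b))%:E)%E.
  have Umm : 0 < (u%:R : R) ^+ m.*2 by exact: exprn_gt0.
  rewrite EFinM -lee_pdivrMl ?invr_gt0 // invrK -ge0_integralZl_EFin //.
  apply: (le_trans _ (stab (p := m.*2) (q := 0) _ sn0 xW)); last by rewrite double_gt0.
  apply: ge0_le_integralT => X; first by rewrite -EFinM lee_fin mulr_ge0 // ltW.
  rewrite -EFinM indicE; case: (boolP (y X == z X)) => yz.
    rewrite memNset /= ?yz // mulr0; exact: expe_ge0.
  rewrite mem_set //= mulr1; apply: expe_le_EFin; first exact: ltW.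
  exact: (stab_radius_ge ix yz).
apply: (@le_trans _ _ (\int[palm 1%N x]_X ((u%:R ^- m)%:E * ((`|y X| ^+ 2)%:E + (`|y X| ^+ m.+1)%:E) +
   (2 * u%:R ^+ m)%:E * (\1_[set X | y X != z X] X)%:E))%E).
  apply: ge0_le_integralT => X; first by rewrite lee_fin normr_ge0.
  rewrite [leRHS](_ : _ = (u%:R ^- m * (`|y X| ^+ 2 + `|y X| ^+ m.+1) +
    2 * u%:R ^+ m * \1_[set X | y X != z X] X)%:E) // lee_fin indicE.
  rewrite (_ : (X \in _) = (y X != z X)); first exact: clip_error_le.
  by apply/idP/idP => [/set_mem|h']; [|exact/mem_set].
have U2 : 0 <= 2 * (u%:R : R) ^+ m by rewrite mulr_ge0 // ltW.
rewrite ge0_integralD //; last 3 first.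
- by move=> X _; apply: mule_ge0; rewrite ?adde_ge0 ?lee_fin ?exprn_ge0.
- by apply: measurable_funeM; exact: emeasurable_funD.
- exact: measurable_funeM.
rewrite !ge0_integralZl_EFin //; last 2 first.
- by move=> X _; rewrite adde_ge0 ?lee_fin ?exprn_ge0.
- exact: emeasurable_funD.
rewrite ge0_integralD //.
apply: (le_trans (leeD (lee_wpmul2l _ (leeD (ey _ _) (ey _ _))) (lee_wpmul2l _ eD))) => //.
rewrite [leLHS](_ : _ = (u%:R ^- m * (Cm ^+ 2 * 2`!%:R `^ beta + Cm ^+ m.+1 * m.+1`!%:R `^ beta) +
  2 * u%:R ^+ m * (u%:R ^- m.*2 * (Cs ^+ m.*2 * m.*2`!%:R `^ b)))%:E) // lee_fin.
rewrite /palm_err_const !mulrDr lerD2l.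
rewrite -addnn exprD invfM.
set A := Cs ^+ _ * _; move: (u%:R ^+ m) Um0 => v v0.
by rewrite le_eqVlt; apply/orP; left; apply/eqP; field; rewrite lt0r_neq0.
Qed.

End truncation_error.

Section statistic_truncation.
Context (R : realType) (d : nat).
Local Notation E := 'rV[R]_d.
Local Notation N := (config R d).
Context (disp : measure_display) (Omega : measurableType disp)
  (P : probability Omega R) (pp : {RV P >-> N})
  (rho : forall p, p.-tuple E -> R) (palm : forall p, R.-pker p.-tuple E ~> N).
Hypotheses (ppalm : is_palm pp rho palm) (pcorr : is_correlation pp rho).
Context (xi : E -> N -> R) (f : E -> R) (Mf : R).
Hypotheses (mxi : measurable_fun setT (fun v : E * N => xi v.1 v.2))
  (mf : measurable_fun setT f) (Mf1 : 1 <= Mf) (fM : forall x, `|f x| <= Mf).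
Context (n : nat).
Local Notation W := (@window R d (Some n)).

Lemma statisticE X : statistic xi f n X =
  \sum_(x <- pts X W) xi x (config_cap X W) * rescaled f n x.
Proof.
rewrite /statistic; have bW : bounded_set W by case: (@bounded_borel_window R d n).
by rewrite (fsbig_finite _ _ (points_locally_finite X bW)).
Qed.

Lemma measurable_statistic : measurable_fun setT (statistic xi f n).
Proof.
rewrite (_ : statistic xi f n = fun X => \sum_(x <- pts X W)
    xi x (config_cap X W) * rescaled f n x); last by apply/funext => X; rewrite statisticE.
have mW : measurable W by case: (@bounded_borel_window R d n).
have mid : measurable_fun setT (fun X : N => X) by exact: measurable_id.
have mg : measurable_fun setT (fun v : E * N => xi v.1 (config_cap v.2 W) * rescaled f n v.1).
  apply: measurable_funM; first exact: measurable_score_cap.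
  exact: (measurableT_comp (measurable_rescaled mf n)).
exact: (measurable_sum_pts mid (bounded_borel_window R d n) mg).
Qed.

Context (h u : nat).
Hypotheses (n0 : (0 < n)%N) (h0 : (0 < h)%N) (u0 : (0 < u)%N)
  (rh : n%:R `^ d%:R^-1 <= h%:R :> R).
Local Notation cell := (@cell R d n h).

Lemma norm_statistic_sub_le w :
  `|statistic xi f n (pp w) - \sum_(i : {ffun 'I_d -> 'I_h.*2}) trunc_stat pp xi f n u i w| <=
  Mf * \sum_(i : {ffun 'I_d -> 'I_h.*2}) \sum_(x <- pts (pp w) (cell i)) trunc_err xi n u i x (pp w).
Proof.
rewrite statisticE (sum_cells h0 rh) -sumrB mulr_sumr.
apply: (le_trans (ler_norm_sum _ _ _)); apply: ler_sum => i _.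
rewrite /trunc_stat /cell_stat pts_cap (_ : _ `&` _ = cell i); last first.
  by apply/seteqP; split => [x []|x Cx] //; split => //; exact: cell_subset_nbhd.
rewrite -sumrB mulr_sumr; apply: (le_trans (ler_norm_sum _ _ _)); apply: ler_sum => x _.
by rewrite -mulrBl normrM mulrC; apply: ler_wpM2r; [exact: normr_ge0|exact: fM].
Qed.

Context (b beta Cs Cm K : R).
Hypotheses
  (stab : forall (p q : nat) (k : option nat) (x : q.+1.-tuple E),
      (q < p)%N -> k <> Some 0%N -> (forall i, window k (tnth x i)) ->
      (\int[palm q.+1 x]_X
         (`|stab_radius xi (thead x) (config_cap X (window k))| ^+ p)
       <= (Cs ^+ p * p`!%:R `^ b)%:E)%E)
  (mom : forall (p q : nat) (k : option nat) (x : q.+1.-tuple E),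
      (q < p)%N -> k <> Some 0%N -> (forall i, window k (tnth x i)) ->
      (\int[palm q.+1 x]_X
         (`|xi (thead x) (config_cap X (window k))| ^+ p)%:E
       <= (Cm ^+ p * p`!%:R `^ beta)%:E)%E)
  (Cs0 : 0 <= Cs) (Cm0 : 0 <= Cm) (K0 : 0 <= K)
  (rhoK : forall x : 1.-tuple E, rho x <= K).

Lemma exp_statistic_sub_le m : (0 < m)%N ->
  (\int[P]_w (`|statistic xi f n (pp w) - \sum_(i : {ffun 'I_d -> 'I_h.*2}) trunc_stat pp xi f n u i w|)%:E <=
   (Mf * ((h.*2 ^ d)%:R * (u%:R ^- m * palm_err_const b beta Cs Cm m * K)))%:E)%E.
Proof.
move=> m0.
pose G (i : {ffun 'I_d -> 'I_h.*2}) w := (\sum_(x <- pts (pp w) (cell i)) trunc_err xi n u i x (pp w))%:E.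
have err0 i w : (0 <= G i w)%E by rewrite lee_fin; apply: sumr_ge0 => x _; exact: normr_ge0.
have mpp := measurable_pp pp.
have mG i : measurable_fun setT (G i).
  apply/measurable_EFinP.
  have mg := measurable_sum_pts (@measurable_id _ N setT) (bounded_borel_cell R n i)
    (measurable_trunc_err mxi n u i).
  exact: (measurableT_comp mg mpp).
apply: (@le_trans _ _ (\int[P]_w (Mf%:E * \sum_i G i w))%E).
  apply: ge0_le_integralT => w; first by rewrite lee_fin normr_ge0.
  by rewrite sumEFin -EFinM lee_fin; exact: norm_statistic_sub_le.
have Mf0 : 0 <= Mf by exact: le_trans Mf1.
rewrite ge0_integralZl_EFin //; last 2 first.
- by move=> w _; apply: sume_ge0.
- exact: emeasurable_sum.
rewrite EFinM; apply: lee_wpmul2l; first by rewrite lee_fin.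
rewrite ge0_integral_sum //.
have cd0 := palm_err_const_ge0 b beta m Cs0 Cm0.
have B0 : 0 <= u%:R ^- m * palm_err_const b beta Cs Cm m by rewrite mulr_ge0 // invr_ge0 exprn_ge0.
rewrite (_ : ((h.*2 ^ d)%:R * _)%:E = \sum_(i : {ffun 'I_d -> 'I_h.*2})
    (u%:R ^- m * palm_err_const b beta Cs Cm m * K)%:E)%E; last first.
  by rewrite sumEFin sumr_const card_ffun !card_ord mulr_natl.
apply: lee_sum => i _; rewrite -[X in (_ <= X%:E)%E]mulr1.
apply: (integral_sum_pts_le (g := fun v => trunc_err xi n u i v.1 v.2) ppalm pcorr
  (bounded_borel_cell R n i)) => //.
- exact: measurable_trunc_err.
- by move=> v; exact: normr_ge0.
- by move=> x ix; exact: (palm_trunc_err_le mxi n0 u0 stab mom m0 ix).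
- exact: lebesgue_cell_le.
Qed.

End statistic_truncation.

(** * Choice of the scales *)

(** The right-hand side is n to the power (k+1)(1+eps). The exponent k + 4 exceeds by 2 the exponent
    k + 2 of the moment bound. *)
Lemma sqrt_powR_exprn_ge (R : realType) (eps : R) (k n : nat) : (0 < n)%N ->
  3%:R <= k.+1%:R * eps ->
  (n%:R : R) ^+ (k + 4) <= (Num.sqrt n%:R `^ (1 + eps)) ^+ k.*2.+2.
Proof.
move=> n0 keps; have n1 : (1 : R) <= n%:R by rewrite ler1n.
have n0' : (0 : R) <= n%:R by exact: le_trans n1.
rewrite -powR12_sqrt // -!powRrM -[leRHS]powR_mulrn ?powR_ge0 // -powRrM -powR_mulrn //.
apply: ler_powR => //.
have -> : (k.*2.+2%:R : R) = 2 * k.+1%:R by rewrite -natrM mul2n doubleS.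
rewrite (_ : 2^-1 * (1 + eps) * _ = k.+1%:R + k.+1%:R * eps).
  rewrite (_ : (k + 4)%:R = k.+1%:R + 3%:R); first by rewrite lerD2l.
  by rewrite -natrD addSnnS.
by move: (k.+1%:R : R) => x; field.
Qed.

(** Turns n^-2 into the telescoping form required by [ae_cvg0_of_summable_integral], as n + 2 <= 2
    (n + 1). *)
Lemma inv_sqr_le (R : realType) (n : nat) :
  (n.+1%:R : R) ^- 2 <= 2 / (n.+1%:R * n.+2%:R).
Proof.
have h1 : (0 : R) < n.+1%:R by rewrite ltr0n.
have h2 : (n.+2%:R : R) = n.+1%:R + 1 by rewrite natr1.
have h3 : (1 : R) <= n.+1%:R by rewrite ler1n.
rewrite h2; move: (n.+1%:R : R) h1 h3 => x x0 x1.
rewrite ler_pdivlMr; last by apply: mulr_gt0 => //; lra.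
rewrite mulrC ler_pdivrMr ?exprn_gt0 // expr2; nra.
Qed.

Lemma cvg0_exprn (R : realType) (v : nat -> R) (p : nat) :
  v n ^+ p.+1 @[n --> \oo] --> (0 : R) -> v n @[n --> \oo] --> (0 : R).
Proof.
move=> /cvgr0Pnorm_lt vp; apply/cvgr0Pnorm_lt => e e0.
have ep : 0 < e ^+ p.+1 by exact: exprn_gt0.
apply: filterS (vp _ ep) => n; rewrite normrX => h.
rewrite ltNge; apply/negP => h'; move: h; apply/negP; rewrite -leNgt.
by apply: lerXn2r => //; rewrite nnegrE // ltW.
Qed.

Lemma cvg0_inv_sqr (R : realType) (C : R) : C * n.+1%:R ^- 2 @[n --> \oo] --> (0 : R).
Proof.
rewrite -(mulr0 C); apply: cvgMr.
rewrite -(mulr0 (0 : R)); under eq_fun do rewrite expr2 invfM.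
by apply: cvgM; exact: cvg_harmonic.
Qed.

(** * Almost sure convergence from an approximation in mean *)

Section approximation.
Context (disp : measure_display) (T : measurableType disp) (R : realType)
  (P : probability T R) (S A : nat -> T -> R) (eps C : R) (k : nat).
Hypotheses (keps : 3%:R <= k.+1%:R * eps) (C0 : 0 <= C).
Hypotheses (mS : forall n, measurable_fun setT (S n))
  (iA : forall n, P.-integrable setT (EFin \o A n)).
Hypotheses
  (SA : forall n, (0 < n)%N -> (\int[P]_w (`|S n w - A n w|)%:E <= (C * n%:R ^- 2)%:E)%E)
  (AA : forall n, (0 < n)%N ->
    (\int[P]_w ((A n w - \int[P]_v A n v) ^+ k.*2.+2)%:E <= (C * n%:R ^+ k.+2)%:E)%E).

Let mA n : measurable_fun setT (A n).
Proof. by apply/measurable_EFinP; exact: measurable_int (iA n). Qed.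

Let iSA n : (0 < n)%N -> P.-integrable setT (EFin \o (fun w => S n w - A n w)).
Proof.
move=> n0; apply/integrableP; split.
  by apply/measurable_EFinP; exact: measurable_funB.
by apply: (le_lt_trans (SA n0)); rewrite ltry.
Qed.

(** For n > 0, [S n] is the integrable [A n] plus an L^1 error, so its expectation is finite and
    [fine] loses nothing. *)
Lemma exp_approx_sub_le n : (0 < n)%N ->
  `|fine 'E_P[S n]%E - \int[P]_v A n v| <= C * n%:R ^- 2.
Proof.
move=> n0; have iS : P.-integrable setT (EFin \o S n).
  have -> : EFin \o S n = (fun w => ((S n w - A n w)%:E + (A n w)%:E)%E).
    by apply/funext => w /=; rewrite -EFinD subrK.
  by apply: integrableD => //; [exact: iSA|exact: iA].
rewrite (_ : fine _ = \int[P]_v S n v); last by rewrite unlock.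
rewrite -RintegralB //.
apply: (le_trans (le_normr_Rintegral _ _)) => //; first exact: iSA.
rewrite -lee_fin /Rintegral fineK; first exact: SA.
apply/fin_numPlt; rewrite (lt_le_trans (ltNyr 0)) ?integral_ge0 //=.
by apply: (le_lt_trans (SA n0)); rewrite ltry.
Qed.

(** S - E S is (S - A) + (A - E A) - (E S - E A). The first term and the normalized power of the
    second have summable expectations; the third is deterministic and small. *)
Lemma ae_cvg_of_approximation : {ae P, forall w,
  (S n w - fine 'E_P[S n]%E) / Num.sqrt n%:R `^ (1 + eps) @[n --> \oo] --> (0 : R)}.
Proof.
pose D n : R := Num.sqrt n%:R `^ (1 + eps).
have DX n : (0 < n)%N -> n%:R ^+ (k + 4) <= D n ^+ k.*2.+2.
  by move=> n0; exact: sqrt_powR_exprn_ge.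
have D1 n : (0 < n)%N -> 1 <= D n.
  move=> n0; have e : 1 <= D n ^+ k.*2.+2.
    by apply: (le_trans _ (DX n n0)); rewrite exprn_ege1 // ler1n.
  rewrite leNgt; apply/negP => Dn1; move: e; apply/negP; rewrite -ltNge.
  by rewrite exprn_ilt1 // powR_ge0.
have h1 : {ae P, forall w, `|S n.+1 w - A n.+1 w| @[n --> \oo] --> (0 : R)}.
  apply: (@ae_cvg0_of_summable_integral _ _ _ _ _ (C * 2)) => [n|n w|n] //.
    by apply: measurableT_comp => //; exact: measurable_funB.
  apply: (le_trans (SA (ltn0Sn n))); rewrite lee_fin -mulrA; apply: ler_wpM2l => //.
  exact: inv_sqr_le.
have h2 : {ae P, forall w, ((A n.+1 w - \int[P]_v A n.+1 v) / D n.+1) ^+ k.*2.+2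
    @[n --> \oo] --> (0 : R)}.
  apply: (@ae_cvg0_of_summable_integral _ _ _ _ _ (C * 2)) => [n|n w|n].
  - by apply: measurable_funX; apply: measurable_funM => //; exact: measurable_funB.
  - exact: exprn_doubleS_ge0.
  have Dn := D1 _ (ltn0Sn n); have D0 : 0 < D n.+1 by exact: lt_le_trans Dn.
  have mX : measurable_fun setT (fun w => ((A n.+1 w - \int[P]_v A n.+1 v) ^+ k.*2.+2)%:E).
    by apply/measurable_EFinP; apply: measurable_funX; exact: measurable_funB.
  have X0 w : (0 <= ((A n.+1 w - \int[P]_v A n.+1 v) ^+ k.*2.+2)%:E)%E.
    by rewrite lee_fin exprn_doubleS_ge0.
  have Di : 0 <= D n.+1 ^- k.*2.+2 by rewrite invr_ge0 exprn_ge0 // ltW.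
  rewrite (_ : (fun w => _) = (fun w => (D n.+1 ^- k.*2.+2)%:E *
      ((A n.+1 w - \int[P]_v A n.+1 v) ^+ k.*2.+2)%:E)%E); last first.
    by apply/funext => w; rewrite -EFinM expr_div_n mulrC.
  rewrite ge0_integralZl_EFin //.
  apply: (le_trans (lee_wpmul2l _ (AA (ltn0Sn n)))) => //.
  rewrite -EFinM lee_fin mulrCA -mulrA; apply: ler_wpM2l => //.
  apply: (le_trans _ (inv_sqr_le R n)).
  have N0 : (0 : R) < n.+1%:R by rewrite ltr0n.
  rewrite mulrC ler_pdivrMr ?exprn_gt0 //.
  rewrite -[leLHS](mulKf (x := n.+1%:R ^+ 2)) ?expf_neq0 ?lt0r_neq0 //.
  apply: ler_wpM2l; first by rewrite invr_ge0 exprn_ge0.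
  by rewrite -exprD addnC (_ : (_ + 2)%N = (k + 4)%N); [exact: DX|lia].
apply: filterS2 h1 h2 => w h1 /cvg0_exprn h2.
(* The estimates hold for n > 0 only, hence the shift of the sequence. *)
rewrite -cvg_shiftS /=; apply: norm_cvg0.
have h3 := cvg0_inv_sqr C.
apply: (squeeze_cvgr (f := fun=> 0) (h := fun n => `|S n.+1 w - A n.+1 w| +
   `|(A n.+1 w - \int[P]_v A n.+1 v) / D n.+1| + C * n.+1%:R ^- 2)).
- near=> n; rewrite normr_ge0 /=.
  have Dn := D1 _ (ltn0Sn n); have D0 : 0 < D n.+1 by exact: lt_le_trans Dn.
  have es := exp_approx_sub_le (ltn0Sn n).
  rewrite -/(D n.+1) normrM normrV ?unitfE ?lt0r_neq0 // (ger0_norm (ltW D0)) ler_pdivrMr //.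
  rewrite normrM normrV ?unitfE ?lt0r_neq0 // (ger0_norm (ltW D0)) !mulrDl divfK ?lt0r_neq0 //.
  set EA := \int[P]_v A n.+1 v in es *.
  set ES := fine 'E_P[S n.+1]%E in es *.
  have -> : S n.+1 w - ES = (S n.+1 w - A n.+1 w) + (A n.+1 w - EA) - (ES - EA) by ring.
  apply: (le_trans (ler_normB _ _)); apply: lerD; last first.
    apply: (le_trans es); rewrite ler_peMr // mulr_ge0 // invr_ge0 exprn_ge0 //.
  apply: (le_trans (ler_normD _ _)); rewrite lerD2r.
  by rewrite ler_peMr.
- exact: cvg_cst.
- rewrite -[X in _ --> X]addr0 -[X in _ --> X + _]addr0.
  by apply: cvgD => //; apply: cvgD => //; apply/norm_cvg0P.
Unshelve. all: by end_near.
Qed.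

End approximation.

(** An integer substitute for the e-th root: u is minimal with n <= u^e. If u >= 2 then (u-1)^e < n
    and u <= 2 (u-1), which gives the upper bound. *)
Lemma nat_root_bounds (e n : nat) : (0 < n)%N -> (0 < e)%N ->
  exists u, [/\ (0 < u)%N, (n <= u ^ e)%N & (u ^ e <= 2 ^ e * n)%N].
Proof.
move=> n0 e0.
have ex : exists u, (0 < u)%N && (n <= u ^ e)%N.
  by exists n; rewrite n0 /= -[X in (X <= _)%N]expn1 leq_pexp2l.
case: (ex_minnP ex) => u /andP[u0 nu] umin; exists u; split => //.
case: (leqP u 1) => u1.
  have -> : u = 1%N by lia.
  by rewrite exp1n muln_gt0 expn_gt0.
have hu : ((u.-1) ^ e < n)%N.
  by rewrite ltnNge; apply/negP => h; have := umin u.-1; rewrite h; lia.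
apply: (@leq_trans ((2 * u.-1) ^ e)); first by rewrite leq_exp2r //; lia.
by rewrite expnMn leq_mul2l ltnW // orbT.
Qed.

(** For u >= 2 B / c the exponent is at most B - c u; for smaller u it is at most [B2], while c u /
    2 < B. In both cases it is at most B2 + B - c u / 2, and exp(-y) <= D! / y^D. *)
Lemma expR_power_decay (R : realType) (B c : R) (r D : nat) : 0 <= B -> 0 < c ->
  exists2 M : R, 0 <= M & forall u : nat, (0 < u)%N ->
    expR (B * u%:R ^+ r - c * u%:R ^+ r.+1) <= M * u%:R ^- D.
Proof.
move=> B0 c0; pose B2 := B * (2 * B / c) ^+ r.
have B20 : 0 <= B2 by rewrite /B2; apply: mulr_ge0 => //; apply: exprn_ge0; nonneg.
exists (expR (B2 + B) * (D`!%:R * (2 / c) ^+ D)).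
  by apply: mulr_ge0; [exact: expR_ge0|apply: mulr_ge0 => //; apply: exprn_ge0; nonneg].
move=> u u0; have U1 : (1 : R) <= u%:R by rewrite ler1n.
move: (u%:R : R) U1 => x x1; have x0 : 0 < x by exact: lt_le_trans x1.
have xr1 : 1 <= x ^+ r by exact: exprn_ege1.
apply: (@le_trans _ _ (expR (B2 + B - c / 2 * x))).
  rewrite ler_expR exprS.
  have -> : B * x ^+ r - c * (x * x ^+ r) = x ^+ r * (B - c * x) by move: (x ^+ r) => z; ring.
  case: (lerP (2 * B / c) x) => h.
    have h2 : 2 * B <= c * x by rewrite [c * x]mulrC -ler_pdivrMr.
    apply: (@le_trans _ _ (1 * (B - c * x))); last by lra.
    by apply: ler_wnM2r => //; nra.
  have h2 : c * x < 2 * B by rewrite [c * x]mulrC -ltr_pdivlMr.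
  have h3 : x ^+ r <= (2 * B / c) ^+ r by apply: lerXn2r; rewrite ?nnegrE; nonneg.
  have h4 : B * x ^+ r <= B2 by apply: ler_wpM2l.
  have h5 : 0 <= x ^+ r * (c * x) by nonneg.
  move: h4 h5; rewrite mulrBr [x ^+ r * B]mulrC; move: (x ^+ r) => z h4 h5; lra.
rewrite expRD -[leRHS]mulrA -(mulrA D`!%:R); apply: ler_wpM2l; first exact: expR_ge0.
rewrite expRN -exprVn -exprMn.
have y0 : 0 < c / 2 * x by apply: mulr_gt0 => //; lra.
have -> : 2 / c * x^-1 = (c / 2 * x)^-1 by field; lra.
move: (c / 2 * x) y0 => y y0.
have := exprn_fact_le_expR D (ltW y0) => h.
have f0 : (0 : R) < D`!%:R by rewrite ltr0n fact_gt0.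
have q0 : 0 < y ^+ D / D`!%:R by rewrite divr_gt0 ?exprn_gt0.
rewrite exprVn -[leRHS]invf_div.
by rewrite lef_pV2 ?posrE ?expR_gt0.
Qed.

(** * Bounds in powers of u and n *)

Section asymptotics.
Context (R : realType) (d : nat) (K ahat c Mf : R) (q J : nat).
Hypotheses (K1 : 1 <= K) (ahat0 : 0 < ahat) (c0 : 0 < c) (Mf1 : 1 <= Mf)
  (Jd : (d * q).+1%:R <= J%:R * ahat).

Let K0 : 0 <= K. Proof. exact: le_trans K1. Qed.
Let Mf0 : 0 <= Mf. Proof. exact: le_trans Mf1. Qed.

(** The neighbourhoods have volume of order u^d, so decoupling costs the exponential of a multiple
    of u^(d q). By the choice of J, the decay at distance u^J is at least as fast as expR (- c u^(d
    q + 1)). *)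
Lemma dev_cov_bound_le (p D : nat) : exists2 M : R, 0 <= M &
  forall (u : nat) (s : R), (0 < u)%N -> u%:R ^+ J <= s ->
    dev_cov_bound d K ahat c q Mf u p s <= M * u%:R ^- D.
Proof.
pose A1 := (2 * (2 * K * 3 * 4 ^+ d)) ^+ q.
pose A2 := (2 * (2 * K * (2 ^ p).-1.+2%:R * (p%:R * 4 ^+ d))) ^+ q.
have A10 : 0 <= A1 by rewrite /A1; apply: exprn_ge0; nonneg.
have A20 : 0 <= A2 by rewrite /A2; apply: exprn_ge0; nonneg.
(* The additional p+1 cancels the power u^(p+1) contributed by the bound on one cell statistic and p
   deviations. *)
have [M M0 hM] := expR_power_decay (d * q) (D + p.+1) (addr_ge0 A10 A20) c0.
pose V := 16 * (Mf * (Mf * (K + 1)) ^+ p).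
have V0 : 0 <= V.
  by rewrite /V; apply: mulr_ge0 => //; apply: mulr_ge0 => //; apply: exprn_ge0; nonneg.
exists (V * M); first exact: mulr_ge0.
move=> u s u0 us; have U1 : (1 : R) <= u%:R by rewrite ler1n.
(* The constant 4 comes from 2 (u+1) <= 4 u, as u >= 1. *)
have al4 : (2 * u.+1%:R : R) ^+ d <= 4 ^+ d * u%:R ^+ d.
  rewrite -exprMn -[u.+1%:R]natr1; apply: lerXn2r; rewrite ?nnegrE; lra.
have al0 : 0 <= (2 * u.+1%:R : R) ^+ d by nonneg.
rewrite /dev_cov_bound; move: (2 * u.+1%:R : R) al0 al4 => al al0 al4.
have := hM u u0; move: (u%:R : R) U1 us al4 => x x1 us al4 {}hM.
have x0 : 0 < x by exact: lt_le_trans x1.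
have e0 : expR (- c * s `^ ahat) <= expR (- (c * x ^+ (d * q).+1)).
  rewrite ler_expR mulNr lerN2; apply: ler_wpM2l; first exact: ltW.
  apply: (@le_trans _ _ ((x ^+ J) `^ ahat)).
    by rewrite -!powR_mulrn ?(ltW x0) // -powRrM; exact: ler_powR.
  have xJ : 0 <= x ^+ J by exact/exprn_ge0/ltW.
  by apply: ge0_ler_powR; rewrite ?nnegrE ?(ltW ahat0) // (le_trans xJ).
have ex (t : R) : 0 <= t ->
    expR ((2 * (t * al ^+ d)) ^+ q) <= expR ((2 * (t * 4 ^+ d)) ^+ q * x ^+ (d * q)).
  move=> t0; rewrite ler_expR exprM -exprMn; apply: lerXn2r; rewrite ?nnegrE.
  - by apply: mulr_ge0 => //; exact: mulr_ge0.
  - by apply: mulr_ge0; [nonneg|apply: exprn_ge0; exact: ltW].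
  - by rewrite -!mulrA; apply: ler_wpM2l => //; apply: ler_wpM2l.
have e1 := ex (2 * K * 3) ltac:(nonneg).
have e2 := ex (2 * K * (2 ^ p).-1.+2%:R * p%:R) ltac:(nonneg).
rewrite -!(mulrA (2 * K * (2 ^ p).-1.+2%:R) p%:R) in e2.
have t0 : 0 <= 16 * (x * Mf * (x * Mf * (K + 1)) ^+ p).
  by apply: mulr_ge0 => //; apply: mulr_ge0; [nonneg; exact: ltW|apply: exprn_ge0; nonneg; exact: ltW].
apply: (@le_trans _ _ (16 * (x * Mf * (x * Mf * (K + 1)) ^+ p) *
   (expR (- (c * x ^+ (d * q).+1)) * (expR (A1 * x ^+ (d * q)) * expR (A2 * x ^+ (d * q)))))).
  rewrite -2!(mulrA (16 * _)); apply: ler_wpM2l => //.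
  rewrite -(mulrA (expR (- c * _))); apply: ler_pM => //; try exact: expR_ge0.
  by apply: ler_pM => //; exact: expR_ge0.
rewrite -!expRD.
rewrite (_ : - _ + _ = (A1 + A2) * x ^+ (d * q) - c * x ^+ (d * q).+1); last by rewrite mulrDl addrC.
rewrite (_ : 16 * _ = V * x ^+ p.+1); last first.
  by rewrite /V exprS !exprMn; move: (x ^+ p) (Mf ^+ p) ((K + 1) ^+ p) => y1 y2 y3; ring.
clearbody V; rewrite -!mulrA; apply: ler_wpM2l => //.
apply: (@le_trans _ _ (x ^+ p.+1 * (M * x ^- (D + p.+1)))).
  by apply: ler_wpM2l => //; apply: exprn_ge0; exact: ltW.
have xX j : x ^+ j != 0 by rewrite expf_neq0 // lt0r_neq0.
rewrite exprD; move: (x ^+ p.+1) (x ^+ D) (xX p.+1) (xX D) => y z y0 z0.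
by rewrite [leLHS](_ : _ = M / z) //; field; rewrite y0 z0.
Qed.

Lemma dev_moment_boundE k u : dev_moment_bound K q Mf u k =
  dev_moment_bound K q Mf 1 k * u%:R ^+ k.*2.+2.
Proof.
rewrite /dev_moment_bound -[1%:R * Mf]/(1 * Mf) (mul1r Mf) -(mulrA u%:R) exprMn.
by rewrite -[LHS]mulrA [LHS]mulrC.
Qed.

(** Of the two terms of [fluct_bound], the one with the moments of single cells has order n^(k+1)
    u^(2k+2). The decoupling term carries n^(2k+2) but is made bounded by the decay. *)
Lemma fluct_bound_le (k w : nat) : exists2 M : R, 0 <= M &
  forall (n u h : nat) (s : R), (0 < n)%N -> (0 < u)%N -> u%:R ^+ J <= s ->
    (n <= u ^ w)%N -> (h.*2 ^ d <= 4 ^ d * n)%N ->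
    fluct_bound d K ahat c q Mf u k (h.*2 ^ d)%:R s <= M * (n%:R ^+ k.+1 * u%:R ^+ k.*2.+2).
Proof.
(* Since n <= u^w, the decay u^(- w (2k+2)) cancels n^(2k+2). *)
have [Mc Mc0 hMc] := dev_cov_bound_le k.*2.+1 (w * k.*2.+2).
pose B : R := 4 ^+ d; have B1 : 1 <= B by rewrite /B exprn_ege1 // ler1n.
have B0 : 0 <= B by exact: le_trans B1.
pose Mm := dev_moment_bound K q Mf 1 k.
have Mm0 : 0 <= Mm by exact: dev_moment_bound_ge0.
pose F : R := 4 ^+ k.+1; have F0 : 0 <= F by rewrite /F; nonneg.
exists (expR F * (k.*2.+2%:R * B ^+ k.*2.+2 * Mc + F * (2 * B ^+ k.+1 * Mm))).
  apply: mulr_ge0; first exact: expR_ge0.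
  apply: addr_ge0; first by apply: mulr_ge0 => //; apply: mulr_ge0 => //; exact: exprn_ge0.
  apply: mulr_ge0 => //; apply: mulr_ge0 => //; apply: mulr_ge0 => //; exact: exprn_ge0.
move=> n u h s n0 u0 us nu hn.
have U1 : (1 : R) <= u%:R by rewrite ler1n.
have N1 : (1 : R) <= n%:R by rewrite ler1n.
have nu' : (n%:R : R) <= u%:R ^+ w by rewrite -natrX ler_nat.
have hn' : ((h.*2 ^ d)%:R : R) <= B * n%:R by rewrite /B -natrX -natrM ler_nat.
have Nm0 : (0 : R) <= (h.*2 ^ d)%:R by [].
have cov0 := dev_cov_bound_ge0 d ahat c q K1 Mf1 u k.*2.+1 s.
rewrite /fluct_bound dev_moment_boundE -/Mm -/F.
have := hMc u s u0 us.
move: (dev_cov_bound _ _ _ _ _ _ _ _ _) cov0 => cov cov0 {hMc us} hcov.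
move: ((h.*2 ^ d)%:R : R) hn' Nm0 => m mn m0 {hn nu}.
move: (u%:R : R) (n%:R : R) U1 N1 nu' mn hcov => x y x1 y1 yx my hcov.
have x0 : 0 < x by exact: lt_le_trans x1.
have y0 : 0 <= y by exact: le_trans y1.
have By0 : 0 <= B * y by exact: mulr_ge0.
have mX j : m ^+ j <= (B * y) ^+ j by apply: lerXn2r; rewrite ?nnegrE.
have By1 : 1 <= B * y by rewrite -[leLHS]mulr1; apply: ler_pM.
have yX : y ^+ k.*2.+2 <= x ^+ (w * k.*2.+2).
  by rewrite exprM; apply: lerXn2r; rewrite ?nnegrE // exprn_ge0 // ltW.
have xp1 : 1 <= x ^+ k.*2.+2 by exact: exprn_ege1.
have yk1 : 1 <= y ^+ k.+1 by exact: exprn_ege1.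
have t1 : m * (m ^+ k.*2.+1 * cov) <= B ^+ k.*2.+2 * Mc * (y ^+ k.+1 * x ^+ k.*2.+2).
  rewrite mulrA -exprS.
  have xD0 : 0 < x ^+ (w * k.*2.+2) by exact: exprn_gt0.
  apply: (@le_trans _ _ ((B * y) ^+ k.*2.+2 * (Mc / x ^+ (w * k.*2.+2)))).
    by apply: ler_pM => //; exact: exprn_ge0.
  have Bp0 : 0 <= B ^+ k.*2.+2 by exact: exprn_ge0.
  rewrite exprMn; move: (B ^+ k.*2.+2) (y ^+ k.*2.+2) (x ^+ (w * k.*2.+2)) Bp0 yX xD0.
  move=> b yy xx b0 yX xD0; rewrite -!mulrA; apply: ler_wpM2l => //.
  rewrite mulrCA; apply: ler_wpM2l => //.
  apply: (@le_trans _ _ 1); first by rewrite ler_pdivrMr // mul1r.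
  by rewrite -[leLHS]mulr1; apply: ler_pM.
have t2 : m * (m ^+ k + 1) <= 2 * B ^+ k.+1 * y ^+ k.+1.
  apply: (@le_trans _ _ (B * y * ((B * y) ^+ k + (B * y) ^+ k))).
    apply: ler_pM => //; first by apply: addr_ge0 => //; exact: exprn_ge0.
    by apply: lerD => //; exact: exprn_ege1.
  by rewrite -mulr2n mulrnAr -exprS exprMn -mulrA mulr_natl.
rewrite -[leRHS]mulrA; apply: ler_wpM2l; first exact: expR_ge0.
move: t1 t2; set X1 := x ^+ _; set Y1 := y ^+ _; set Z1 := m ^+ _; set Z2 := m ^+ _.
move=> t1 t2.
rewrite [leLHS](_ : _ = k.*2.+2%:R * (m * (Z1 * cov)) + F * ((m * (Z2 + 1)) * (Mm * X1))); last first.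
  by move: (k.*2.+2%:R : R) => kk; ring.
rewrite [leRHS](_ : _ = k.*2.+2%:R * (B ^+ k.*2.+2 * Mc * (Y1 * X1)) +
   F * ((2 * B ^+ k.+1 * Y1) * (Mm * X1))); last first.
  by move: (k.*2.+2%:R : R) (B ^+ k.*2.+2) (B ^+ k.+1) => kk b1 b2; ring.
apply: lerD; first exact: ler_wpM2l.
apply: ler_wpM2l => //; apply: ler_wpM2r => //; apply: mulr_ge0 => //.
by apply: exprn_ge0; exact: ltW.
Qed.

End asymptotics.

(** 2 (u+1) <= 4 u <= 4 v. This is the origin of the 5 in L = 5 u^J: separation u^J remains once the
    neighbourhoods are removed. *)
Lemma leq_spacing (u v : nat) : (0 < u)%N -> (u <= v)%N -> (v + 2 * u.+1 <= 5 * v)%N.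
Proof. lia. Qed.

Section polynomial_bounds.
Context (R : realType) (d : nat).
Local Notation E := 'rV[R]_d.
Local Notation N := (config R d).
Context (disp : measure_display) (Omega : measurableType disp)
  (P : probability Omega R) (pp : {RV P >-> N})
  (rho : forall p, p.-tuple E -> R) (palm : forall p, R.-pker p.-tuple E ~> N).
Hypotheses (d0 : (0 < d)%N) (ppalm : is_palm pp rho palm) (pcorr : is_correlation pp rho).
Context (a ahat b beta : R).
Hypotheses (a01 : 0 <= a < 1) (ahat0 : 0 < ahat) (edc : EDC rho a ahat).
Context (xi : E -> N -> R) (f : E -> R) (Mf : R).
Hypotheses (mxi : measurable_fun setT (fun v : E * N => xi v.1 v.2))
  (mf : measurable_fun setT f) (Mf1 : 1 <= Mf) (fM : forall x, `|f x| <= Mf)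
  (stab : stabilization palm xi b) (mom : moment_growth palm xi beta).

(* Here u is about n^(1/w) and L = 5 u^J. The exponent J makes u^(J ahat)
   dominate the u^(d q) lost in the decoupling, and w makes the product of the
   remaining powers of u at most of order n. *)
Lemma statistic_approximation (k : nat) : exists (A : nat -> Omega -> R) (C : R),
  [/\ 0 <= C, forall n, P.-integrable setT (EFin \o A n),
    forall n, (0 < n)%N ->
      (\int[P]_w (`|statistic xi f n (pp w) - A n w|)%:E <= (C * n%:R ^- 2)%:E)%E &
    forall n, (0 < n)%N ->
      (\int[P]_w ((A n w - \int[P]_v A n v) ^+ k.*2.+2)%:E <= (C * n%:R ^+ k.+2)%:E)%E].
Proof.
have /andP[a0 a1] := a01.
have [K [c [K1 c0 hrho hdec]]] := EDC_corr0 pcorr edc a0 ahat0.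
have K0 : 0 <= K by exact: le_trans K1.
have Mf0 : 0 <= Mf by exact: le_trans Mf1.
have [q qa] : exists q : nat, 1 <= q%:R * (1 - a).
  exists (Num.truncn (1 - a)^-1).+1.
  rewrite -ler_pdivrMr ?subr_gt0 // mul1r; exact/ltW/truncnS_gt.
have [J [J0 Jd]] : exists J : nat, (0 < J)%N /\ (d * q).+1%:R <= J%:R * ahat.
  exists (Num.truncn ((d * q).+1%:R / ahat)).+1; split => //.
  by rewrite -ler_pdivrMr //; exact/ltW/truncnS_gt.
have [Cs Cs0 hstab] := stab; have [Cm Cm1 hmom] := mom.
have Cm0 : 0 <= Cm by exact: le_trans Cm1.
(* Combining the (5 u^J)^d classes costs that number to the power p+1, and [fluct_bound_le] costs
   u^p. Their total exponent in u is w, so u^w of order n turns n^(k+1) into n^(k+2). *)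
pose p := k.*2.+2; pose w := (J * d * p.+1 + p)%N.
have w0 : (0 < w)%N by rewrite /w addn_gt0 orbT.
have [Mfl Mfl0 hfl] := fluct_bound_le K1 ahat0 c0 Mf1 Jd k w.
(* The pair consists of the scale u and the number h of unit cubes on each side of the origin; its
   value at n = 0 is a dummy. *)
have root n : exists uh : nat * nat, (0 < n)%N ->
    [/\ (0 < uh.1)%N, (n <= uh.1 ^ w)%N & (uh.1 ^ w <= 2 ^ w * n)%N] /\
    [/\ (0 < uh.2)%N, (n <= uh.2 ^ d)%N & (uh.2 ^ d <= 2 ^ d * n)%N].
  case: (posnP n) => [->|n0]; first by exists (0%N, 0%N).
  have [u hu] := nat_root_bounds n0 w0; have [h hh] := nat_root_bounds n0 d0.
  by exists (u, h).
have [uh huh] := choice root.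
pose A n (t : Omega) : R :=
  \sum_(i : {ffun 'I_d -> 'I_(uh n).2.*2}) trunc_stat pp xi f n (uh n).1 i t.
have algA n := window_algebra ppalm pcorr K1 hrho a0 qa n.
have admA n : exp_npts_bounded pp (window (Some n)) (A n).
  by apply: (adm_sum (algA n)) => i; exact: (adm_trunc_stat pp mxi mf Mf1 fM).
have hd n : (0 < n)%N -> ((uh n).2.*2 ^ d <= 4 ^ d * n)%N.
  move=> n0; have [_ [_ _ h]] := huh n n0.
  rewrite -mul2n expnMn; apply: (@leq_trans (2 ^ d * (2 ^ d * n))).
    by rewrite leq_mul2l h orbT.
  by rewrite mulnA -expnMn.
(* The error order w * 3 gives u^(-3w) <= n^-3, and the sum over at most 4^d n cells leaves n^-2. *)
pose CT := Mf * (4 ^+ d * (palm_err_const b beta Cs Cm (w * 3) * K)).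
pose CV := (5 ^+ d) ^+ p.+1 * Mfl * 2 ^+ w.
have pc0 : 0 <= palm_err_const b beta Cs Cm (w * 3) by apply: palm_err_const_ge0 => //; exact: ltW.
have CT0 : 0 <= CT by rewrite /CT; nonneg.
have CV0 : 0 <= CV by rewrite /CV; nonneg.
exists A, (CT + CV); split.
- exact: addr_ge0.
- by move=> n; exact: (adm_integrable (algA n) (admA n)).
- move=> n n0; have [[u0 nu _] [h0 nh _]] := huh n n0.
  have N0 : (0 : R) < n%:R by rewrite ltr0n.
  have rh : n%:R `^ d%:R^-1 <= (uh n).2%:R :> R.
    have h0' : (0 : R) <= (uh n).2%:R by [].
    rewrite (_ : (uh n).2%:R = ((uh n).2%:R ^+ d) `^ d%:R^-1 :> R); last first.
      by rewrite -powR_mulrn // -powRrM mulfV ?powRr1 // pnatr_eq0 -lt0n.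
    by apply: ge0_ler_powR; rewrite ?nnegrE ?invr_ge0 ?exprn_ge0 // -natrX ler_nat.
  have rhoK (x : 1.-tuple E) : rho x <= K.
    by have := hrho 1%N x; rewrite expr1 powR1 mulr1.
  have w30 : (0 < w * 3)%N by rewrite muln_gt0 w0.
  have := exp_statistic_sub_le ppalm pcorr mxi Mf1 fM n0 h0 u0 rh hstab hmom (ltW Cs0) Cm0 K0 rhoK w30.
  move=> /le_trans; apply; rewrite lee_fin.
  apply: (@le_trans _ _ (CT * n%:R ^- 2)); last first.
    by apply: ler_wpM2r; [rewrite invr_ge0 exprn_ge0|rewrite lerDl].
  rewrite /CT -[leRHS]mulrA; apply: ler_wpM2l => //.
  have hdR : (((uh n).2.*2 ^ d)%:R : R) <= 4 ^+ d * n%:R.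
    by rewrite -natrX -natrM ler_nat; exact: hd.
  have uR : ((uh n).1%:R : R) ^- (w * 3) <= n%:R ^- 3.
    rewrite lef_pV2 ?posrE ?exprn_gt0 ?ltr0n // exprM.
    by apply: lerXn2r; rewrite ?nnegrE ?exprn_ge0 // -natrX ler_nat.
  move: pc0; set pc := palm_err_const _ _ _ _ _ => pc0.
  apply: (@le_trans _ _ ((4 ^+ d * n%:R) * (n%:R ^- 3 * pc * K))).
    apply: ler_pM => //; first by apply: mulr_ge0 => //; apply: mulr_ge0 => //; rewrite invr_ge0 exprn_ge0.
    by rewrite -!mulrA; apply: ler_wpM2r => //; exact: mulr_ge0.
  rewrite le_eqVlt; apply/orP; left; apply/eqP.
  by move: (n%:R : R) (4 ^+ d : R) N0 => y z y0; field; rewrite lt0r_neq0.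
- move=> n n0; have [[u0 nu un] _] := huh n n0.
  set u := (uh n).1 in u0 nu un *; have hd' := hd n n0; set h := (uh n).2 in hd' *.
  have U1 : (1 : R) <= u%:R by rewrite ler1n.
  have N1 : (1 : R) <= n%:R by rewrite ler1n.
  pose L := (5 * u ^ J)%N.
  have uJ : (u <= u ^ J)%N by rewrite -[leqLHS]expn1; apply: leq_pexp2l.
  have L0 : (0 < L)%N by rewrite muln_gt0 expn_gt0 u0.
  have uL : (u%:R : R) ^+ J <= L%:R - 2 * u.+1%:R.
    by rewrite lerBrDr -natrX -natrM -natrD ler_nat; exact: leq_spacing.
  have s0 : 0 < (L%:R - 2 * u.+1%:R : R).
    by apply: (lt_le_trans _ uL); apply: exprn_gt0; exact: lt_le_trans U1.
  have AE t : A n t - \int[P]_v A n v =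
      \sum_(i : {ffun 'I_d -> 'I_h.*2}) trunc_dev pp xi f n u i t.
    rewrite /trunc_dev sumrB; congr (_ - _) => //; rewrite /A.
    by rewrite (exp_sum (algA n)) // => i; exact: (adm_trunc_stat pp mxi mf Mf1 fM).
  have admD : exp_npts_bounded pp (window (Some n)) (fun t => (A n t - \int[P]_v A n v) ^+ p).
    apply: (admX (algA n)); apply: (admB (algA n)) => //; exact: (adm_cst (algA n)).
  have := exp_sum_trunc_dev_le ppalm pcorr K1 hrho hdec a0 qa mxi mf Mf1 fM n h k L0 s0.
  rewrite (_ : \int[P]_t _ = \int[P]_t (A n t - \int[P]_v A n v) ^+ p); last first.
    by apply: eq_Rintegral => t _; rewrite AE.
  have fl := hfl n u h _ n0 u0 uL nu hd'.
  move=> hE.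
  have iD := adm_integrable (algA n) admD.
  rewrite -[leLHS]fineK; last first.
    exact: (integrable_fin_num measurableT iD).
  rewrite lee_fin; apply: (le_trans hE) => {hE}.
  apply: (@le_trans _ _ (CV * n%:R ^+ k.+2)); last first.
    by apply: ler_wpM2r; [exact: exprn_ge0|rewrite lerDr].
  have Ld0 : (0 : R) <= (L ^ d)%:R by [].
  rewrite mulrA -exprSr.
  apply: (le_trans (ler_wpM2l _ fl)); first exact: exprn_ge0.
  have LE : ((L ^ d)%:R : R) ^+ p.+1 = (5 ^+ d) ^+ p.+1 * u%:R ^+ (J * d * p.+1).
    by rewrite natrX /L natrM natrX !exprMn -!exprM !mulnA.
  have uw : (u%:R : R) ^+ (J * d * p.+1) * u%:R ^+ p <= 2 ^+ w * n%:R.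
    by rewrite -exprD -/w -!natrX -natrM ler_nat.
  rewrite LE /CV (exprS n%:R k.+1); move: uw Mfl0; rewrite -/p.
  have c50 : (0 : R) <= (5 ^+ d) ^+ p.+1 by rewrite !exprn_ge0.
  have nn0 : (0 : R) <= n%:R ^+ k.+1 by exact: exprn_ge0.
  move: (n%:R : R) ((5 ^+ d) ^+ p.+1 : R) (u%:R ^+ (J * d * p.+1) : R) (u%:R ^+ p : R) (n%:R ^+ k.+1 : R)
    (2 ^+ w : R) c50 nn0 => z c5 y y2 nn v c50 nn0 yv M0.
  rewrite [leLHS](_ : _ = c5 * Mfl * nn * (y * y2)); last by ring.
  rewrite [leRHS](_ : _ = c5 * Mfl * nn * (v * z)); last by ring.
  by apply: ler_wpM2l => //; apply: mulr_ge0 => //; exact: mulr_ge0.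
Qed.

End polynomial_bounds.

Theorem mainTheorem4 (R : realType) (d : nat) (d_gt0 : (0 < d)%N)
    (disp : measure_display) (Omega : measurableType disp)
    (P : probability Omega R) (pp : {RV P >-> config R d})
    (rho : forall p, p.-tuple 'rV[R]_d -> R)
    (palm : forall p, R.-pker p.-tuple 'rV[R]_d ~> config R d)
    (xi : 'rV[R]_d -> config R d -> R) (f : 'rV[R]_d -> R)
    (a ahat b beta gamma1 gamma2 : R) :
  measurable_fun setT f -> (exists M : R, forall x, `|f x| <= M) ->
  stationary pp -> is_correlation pp rho -> is_palm pp rho palm ->
  score_function xi -> translation_invariant xi ->
  0 <= a < 1 -> 0 < ahat -> EDC rho a ahat ->
  0 <= b -> stabilization palm xi b ->
  0 <= beta -> moment_growth palm xi beta ->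
  0 <= gamma1 -> 0 <= gamma2 -> power_growth xi gamma1 gamma2 ->
  0 < sigma2 rho palm xi *
      \int[lebesgue_vec R d]_(x in window (Some 1%N)) (f x ^+ 2) ->
  forall eps : R, 0 < eps ->
  {ae P, forall w,
    (statistic xi f n (pp w) -
       fine 'E_P[fun w' => statistic xi f n (pp w')]%E) /
    Num.sqrt n%:R `^ (1 + eps) @[n --> \oo] --> (0 : R)}.
Proof.
move=> mf [M fM] _ pcorr ppalm [mxi _] _ a01 ahat0 edc _ stab _ mom _ _ _ _ eps eps0.
have fM' x : `|f x| <= Num.max 1 M by rewrite le_max fM orbT.
have M1 : 1 <= Num.max 1 M by rewrite le_max lexx.
(* This gives (k+1) eps >= 3, as required by [sqrt_powR_exprn_ge]. *)
pose k := Num.truncn (3 / eps).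
have keps : 3%:R <= k.+1%:R * eps by rewrite -ler_pdivrMr //; exact/ltW/truncnS_gt.
have [A [C [C0 iA SA AA]]] :=
  statistic_approximation d_gt0 ppalm pcorr a01 ahat0 edc mxi mf M1 fM' stab mom k.
apply: (ae_cvg_of_approximation (S := fun n w => statistic xi f n (pp w)) keps C0 _ iA SA AA).
by move=> n; exact: (measurableT_comp (measurable_statistic mxi mf n) (measurable_pp pp)).
Qed.
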